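(* Let $\{B_t^H\}_{t\in\mathbb{R}}$ be a fractional Brownian motion with $H\in(\frac12,1)$ and let $\{\xi_t\}_{t\in\mathbb{R}}$ be a two-sided Lévy process independent of $B^H$. If $\lim_{t\to\infty}\xi_t=+\infty$ almost surely, then $$\overline Y_t=e^{-\xi_t}\int_{-\infty}^t e^{\xi_{s-}}\,dB_s^H$$ exists for all $t\ge0$ and the process $\overline Y=\{\overline Y_t\}_{t\ge0}$ is strictly stationary.
   Context: A fractional Brownian motion (FBM) with index $H$ is a centered Gaussian process $\{B^H_t\}_{t\in\mathbb{R}}$ with $B_0^H=0$ and $\mathrm{Cov}(B_t^H,B_s^H)=\frac12(|t|^{2H}+|s|^{2H}-|t-s|^{2H})$, taken with continuous paths. A two-sided Lévy process is $\xi_t=\xi^1_t$ for $t\ge0$ and $\xi_t=-\xi^2_{-t-}$ for $t<0$, where $\{\xi^1_t\}_{t\ge0}$ and $\{\xi^2_t\}_{t\ge0}$ are independent copies of a real-valued Lévy process. The processes live on a complete product space $(\Omega_1\times\Omega_2,\mathscr F_1\otimes\mathscr F_2,P_1\otimes P_2)$, with $\xi$ defined on $\Omega_1$ and $B^H$ on $\Omega_2$. $\overline Y_t$ is defined as the limit in probability, as $n\to\infty$, of $Z_t^n=\sum_{i=1}^n e^{-\xi_t+\xi_{u_{i-1}^n}}(B^H_{u_i^n}-B^H_{u_{i-1}^n})$, where $-N_n=u_0^n<u_1^n<\dots<u_n^n=t$ are deterministic points with $\max_i(u_i^n-u_{i-1}^n)\downarrow0$ and $N_n\uparrow\infty$;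 ''exists'' means that this limit exists and does not depend on the choice of the points. Strictly stationary means that for all $0\le t_1<\dots<t_m$ and $h>0$, $(\overline Y_{t_1},\dots,\overline Y_{t_m})$ and $(\overline Y_{t_1+h},\dots,\overline Y_{t_m+h})$ have the same distribution. *)

(* Defs.v *)
From mathcomp Require Import all_boot all_order all_algebra.
From mathcomp Require Import all_classical all_reals all_analysis.

Set Implicit Arguments.
Unset Strict Implicit.
Unset Printing Implicit Defensive.

Import Order.TTheory GRing.Theory Num.Theory.
Import numFieldNormedType.Exports.

Local Open Scope classical_set_scope.
Local Open Scope ring_scope.

Section processes.
Context (d : measure_display) (T : measurableType d) (R : realType).
Implicit Types (P : {measure set T -> \bar R}).

(* Taking some of the A i to be setT yields the product rule for every
   subfamily. *)
Definition mutually_independent P (n : nat) (X : 'I_n -> T -> R) : Prop :=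
  forall A : 'I_n -> set R, (forall i, measurable (A i)) ->
    P (\bigcap_i (X i @^-1` A i)) = (\prod_(i < n) P (X i @^-1` A i))%E.

Definition process_sigma_algebra (D : set R) (X : R -> T -> R) : set (set T) :=
  <<s \bigcup_(t in D) preimage_set_system setT (X t) measurable >>.

Definition independent_processes P (D : set R) (X Y : R -> T -> R) : Prop :=
  forall A B, process_sigma_algebra D X A -> process_sigma_algebra D Y B ->
    P (A `&` B) = (P A * P B)%E.

Definition finite_dim_law P (X : R -> T -> R) (n : nat) (t : 'I_n -> R) :
    set (n.-tuple R) -> \bar R :=
  pushforward P (fun w => [tuple X (t i) w | i < n]).

Definition same_finite_dim_laws P (D : set R) (X Y : R -> T -> R) : Prop :=
  forall (n : nat) (t : 'I_n -> R), (forall i, D (t i)) ->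
  forall A : set (n.-tuple R), measurable A ->
    finite_dim_law P X t A = finite_dim_law P Y t A.

Definition strictly_stationary P (Y : R -> T -> R) : Prop :=
  forall (m : nat) (t : 'I_m -> R) (h : R), 0 < h -> (forall i, 0 <= t i) ->
    {homo t : i j / (i < j)%N >-> i < j} ->
  forall A : set (m.-tuple R), measurable A ->
    finite_dim_law P Y t A = finite_dim_law P Y (fun i => t i + h) A.

Definition cvg_in_probability P {I : Type} (F : set_system I)
    (X : I -> T -> R) (Y : T -> R) : Prop :=
  forall e : R, 0 < e -> P [set w | e < `|X i w - Y w|] @[i --> F] --> 0%E.

(* Real Lévy process; only the values X t with 0 <= t matter. As in Sato's
   book, X 0 = 0 and the càdlàg property are required almost surely. *)
Record levy_process P (X : R -> T -> R) : Prop := {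
  levy_measurable : forall t : R, 0 <= t -> measurable_fun setT (X t) ;
  levy_start0 : {ae P, forall w, X 0 w = 0} ;
  levy_independent_increments : forall (n : nat) (t : nat -> R),
    0 <= t 0%N -> (forall i, (i < n)%N -> t i < t i.+1) ->
    mutually_independent P (fun i : 'I_n => X (t i.+1) \- X (t i)) ;
  levy_stationary_increments : forall s t : R, 0 <= s -> 0 <= t ->
    forall A : set R, measurable A ->
      pushforward P (X (s + t) \- X s) A = pushforward P (X t \- X 0) A ;
  levy_stochastically_continuous : forall t : R, 0 <= t ->
    cvg_in_probability P (within [set s : R | 0 <= s] (nbhs t)) X (X t) ;
  levy_cadlag : {ae P, forall w,
    (forall t : R, 0 <= t -> X s w @[s --> t^'+] --> X t w) /\
    (forall t : R, 0 < t -> cvg (X s w @[s --> t^'-])) } }.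

Definition two_sided_levy_process P (xi : R -> T -> R) : Prop :=
  exists xi1 xi2 : R -> T -> R,
    [/\ levy_process P xi1, levy_process P xi2,
        same_finite_dim_laws P [set t : R | 0 <= t] xi1 xi2,
        independent_processes P [set t : R | 0 <= t] xi1 xi2 &
        forall (t : R) (w : T), xi t w =
          if 0 <= t then xi1 t w else - lim (xi2 s w @[s --> (- t)^'-])].

(* normal_prob m 0 is not the Dirac mass at m in the library, so the
   degenerate normal law is a separate case. *)
Definition gaussian_variable P (X : T -> R) : Prop :=
  (exists m : R, forall A : set R, measurable A ->
     pushforward P X A = (\d_m : set R -> \bar R) A) \/
  (exists m s : R, 0 < s /\ forall A : set R, measurable A ->
     pushforward P X A = normal_prob m s A).

Definition gaussian_process P (X : R -> T -> R) : Prop :=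
  forall (n : nat) (a t : 'I_n -> R),
    gaussian_variable P (fun w => \sum_(i < n) a i * X (t i) w).

End processes.

Record fractional_brownian_motion (d : measure_display) (T : measurableType d)
    (R : realType) (P : probability T R) (H : R) (B : R -> T -> R) : Prop := {
  fbm_measurable : forall t, measurable_fun setT (B t) ;
  fbm_gaussian : gaussian_process P B ;
  fbm_centered : forall t, expectation P (B t) = 0%E ;
  fbm_start0 : forall w, B 0 w = 0 ;
  fbm_covariance : forall t s : R, covariance P (B t) (B s) =
    (2^-1 * (`|t| `^ (2 * H) + `|s| `^ (2 * H) - `|t - s| `^ (2 * H)))%:E ;
  fbm_continuous : forall w, continuous (B ^~ w) }.

Section generalized_fOU.
Context (d1 d2 : measure_display) (T1 : measurableType d1)
  (T2 : measurableType d2) (R : realType)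
  (P1 : probability T1 R) (P2 : probability T2 R).

(* T1 * T2 with the completed product sigma-algebra, and the completion of
   the product probability (Carathéodory extension of P1 \x P2). *)
Definition complete_product : measurableType _ :=
  caratheodory_type ((P1 \x P2)%E^*)%mu.

Definition complete_product_prob : {measure set complete_product -> \bar R} :=
  @completed_measure_extension _ _ _ (P1 \x P2)%E.

Context (xi : R -> T1 -> R) (B : R -> T2 -> R).

Definition mesh (n : nat) (u : nat -> R) : R :=
  \big[Num.max/0]_(i < n) (u i.+1 - u i).

(* The n-th partition (n > 0) is u n 0 < u n 1 < ... < u n n, and N_n is
   - u n 0. *)
Record admissible_partitions (t : R) (u : nat -> nat -> R) : Prop := {
  partition_last : forall n, (0 < n)%N -> u n n = t ;
  partition_increasing : forall n i, (i < n)%N -> u n i < u n i.+1 ;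
  partition_mesh_decr : forall m n, (0 < m <= n)%N ->
    mesh n (u n) <= mesh m (u m) ;
  partition_mesh_cvg0 : mesh n (u n) @[n --> \oo] --> 0 ;
  partition_start_incr : forall m n, (0 < m <= n)%N ->
    - u m 0%N <= - u n 0%N ;
  partition_start_cvgy : - u n 0%N @[n --> \oo] --> +oo }.

Definition riemann_sum (t : R) (n : nat) (u : nat -> R)
    (w : T1 * T2) : R :=
  \sum_(i < n) expR (- xi t w.1 + xi (u i) w.1) * (B (u i.+1) w.2 - B (u i) w.2).

(* Yt is a version of e^{-xi_t} \int_{-oo}^t e^{xi_{s-}} dB_s. *)
Definition is_Ybar (t : R) (Yt : complete_product -> R) : Prop :=
  measurable_fun setT Yt /\
  forall u, admissible_partitions t u ->
    cvg_in_probability complete_product_prob \oo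
      (fun n => riemann_sum t n (u n)) Yt.

End generalized_fOU.

(* Main.v *)
Require Import Defs.
From mathcomp Require Import all_boot all_order all_algebra.
From mathcomp Require Import all_classical all_reals all_analysis.
From mathcomp Require Import measurable_realfun ring lra.
Import Order.TTheory GRing.Theory Num.Theory.
Import numFieldNormedType.Exports.
Local Open Scope classical_set_scope.
Local Open Scope ring_scope.

Set Implicit Arguments.
Unset Strict Implicit.
Unset Printing Implicit Defensive.

(** Existence. Fix a path of xi. The Riemann sums are, up to the factor
    exp(- xi_t), integrals against B of the step functions equal to exp(xi_(u_i))
    on [u_i, u_(i+1)[. For H > 1/2 the second moment of the integral of a step
    function is at most 3 N (K + N), where K bounds the function and N its
    L1 norm (step_sum_moment2_le). The step functions of finer and finer
    partitions tend to the left limits of exp(xi) off the countable set of the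
    partition points, and they are dominated by the running supremum of exp(xi)
    over the past. If this supremum is integrable, the step functions of two
    sequences of partitions become close in L1 (stepf_L1), hence their integrals
    in mean square. Averaging over the paths of xi, the difference of the Riemann
    sums tends to 0 in probability for any two sequences of partitions
    (riemann_sums_close): each sequence is Cauchy, and all have the same limit.

    Integrability of the supremum. Let U_n be the supremum of exp(xi) over the
    times before - n. Since the increments of xi are stationary, the mean a_n of
    U_(n+k) / U_k does not depend on k, so that U_(n+1) / U_1 - U_(n+1) / U_0,
    which is nonnegative, has mean a_n - a_(n+1). Summing over n, the sum of the
    U_n is almost surely finite where U_1 < U_0, and likewise where
    U_(k+1) < U_k. As xi tends to - oo at - oo, U_n tends to 0, and one of these
    inequalities holds (past_sup_summable).

    Stationarity. By the argument of Cramer and Wold, finite measures on tuples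
    are equal as soon as they give the same mean to all cosines of affine forms
    (cramer_wold), and convergence in probability preserves these means. It is
    therefore enough to compare the Riemann sums for t and for t + h, over
    partitions that are translates of each other. The coefficients depend only
    on differences of values of xi, whose joint law is invariant under shifts;
    given the coefficients, the sum is a centred Gaussian variable whose
    variance is invariant under shifts as well (functional_shift).

    The stationarity of the increments on the whole line comes from the fact that
    over a grid that contains 0 they are independent, with laws that depend on
    the lengths of the cells only (two_sided_grid). Path properties are obtained
    by modifying xi on a null set (regular_modification); the drift of the
    negative half is inherited from that of the positive half, since both have
    the same finite-dimensional laws (levy_drift_transfer). *)

(** * Finite measures on tuples are determined by cosine waves *)

Section bounded_functions.
Context d (T : measurableType d) (R : realType) (mu : {measure set T -> \bar R}).
Hypothesis mufin : (mu setT < +oo)%E.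

Lemma bounded_integrable (f : T -> R) (M : R) :
  measurable_fun setT f -> (forall x, `|f x| <= M) ->
  mu.-integrable setT (EFin \o f).
Proof.
move=> mf fM; apply: measurable_bounded_integrable => //.
exists M; split; first by rewrite num_real.
by move=> y My x _; rewrite /= (le_trans (fM x))// ltW.
Qed.

Lemma bounded_Rintegral_cvg (f_ : nat -> T -> R) (f : T -> R) (M : R) :
  (forall n, measurable_fun setT (f_ n)) -> (forall n x, `|f_ n x| <= M) ->
  (forall x, f_ n x @[n --> \oo] --> f x) ->
  (\int[mu]_x f_ n x)%R @[n --> \oo] --> (\int[mu]_x f x)%R.
Proof.
move=> mf fM cf.
have mlim : measurable_fun setT f.
  exact: (measurable_realfun.measurable_fun_cvg mf (fun x _ => cf x)).
have ib : mu.-integrable setT (EFin \o (cst M : T -> R)).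
  exact: (@bounded_integrable (cst M) `|M|).
have mf' n : measurable_fun setT (fun x => (f_ n x)%:E) by exact/measurable_EFinP.
have mlim' : measurable_fun setT (fun x => (f x)%:E) by exact/measurable_EFinP.
have cf' : {ae mu, forall x, setT x -> (f_ n x)%:E @[n --> \oo] --> (f x)%:E}.
  by apply: aeW => x _; apply: cvg_EFin; [exact: nearW|exact: cf].
have fM' : {ae mu, forall x n, setT x ->
    (`|(f_ n x)%:E| <= (EFin \o (cst M : T -> R)) x)%E}.
  by apply: aeW => x n _; rewrite /= lee_fin.
have [fint _ cvg] := dominated_convergence measurableT mf' mlim' cf' ib fM'.
apply: (@fine_cvg _ _ _ _ _ (\int[mu]_x f x)%R).
rewrite fineK; first exact: cvg.
exact: (integrable_fin_num measurableT fint).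
Qed.

End bounded_functions.

Section cramer_wold.
Context (R : realType) (n : nat).
Local Notation T := (n.-tuple R).
Variables (m1 m2 : {measure set T -> \bar R}).
Hypotheses (fin1 : (m1 setT < +oo)%E) (fin2 : (m2 setT < +oo)%E).

Definition wave (th : 'I_n -> R) (b : R) (x : T) : R :=
  cos (\sum_(i < n) th i * tnth x i + b).

Lemma measurable_wave th b : measurable_fun setT (wave th b).
Proof.
apply: measurableT_comp; first exact: continuous_measurable_fun (@continuous_cos R).
apply: measurable_funD => //; apply: measurable_sum => i.
by apply: measurable_funM => //; exact: measurable_tnth.
Qed.

Lemma waveM th b th' b' x : wave th b x * wave th' b' x =
  2^-1 * wave (fun i => th i + th' i) (b + b') x +
  2^-1 * wave (fun i => th i - th' i) (b - b') x.
Proof.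
rewrite /wave; set u := \sum_(i < n) th i * _; set v := \sum_(i < n) th' i * _.
have -> : \sum_(i < n) (th i + th' i) * tnth x i = u + v.
  by rewrite -big_split; apply: eq_bigr => i _; rewrite mulrDl.
have -> : \sum_(i < n) (th i - th' i) * tnth x i = u - v.
  by rewrite -sumrB; apply: eq_bigr => i _; rewrite mulrBl.
have -> : u + v + (b + b') = (u + b) + (v + b') by ring.
have -> : u - v + (b - b') = (u + b) - (v + b') by ring.
rewrite (cosD (u + b)) (cosB (u + b)); lra.
Qed.

(** The functions whose products with all waves are not distinguished by the two
    measures. Products are tested rather than the functions themselves because
    a product of waves is again a combination of waves. *)
Record tested (f : T -> R) : Prop := Tested {
  tested_meas : measurable_fun setT f ;
  tested_bnd : exists M, forall x, `|f x| <= M ;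
  tested_eq : forall th b,
    (\int[m1]_x (f x * wave th b x) = \int[m2]_x (f x * wave th b x))%R }.

(** Unlike the tested functions, the multipliers form an algebra. It contains
    the waves and is closed under bounded pointwise limits, which is enough to
    reach the indicators of rectangles. *)
Record multiplier (g : T -> R) : Prop := Multiplier {
  mult_meas : measurable_fun setT g ;
  mult_bnd : exists M, forall x, `|g x| <= M ;
  mult_tested : forall f, tested f -> tested (fun x => f x * g x) }.

Lemma tested_int (m : {measure set T -> \bar R}) f th b :
  (m setT < +oo)%E -> tested f ->
  m.-integrable setT (EFin \o (fun x => f x * wave th b x)).
Proof.
move=> mfin [mf [M fM] _]; apply: (@bounded_integrable _ _ _ _ mfin _ M).
  by apply: measurable_funM => //; exact: measurable_wave.
move=> x; rewrite normrM -[leRHS]mulr1; apply: ler_pM => //; exact: cos_max.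
Qed.

Lemma testedD f g : tested f -> tested g -> tested (fun x => f x + g x).
Proof.
move=> tf tg; have [mf [M fM] ef] := tf; have [mg [N gN] eg] := tg.
split; first exact: measurable_funD.
  exists (M + N) => x; exact: le_trans (ler_normD _ _) (lerD _ _).
move=> th b.
under eq_Rintegral do rewrite mulrDl.
under [RHS]eq_Rintegral do rewrite mulrDl.
rewrite RintegralD//; [|exact: tested_int..].
by rewrite RintegralD//; [rewrite ef eg|exact: tested_int..].
Qed.

Lemma testedZ c f : tested f -> tested (fun x => c * f x).
Proof.
move=> tf; have [mf [M fM] ef] := tf; split; first exact: measurable_funM.
  by exists (`|c| * M) => x; rewrite normrM ler_wpM2l.
move=> th b.
under eq_Rintegral do rewrite -mulrA.
under [RHS]eq_Rintegral do rewrite -mulrA.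
rewrite RintegralZl//; last exact: tested_int.
by rewrite RintegralZl//; [rewrite ef|exact: tested_int].
Qed.

Lemma tested_wave f th b : tested f -> tested (fun x => f x * wave th b x).
Proof.
move=> tf; have [mf [M fM] ef] := tf; split.
- by apply: measurable_funM => //; exact: measurable_wave.
- exists M => x; rewrite normrM -[leRHS]mulr1; apply: ler_pM => //; exact: cos_max.
- move=> th' b'.
  have E x : f x * wave th b x * wave th' b' x =
     2^-1 * f x * wave (fun i => th i + th' i) (b + b') x +
     2^-1 * f x * wave (fun i => th i - th' i) (b - b') x.
    by rewrite -mulrA waveM; ring.
  under eq_Rintegral do rewrite E.
  under [RHS]eq_Rintegral do rewrite E.
  have t2 := testedZ 2^-1 tf.
  rewrite RintegralD//; [|exact: (tested_int _ _ fin1 t2)..].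
  rewrite RintegralD//; [|exact: (tested_int _ _ fin2 t2)..].
  by rewrite !(tested_eq t2).
Qed.

Lemma tested_lim (f_ : nat -> T -> R) (f : T -> R) (M : R) : (forall k, tested (f_ k)) ->
  (forall k x, `|f_ k x| <= M) -> (forall x, f_ k x @[k --> \oo] --> f x) ->
  tested f.
Proof.
move=> tf fM cf; split.
- exact: (measurable_realfun.measurable_fun_cvg (fun k => tested_meas (tf k))
    (fun x _ => cf x)).
- exists M => x; have cn : `|f_ k x| @[k --> \oo] --> `|f x| by apply: cvg_norm.
  by rewrite -(cvg_lim _ cn)//; apply: limr_le; [apply/cvg_ex; eexists; exact: cn|exact: nearW].
- move=> th b.
  have c (m : {measure set T -> \bar R}) : (m setT < +oo)%E -> (\int[m]_x (f_ k x * wave th b x))%R @[k --> \oo] -->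
      (\int[m]_x (f x * wave th b x))%R.
    move=> mfin; apply: (@bounded_Rintegral_cvg _ _ _ _ mfin _ _ M).
    - by move=> k; apply: measurable_funM; [exact: tested_meas|exact: measurable_wave].
    - move=> k x; rewrite normrM -[leRHS]mulr1; apply: ler_pM => //; exact: cos_max.
    - by move=> x; apply: cvgM; [exact: cf|exact: cvg_cst].
  rewrite -(cvg_lim _ (c _ fin1))// -(cvg_lim _ (c _ fin2))//.
  by congr (limn _); apply/funext => k; exact: tested_eq.
Qed.

Lemma mult_wave th b : multiplier (wave th b).
Proof.
split; first exact: measurable_wave.
  by exists 1 => x; exact: cos_max.
by move=> f; exact: tested_wave.
Qed.

Lemma mult_cst c : multiplier (fun=> c).
Proof.
split => //; first by exists `|c|.
move=> f tf; rewrite (_ : (fun _ => _) = (fun x => c * f x)).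
  exact: testedZ.
by apply/funext => x; rewrite mulrC.
Qed.

Lemma multM f g : multiplier f -> multiplier g -> multiplier (fun x => f x * g x).
Proof.
move=> [mf [M fM] tf] [mg [N gN] tg]; split; first exact: measurable_funM.
  exists (M * N) => x; rewrite normrM; exact: ler_pM.
move=> h th; rewrite (_ : (fun _ => _) = (fun x => (h x * f x) * g x)).
  by apply: tg; exact: tf.
by apply/funext => x; rewrite mulrA.
Qed.

Lemma multD f g : multiplier f -> multiplier g -> multiplier (fun x => f x + g x).
Proof.
move=> [mf [M fM] tf] [mg [N gN] tg]; split; first exact: measurable_funD.
  exists (M + N) => x; exact: le_trans (ler_normD _ _) (lerD _ _).
move=> h th; rewrite (_ : (fun _ => _) = (fun x => (h x * f x) + (h x * g x))).
  by apply: testedD; [exact: tf|exact: tg].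
by apply/funext => x; rewrite mulrDr.
Qed.

Lemma mult_compl f : multiplier f -> multiplier (fun x => 1 - f x).
Proof.
move=> mf; rewrite (_ : (fun _ => _) = (fun x => 1 + (-1) * f x)).
  by apply: multD; [exact: mult_cst|apply: multM => //; exact: mult_cst].
by apply/funext => x; rewrite mulN1r.
Qed.

Lemma multX f k : multiplier f -> multiplier (fun x => f x ^+ k).
Proof.
move=> mf; elim: k => [|k ih].
  by under eq_fun do rewrite expr0; exact: mult_cst.
by under eq_fun do rewrite exprS; exact: multM.
Qed.

Lemma mult_lim (f_ : nat -> T -> R) (f : T -> R) (M : R) : (forall k, multiplier (f_ k)) ->
  (forall k x, `|f_ k x| <= M) -> (forall x, f_ k x @[k --> \oo] --> f x) ->
  multiplier f.
Proof.
move=> tf fM cf; split.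
- exact: (measurable_realfun.measurable_fun_cvg (fun k => mult_meas (tf k))
    (fun x _ => cf x)).
- exists M => x; have cn : `|f_ k x| @[k --> \oo] --> `|f x| by apply: cvg_norm.
  by rewrite -(cvg_lim _ cn)//; apply: limr_le; [apply/cvg_ex; eexists; exact: cn|exact: nearW].
- move=> h th; have [mh [N hN] _] := th.
  apply: (@tested_lim (fun k x => h x * f_ k x) _ (N * M)).
  + by move=> k; exact: mult_tested.
  + by move=> k x; rewrite normrM; apply: ler_pM.
  + by move=> x; apply: cvgM; [exact: cvg_cst|exact: cf].
Qed.

End cramer_wold.

Lemma cvg_natM_expr (R : realType) (q : R) : 0 <= q -> q < 1 ->
  k%:R * q ^+ k @[k --> \oo] --> (0 : R).
Proof.
rewrite le_eqVlt => /predU1P[<- _|q0 q1].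
  apply/cvgrPdist_lt => e e0; near=> k.
  rewrite expr0n gtn_eqF ?mulr0 ?subrr ?normr0//; near: k; exact: nbhs_infty_gt.
have [c c0 qE] : exists2 c, 0 < c & forall k, q ^+ k = (expR (k%:R * c))^-1.
  exists (- ln q) => [|k]; first by rewrite oppr_gt0 ln_lt0// q0.
  by rewrite -expRN -mulrN opprK expRM_natl lnK// posrE.
have lim : (2 / c ^+ 2) * (k.+1%:R)^-1 @[k --> \oo] --> (0 : R).
  rewrite -[X in _ --> X](mulr0 (2 / c ^+ 2)); apply: cvgMr; exact: cvg_harmonic.
rewrite -cvg_shiftS.
apply: (squeeze_cvgr _ (cvg_cst _) lim); apply: nearW => k /=; apply/andP; split.
  by rewrite mulr_ge0// exprn_ge0// ltW.
have x0 : 0 < k.+1%:R * c by rewrite mulr_gt0.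
have h := expR_ge1Dxn 1 (ltW x0).
have h' : (k.+1%:R * c) ^+ 2 / 2 <= expR (k.+1%:R * c).
  apply: le_trans h; rewrite -[2%R in X in X <= _]/(2`!%:R) lerDr//.
rewrite qE; have k0 : (0 : R) < k.+1%:R by [].
rewrite ler_pdivrMr ?expR_gt0// .
apply: le_trans (ler_wpM2l _ h'); last first.
  by rewrite mulr_ge0 ?invr_ge0 ?ltW ?divr_gt0 ?exprn_gt0.
have c1 : c != 0 by rewrite gt_eqF.
rewrite le_eqVlt; apply/orP; left; apply/eqP; field.
by rewrite c1 gt_eqF// -natr1 addrC in k0 *.
Unshelve. all: by end_near. Qed.

Lemma mean_value (R : realType) (f df : R -> R) (x y : R) :
  (forall z, is_derive z (1 : R) f (df z)) ->
  exists2 c, `|c - x| <= `|y - x| & f y - f x = df c * (y - x).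
Proof.
move=> fd; have cf : continuous f.
  by move=> z; apply: differentiable_continuous; apply/derivable1_diffP; exact: (@ex_derive _ _ _ _ _ _ _ (fd z)).
have [xy|yx] := leP x y.
  have [|c] := @MVT_segment R f df x y xy (fun z _ => fd z); first exact: continuous_subspaceT.
  rewrite in_itv/= => /andP[xc cy] E; exists c => //.
  by rewrite !ger0_norm ?subr_ge0//; lra.
have [|c] := @MVT_segment R f df y x (ltW yx) (fun z _ => fd z); first exact: continuous_subspaceT.
rewrite in_itv/= => /andP[xc cy] E; exists c.
  rewrite !ler0_norm ?subr_le0//; lra.
lra.
Qed.

Lemma cos_lip (R : realType) (x y : R) : `|cos x - cos y| <= `|x - y|.
Proof.
have [c _ ->] := @mean_value R cos (fun z => - sin z) y x (fun z => is_derive_cos z).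
by rewrite normrM ler_piMl// normrN sin_max.
Qed.

Lemma sin_mean (R : realType) (v : R) : exists2 c, `|c| <= `|v| & sin v = cos c * v.
Proof.
have [c] := @mean_value R sin cos 0 v (fun z => is_derive_sin z).
by rewrite !subr0 sin0 subr0 => ? ?; exists c.
Qed.

Lemma sin_lt (R : realType) (v : R) : 0 < v -> v < 2 -> sin v < v.
Proof.
move=> v0 v2.
have [|c] := @MVT R sin cos 0 v v0 (fun z _ => is_derive_sin z).
  exact/continuous_subspaceT/continuous_sin.
rewrite in_itv/= !subr0 sin0 subr0 => /andP[c0 cv] ->.
rewrite gtr_pMl// -cos0 ltr_cos// in_itv/= ?lexx ?pi_ge0// (ltW c0)/=.
by rewrite ltW// (lt_trans cv)// (lt_le_trans v2)// pi_ge2.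
Qed.

(** N sin(u / sqrt N)^2 tends to u^2, which settles all u except u = 1 and
    u = -1; there the strict inequality sin v < v puts the limit on the side of
    the closed ball. *)
Lemma cvg_sin_ball (R : realType) (u : R) :
  ((sin (u / Num.sqrt N.+1%:R) ^+ 2 * N.+1%:R < 1)%R%:R : R) @[N --> \oo] -->
  ((`|u| <= 1)%R%:R : R).
Proof.
have sq0 N : 0 < Num.sqrt (N.+1%:R : R) by rewrite sqrtr_gt0 ltr0Sn.
have sqE N : Num.sqrt (N.+1%:R : R) ^+ 2 = N.+1%:R by rewrite sqr_sqrtr.
have E N : exists2 c, `|c| <= `|u| / Num.sqrt (N.+1%:R : R) &
   sin (u / Num.sqrt N.+1%:R) ^+ 2 * N.+1%:R = cos c ^+ 2 * u ^+ 2.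
  have [c cu ->] := sin_mean (u / Num.sqrt N.+1%:R).
  exists c; first by rewrite -(gtr0_norm (sq0 N)) -normf_div.
  rewrite -[in X in _ * X](sqE N); field. by rewrite gt_eqF.
have [u1|u1] := leP.
  apply: cvg_near_cst; apply: nearW => N.
  suff -> : sin (u / Num.sqrt N.+1%:R) ^+ 2 * N.+1%:R < 1 by [].
  have -> : sin (u / Num.sqrt N.+1%:R) ^+ 2 = sin (`|u| / Num.sqrt N.+1%:R) ^+ 2.
    by case: (ger0P u) => // _; rewrite mulNr sinN sqrrN.
  have [->|u0] := eqVneq u 0; first by rewrite normr0 mul0r sin0 expr0n mul0r.
  have v0 : 0 < `|u| / Num.sqrt N.+1%:R by rewrite divr_gt0// normr_gt0.
  have v1 : `|u| / Num.sqrt N.+1%:R <= 1.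
    rewrite ler_pdivrMr// mul1r (le_trans u1)// -[leLHS]sqrtr1 ?ler_sqrt ?ler1n ?ler0n//.
  have h := sin_lt v0 (le_lt_trans v1 (ltr1n R 2)).
  rewrite -ltr_pdivlMr// (lt_le_trans (y := (`|u| / Num.sqrt N.+1%:R) ^+ 2))//.
    by rewrite ltr_pXn2r// ?nnegrE ?ltW// sin_gt0_pi// v0 (le_lt_trans v1)// (lt_le_trans _ (pi_ge2 R))// ltr1n.
  by rewrite expr_div_n sqE ler_pM2r ?invr_gt0// expr_le1.
apply: cvg_near_cst; near=> N.
suff /negbTE -> : ~~ (sin (u / Num.sqrt N.+1%:R) ^+ 2 * N.+1%:R < 1) by [].
rewrite -leNgt.
have [c cu ->] := E N.
have cc : 1 - `|c| <= cos c.
  by have := cos_lip 0 c; rewrite cos0 sub0r normrN => /(le_trans (ler_norm _)); lra.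
have u0 : 0 < `|u| by rewrite (lt_trans _ u1).
have sN : `|u| ^+ 2 / (`|u| - 1) <= Num.sqrt (N.+1%:R : R).
  have q0 : 0 <= `|u| ^+ 2 / (`|u| - 1) by rewrite divr_ge0 ?exprn_ge0// subr_ge0 ltW.
  rewrite -(@ler_pXn2r _ 2%N)// ?nnegrE//.
  rewrite sqE -natr1; apply: ler_wpDr => //; near: N; exact: nbhs_infty_ger.
have k1 : `|u| / Num.sqrt N.+1%:R <= 1 - `|u|^-1.
  rewrite ler_pdivrMr//; move: sN; rewrite ler_pdivrMr ?subr_gt0// => sN.
  rewrite -(ler_pM2l u0) -expr2 (le_trans sN)// le_eqVlt; apply/orP; left; apply/eqP.
  by field; rewrite gt_eqF.
have : 1 <= cos c * `|u|.
  apply: (@le_trans _ _ ((1 - (1 - `|u|^-1)) * `|u|)).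
    by rewrite opprB addrC subrK mulVf// gt_eqF// (lt_trans _ u1).
  rewrite ler_wpM2r//; lra.
move=> h; rewrite -[u ^+ 2]real_normK ?num_real// -exprMn.
by rewrite -[leLHS](expr1n _ 2) ler_pXn2r// ?nnegrE// (le_trans _ h).
Unshelve. all: by end_near. Qed.

(** Polynomials approximating the indicator of a half-line: the quantity is at
    least 1 - k (z N)^k by Bernoulli's inequality, and at most
    exp(- k (z N)^k). *)
Lemma cvg_threshold (R : realType) (z : R) (N : nat) : 0 <= z -> z <= 1 ->
  (1 - z ^+ k) ^+ (k * N ^ k) @[k --> \oo] --> ((z * N%:R < 1)%R%:R : R).
Proof.
move=> z0 z1; have zk0 k : 0 <= z ^+ k by exact: exprn_ge0.
have zk1 k : z ^+ k <= 1 by exact: exprn_ile1.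
case: ltP => zN.
  have q0 : 0 <= z * N%:R by rewrite mulr_ge0.
  have lim1 : (1 - k%:R * (z * N%:R) ^+ k) @[k --> \oo] --> (1 : R).
    rewrite -[X in _ --> X]subr0; apply: cvgB; first exact: cvg_cst.
    exact: cvg_natM_expr.
  apply: (squeeze_cvgr _ lim1 (cvg_cst _)).
  apply: nearW => k; apply/andP; split; last first.
    by apply: exprn_ile1; rewrite ?subr_ge0// gerBl.
  have bern m : 1 - m%:R * z ^+ k <= (1 - z ^+ k) ^+ m.
    elim: m => [|m ih]; first by rewrite mul0r subr0 expr0.
    rewrite exprS; apply: le_trans (ler_wpM2l _ ih); last by rewrite subr_ge0.
    rewrite -natr1; have : 0 <= m%:R * z ^+ k * z ^+ k by rewrite !mulr_ge0.
    by lra.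
  apply: le_trans (bern _).
  by rewrite exprMn natrM natrX -mulrA [N%:R ^+ k * _]mulrC.
have lim0 : (expR (- k%:R)) @[k --> \oo] --> (0 : R) by exact: cvgn_expR.
apply: (squeeze_cvgr _ (cvg_cst _) lim0).
apply: nearW => k; apply/andP; split; first by apply: exprn_ge0; rewrite subr_ge0.
have h : 1 - z ^+ k <= expR (- z ^+ k) by exact: expR_ge1Dx.
apply: (@le_trans _ _ (expR (- z ^+ k) ^+ (k * N ^ k))).
  by rewrite lerXn2r ?nnegrE ?expR_ge0 ?subr_ge0.
rewrite -expRM_natl ler_expR mulrN lerN2 natrM natrX -mulrA -[leLHS]mulr1.
by rewrite ler_wpM2l// mulrC -exprMn exprn_ege1.
Qed.

Section cramer_wold_conclusion.
Context (R : realType) (n : nat).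
Local Notation T := (n.-tuple R).
Variables (m1 m2 : {measure set T -> \bar R}).
Hypotheses (fin1 : (m1 setT < +oo)%E) (fin2 : (m2 setT < +oo)%E).
Local Notation multiplier := (multiplier m1 m2).

Lemma mult_sin2 (i : 'I_n) (a c : R) :
  multiplier (fun x => sin ((tnth x i - a) * c) ^+ 2).
Proof.
suff E x : sin ((tnth x i - a) * c) ^+ 2 =
   1 - wave (fun j => (j == i)%:R * c) (- a * c) x ^+ 2.
  by under eq_fun do rewrite E; apply: mult_compl => //; apply: multX => //; exact: mult_wave.
rewrite sin2cos2 /wave (bigD1 i)//= eqxx mul1r big1 ?addr0; last first.
  by move=> j /negPf ->; rewrite !mul0r.
by congr (1 - cos _ ^+ 2); ring.
Qed.

(** A closed ball is a limit, as N grows, of the sets where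
    N sin((x - a) / (r sqrt N))^2 < 1, and the indicator of such a set is a limit
    of polynomials in a squared sine. *)
Lemma mult_ball (i : 'I_n) (a r : R) : 0 < r ->
  multiplier (fun x => (`|tnth x i - a| <= r)%R%:R).
Proof.
move=> r0.
have b01 (b : bool) : `|b%:R : R| <= 1 by case: b; rewrite /= ?normr1 ?normr0.
have mN N (c : R) : multiplier (fun x => (sin ((tnth x i - a) * c) ^+ 2 * N%:R < 1)%R%:R).
  have z0 x : 0 <= sin ((tnth x i - a) * c) ^+ 2 by exact: sqr_ge0.
  have z1 x : sin ((tnth x i - a) * c) ^+ 2 <= 1.
    by rewrite -real_normK ?num_real// expr_le1// sin_max.
  apply: (@mult_lim _ _ _ _ fin1 fin2 (fun k x => (1 - (sin ((tnth x i - a) * c) ^+ 2) ^+ k) ^+ (k * N ^ k)) _ 1).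
  - move=> k; apply: multX => //; apply: mult_compl => //; apply: multX => //.
    exact: mult_sin2.
  - move=> k x; set z := sin _ ^+ 2 ^+ k.
    have [zk0 zk1] : 0 <= z /\ z <= 1 by split; [exact: exprn_ge0|exact: exprn_ile1].
    have u0 : 0 <= 1 - z by rewrite subr_ge0.
    by rewrite ger0_norm ?exprn_ge0// exprn_ile1// gerBl.
  - by move=> x; apply: cvg_threshold.
apply: (@mult_lim _ _ _ _ fin1 fin2 (fun N x =>
    (sin ((tnth x i - a) * (r * Num.sqrt N.+1%:R)^-1) ^+ 2 * N.+1%:R < 1)%R%:R) _ 1) => //.
move=> x.
have -> : `|tnth x i - a| <= r = (`|(tnth x i - a) / r| <= 1).
  by rewrite normf_div (gtr0_norm r0) ler_pdivrMr// mul1r.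
have -> : (fun N => (sin ((tnth x i - a) * (r * Num.sqrt N.+1%:R)^-1) ^+ 2 * N.+1%:R < 1)%R%:R) =
  (fun N => (sin ((tnth x i - a) / r / Num.sqrt N.+1%:R) ^+ 2 * N.+1%:R < 1)%R%:R : R).
  by apply/funext => N; rewrite invfM mulrA.
exact: cvg_sin_ball.
Qed.

(** Half-lines are increasing unions of balls, and they generate the Borel sets. *)
Lemma mult_borel (i : 'I_n) (A : set R) : measurable A ->
  multiplier (fun x => \1_A (tnth x i)).
Proof.
pose P (A : set R) := multiplier (fun x => \1_A (tnth x i)).
have bnd (A' : set R) (x : R) : `|\1_A' x : R| <= 1.
  by rewrite indicE; case: (_ \in _); rewrite /= ?normr1 ?normr0.
have b01 (b : bool) : `|b%:R : R| <= 1 by case: b; rewrite /= ?normr1 ?normr0.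
have PC S : P S -> P (~` S).
  move=> PS; rewrite /P (_ : (fun _ => _) = fun x => 1 - \1_S (tnth x i)).
    exact: mult_compl.
  by apply/funext => x; rewrite indicC indicE; case: (_ \in _); rewrite ?subrr ?subr0.
have PI S S' : P S -> P S' -> P (S `&` S').
  by move=> PS PS'; rewrite /P indicI; exact: multM.
have PT : P setT.
  rewrite /P (_ : (fun _ => _) = fun=> 1); first exact: mult_cst.
  by apply/funext => x; rewrite indicT.
move=> mA; have := mA.
rewrite [measurable](RGenCInfty.measurableE R); apply: (@dynkin_induction _ _ _ P) => //.
- exact: RGenCInfty.measurableE.
- move=> _ _ [a ->] [c ->]; exists (Num.max a c).
  by apply/seteqP; split=> x /=; rewrite !in_itv/= !andbT ge_max; [move=> [-> ->]|move=> /andP].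
- move=> _ [a ->]; rewrite /P.
  apply: (@mult_lim _ _ _ _ fin1 fin2 (fun k x =>
    (`|tnth x i - (a + k.+1%:R)| <= k.+1%:R)%R%:R) _ 1) => //.
    by move=> k; apply: mult_ball.
  move=> x; rewrite indicE; apply: cvg_near_cst; near=> k.
  congr (_ %:R); congr nat_of_bool.
  have kx : tnth x i - a <= k.+1%:R.
    by rewrite -natr1; apply: ler_wpDr => //; near: k; exact: nbhs_infty_ger.
  rewrite mem_setE in_itv/= andbT ler_norml; apply/andP/idP.
    by move=> [? ?]; lra.
  by move=> ax; split; [|move: kx]; have := ler0n R k.+1; lra.
- by move=> S _; exact: PC.
- move=> F mF tF PF; rewrite /P.
  apply: (@mult_lim _ _ _ _ fin1 fin2 (fun k x => \1_(\big[setU/set0]_(j < k) F j) (tnth x i)) _ 1) => //.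
    elim=> [|k ih].
      by rewrite big_ord0 -setCT; exact: PC.
    by rewrite big_ord_recr/= -[_ `|` _]setCK setCU; exact: (PC _ (PI _ _ (PC _ _) (PC _ _))).
  move=> x; apply: cvg_near_cst.
  have [[j _ Fj]|xF] := pselect ((\bigcup_k F k) (tnth x i)).
    near=> k; rewrite !indicE !mem_set//; first by exists j.
    by rewrite -bigcup_mkord; exists j => //=; near: k; exact: nbhs_infty_gt.
  near=> k; rewrite !indicE !memNset// -bigcup_mkord => -[j _ Fj].
  by apply: xF; exists j.
Unshelve. all: by end_near. Qed.

Lemma mult_rect (A : 'I_n -> set R) : (forall i, measurable (A i)) ->
  multiplier (fun x => \prod_(i < n) \1_(A i) (tnth x i)).
Proof.
move=> mA; elim: (index_enum _) => [|i s ih].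
  by under eq_fun do rewrite big_nil; exact: mult_cst.
under eq_fun do rewrite big_cons.
by apply: multM => //; exact: mult_borel.
Qed.

Definition rect (A : 'I_n -> set R) : set T := [set x | forall i, A i (tnth x i)].

Lemma indic_rect (A : 'I_n -> set R) x :
  \1_(rect A) x = \prod_(i < n) \1_(A i) (tnth x i) :> R.
Proof.
rewrite indicE; have [xA|xA] := boolP (x \in rect A).
  rewrite big1// => i _; rewrite indicE mem_set//.
  by move: xA; rewrite inE; apply.
have /existsNP[i Ai] : ~ forall i, A i (tnth x i).
  by move=> h; move/negP: xA; apply; rewrite inE.
by rewrite (bigD1 i)//= indicE memNset// mul0r.
Qed.

Lemma measurable_rect (A : 'I_n -> set R) : (forall i, measurable (A i)) ->
  measurable (rect A).
Proof.
move=> mA; rewrite (_ : rect A = \bigcap_(i in [set: 'I_n]) ((@tnth n R)^~ i @^-1` A i)).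
  apply: fin_bigcap_measurable => // i _; rewrite -[X in measurable X]setTI.
  exact: measurable_tnth.
by apply/seteqP; split=> x /=; [move=> h i _; exact: h|move=> h i; exact: h].
Qed.

Lemma rect_unique : (forall A, (forall i, measurable (A i)) -> m1 (rect A) = m2 (rect A)) ->
  forall A, measurable A -> m1 A = m2 A.
Proof.
move=> E; pose G := [set rect A | A in [set A | forall i, measurable (A i)]].
have GT : G setT by exists (fun=> setT) => //; apply/seteqP.
apply: (measure_unique G (fun=> setT)) => //.
- apply/seteqP; split.
    move=> A; apply: smallest_sub; first exact: smallest_sigma_algebra.
    elim/big_ind : _ => //; first by move=> ? ? h1 h2; rewrite subUset.
    move=> i _ _ [B mB <-]; apply: sub_sigma_algebra; rewrite setTI.
    exists (fun j => if j == i then B else setT) => /=; first by move=> j; case: ifP.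
    apply/seteqP; split => x /=; first by move=> /(_ i); rewrite eqxx.
    by move=> Bx j; case: ifPn => // /eqP ->.
  apply: smallest_sub; first exact: sigma_algebra_measurable.
  by move=> _ [A mA <-]; exact: measurable_rect.
- move=> _ _ [A mA <-] [B mB <-]; exists (fun i => A i `&` B i).
    by move=> i; apply: measurableI.
  apply/seteqP; split => x /=; first by move=> h; split=> i; have [] := h i.
  by move=> [h1 h2] i; split.
- by rewrite bigcup_const//; exists 0%N.
- by move=> _ [A mA <-]; exact: E.
Qed.

End cramer_wold_conclusion.

(** The indicator of a rectangle is a multiplier, and the constant 1 is tested:
    hence the two measures agree on rectangles. *)
Lemma cramer_wold (R : realType) (n : nat) (m1 m2 : {measure set (n.-tuple R) -> \bar R}) :
  (m1 setT < +oo)%E -> (m2 setT < +oo)%E ->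
  (forall th b, (\int[m1]_x wave th b x = \int[m2]_x wave th b x)%R) ->
  forall A, measurable A -> m1 A = m2 A.
Proof.
move=> f1 f2 E; apply: (rect_unique f1) => A mA.
have t1 : tested m1 m2 (fun=> 1).
  split => //; first by exists 1 => x; rewrite normr1.
  by move=> th b; under eq_Rintegral do rewrite mul1r; rewrite E; apply: eq_Rintegral => x _; rewrite mul1r.
have := tested_eq (mult_tested (mult_rect f1 f2 mA) t1) (fun=> 0) 0.
have H (m : {measure set (n.-tuple R) -> \bar R}) : (m setT < +oo)%E ->
   (\int[m]_x (1 * (\prod_(i < n) \1_(A i) (tnth x i)) * wave (fun=> 0) 0 x))%R = fine (m (rect A)).
  move=> mf; rewrite /Rintegral; congr fine.
  under eq_integral => x _.
    rewrite mul1r -indic_rect /wave big1; last by move=> i _; rewrite mul0r.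
    rewrite addr0 cos0 mulr1; over.
  by rewrite integral_indic ?setIT//; exact: measurable_rect.
rewrite !H// => h.
have fn (m : {measure set (n.-tuple R) -> \bar R}) : (m setT < +oo)%E -> m (rect A) \is a fin_num.
  move=> mf; rewrite ge0_fin_numE//; apply: le_lt_trans mf; apply: le_measure; rewrite ?inE//; exact: measurable_rect.
by rewrite -[LHS]fineK ?fn// h fineK ?fn.
Qed.

(** * Centred Gaussian laws *)

(** The pushforward as a measure: the measurability of f is part of the data that
    makes it countably additive. *)
Definition image_measure d d' (T1 : measurableType d) (T2 : measurableType d')
    (R : realType) (m : {measure set T1 -> \bar R}) (f : T1 -> T2)
    (mf : measurable_fun setT f) : {measure set T2 -> \bar R} :=
  measure_function_pushforward__canonical__measure_function_Measure m mf.

Section standard_normal.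
Context (R : realType).
Local Notation N01 := (normal_prob (0 : R) 1).
Local Notation mu := (@lebesgue_measure R).
Local Notation mR := (measurableTypeR R).

Definition affine (m s : R) (y : mR) : mR := (m + s * y)%R.

Lemma measurable_affine (m s : R) : measurable_fun setT (affine m s).
Proof. by apply: measurable_funD => //; exact: measurable_funM. Qed.

Lemma lebesgue_measure_affine (m s : R) : 0 < s -> forall A : set mR, measurable A ->
  mu A = (s%:E * mu (affine m s @^-1` A))%E.
Proof.
move=> s0.
pose nu : {measure set mR -> \bar R} :=
  mscale (NngNum (ltW s0)) (image_measure mu (measurable_affine m s)).
apply: (@lebesgue_measure_unique R nu) => _ [[a b] _ <-].
rewrite /nu/= /mscale/= /pushforward.
have -> : affine m s @^-1` `]a, b]%classic = `](a - m) / s, (b - m) / s]%classic.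
  apply/seteqP; split => y /=; rewrite !in_itv/= /affine ltr_pdivrMr// ler_pdivlMr// [s * y]mulrC => /andP[? ?]; apply/andP; split; lra.
rewrite !lebesgue_measure_itv/= !lte_fin ltr_pM2r ?invr_gt0// ltrD2r.
case: ifPn => ab; last by rewrite mule0.
rewrite -!EFinB -EFinM; congr EFin; field.
by rewrite gt_eqF.
Qed.

Lemma normal_prob_affine (m s : R) : 0 < s -> forall A : set mR, measurable A ->
  normal_prob m s A = N01 (affine m s @^-1` A).
Proof.
move=> s0 A mA; rewrite /normal_prob.
pose nu : {measure set mR -> \bar R} :=
  mscale (NngNum (ltW s0)) (image_measure mu (measurable_affine m s)).
have mpdf m' s' : measurable_fun setT (fun x : mR => (normal_pdf m' s' x)%:E).
  by apply/measurable_EFinP; exact: measurable_normal_pdf.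
rewrite (eq_measure_integral nu); last first.
  by move=> B mB _; exact: lebesgue_measure_affine.
rewrite ge0_integral_mscale//; last 2 first.
- exact: measurable_funS (mpdf m s).
- by move=> x _; rewrite lee_fin normal_pdf_ge0.
rewrite ge0_integral_pushforward//; last 3 first.
- exact: measurable_affine.
- exact: measurable_funS (mpdf m s).
- by move=> x _; rewrite lee_fin normal_pdf_ge0.
have mA' : measurable (affine m s @^-1` A).
  by rewrite -[X in measurable X]setTI; exact: measurable_affine.
rewrite -ge0_integralZl//=; last 3 first.
- exact: measurable_funS (measurableT_comp (mpdf m s) (measurable_affine m s)).
- by move=> x _; rewrite lee_fin normal_pdf_ge0.
- by rewrite lee_fin ltW.
apply: eq_integral => y _; rewrite -EFinM; congr EFin.
rewrite !normal_pdfE ?gt_eqF//.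
rewrite /normal_peak /normal_fun /affine -mulrnAr sqrtrM ?sqr_ge0// sqrtr_sqr gtr0_norm//.
rewrite expr1n mul1r invfM -[s^-1 * _ * _]mulrA mulVKf ?gt_eqF//; congr (_ * expR _).
by field; rewrite gt_eqF.
Qed.

Lemma normal_prob_sym (A : set mR) : measurable A -> N01 (-%R @^-1` A) = N01 A.
Proof.
move=> mA; rewrite /normal_prob.
have mN : measurable_fun setT (-%R : mR -> mR) by exact: oppr_measurable.
have mpdf : measurable_fun setT (fun x : mR => (normal_pdf (0 : R) 1 x)%:E).
  by apply/measurable_EFinP; exact: measurable_normal_pdf.
rewrite [RHS](eq_measure_integral (image_measure mu mN)); last first.
  by move=> B mB _; rewrite [RHS](_ : _ = pushforward mu (-%R : mR -> mR) B)//; rewrite lebesgue_measureN.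
have pdf0 : {in A, forall x : mR, 0 <= (normal_pdf (0 : R) 1 x)%:E}%E.
  by move=> x _; rewrite lee_fin normal_pdf_ge0.
have -> := ge0_integral_pushforward mN mu mA (measurable_funTS mpdf) pdf0.
apply: eq_integral => y _ /=; congr EFin.
by rewrite !normal_pdfE ?oner_eq0// /normal_fun !subr0 sqrrN.
Qed.

Lemma normal_prob_set1 (a : R) : N01 [set a] = 0%E.
Proof.
have := @normal_prob_dominates R 0 1; move=> /null_content_dominatesP; apply => //.
exact: lebesgue_measure_set1.
Qed.

(** Positivity of this number is enough to recover from its second moment the
    scale of a centred Gaussian law, so its value is left uncomputed. *)
Definition second_moment : \bar R := (\int[N01]_y (y ^+ 2)%:E)%E.

Lemma second_moment_gt0 : (0 < second_moment)%E.
Proof.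
rewrite lt_neqAle integral_ge0 ?andbT; last by move=> y _; rewrite lee_fin sqr_ge0.
apply/negP => /eqP/esym E.
have m2 : measurable_fun setT (fun y : mR => (y ^+ 2)%:E).
  by apply/measurable_EFinP; exact: measurable_funX.
have : (\int[N01]_y `|(y ^+ 2)%:E| = 0)%E.
  by under eq_integral do rewrite gee0_abs ?lee_fin ?sqr_ge0//.
move/(ae_eq_integral_abs N01 measurableT m2) => [A [mA A0 sub]].
have : (N01 setT <= N01 [set 0%R] + N01 A)%E.
  apply: (@le_trans _ _ (N01 ([set 0%R] `|` A))); last exact: measureU2.
  apply: le_measure; rewrite ?inE//; first exact: measurableU.
  move=> y _; have [->|y0] := eqVneq y 0; [by left|right].
  apply: sub => /= h; have /eqP := h I; rewrite eqe sqrf_eq0; exact/negP.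
by rewrite normal_prob_set1 A0 adde0 probability_setT lee_fin ler10.
Qed.

(** Symmetry of the standard normal law replaces the computation of its mean. *)
Lemma affine_mean0 (m s : R) :
  N01.-integrable setT (EFin \o affine m s) ->
  (\int[N01]_y (affine m s y)%:E = 0)%E -> m = 0.
Proof.
move=> intf E.
have mN : measurable_fun setT (-%R : mR -> mR) by exact: oppr_measurable.
have mA t : measurable_fun setT (fun y : mR => (affine m t y)%:E).
  by apply/measurable_EFinP; exact: measurable_affine.
have NE A : measurable A -> N01 A = image_measure N01 mN A.
  by move=> mA'; rewrite -normal_prob_sym.
have intf' : N01.-integrable setT (EFin \o affine m (- s)).
  apply/integrableP; split; first exact: mA.
  move/integrableP : (intf) => [_]; apply: le_lt_trans.
  rewrite [leRHS](eq_measure_integral (image_measure N01 mN)); last first.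
    by move=> A mA' _; exact: NE.
  rewrite (ge0_integral_pushforward mN)//=; last first.
    by apply/measurable_EFinP; apply: measurableT_comp => //; exact: measurable_affine.
  by rewrite /affine; under [leRHS]eq_integral do rewrite mulrN -mulNr.
have E' : (\int[N01]_y (affine m (- s) y)%:E = 0)%E.
  rewrite -E [RHS](eq_measure_integral (image_measure N01 mN)); last first.
    by move=> A mA' _; exact: NE.
  rewrite integral_pushforward//=.
    by apply: eq_integral => y _; rewrite /affine /= mulrN -mulNr.
  apply: eq_integrable intf' => // y _.
  by rewrite /affine/= mulrN -mulNr.
have : (\int[N01]_y ((affine m s y)%:E + (affine m (- s) y)%:E) = 0)%E.
  by rewrite integralD//= E E' adde0.
under eq_integral do rewrite -EFinD /affine addrACA mulNr subrr addr0.
rewrite integral_cst//= probability_setT mule1 => -[] /eqP.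
by rewrite -mulr2n mulrn_eq0/= => /eqP.
Qed.

End standard_normal.

Section centered_gaussian.
Context d (T : measurableType d) (R : realType) (P : probability T R).
Local Notation N01 := (normal_prob (0 : R) 1).
Local Notation mR := (measurableTypeR R).

Lemma integrable_of_sqr (Y : T -> R) : measurable_fun setT Y ->
  P.-integrable setT (fun w => (Y w ^+ 2)%:E) -> P.-integrable setT (fun w => (Y w)%:E).
Proof.
move=> mY iY2; have i1 : P.-integrable setT (fun w => 1 + (Y w ^+ 2)%:E)%E.
  by apply: integrableD => //; exact: finite_measure_integrable_cst.
apply: le_integrable i1 => //; first exact/measurable_EFinP.
move=> w _ /=; rewrite lee_fin [leRHS]ger0_norm; last by rewrite addr_ge0// sqr_ge0.
rewrite -[Y w ^+ 2]real_normK ?num_real//; have := normr_ge0 (Y w).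
by have := sqr_ge0 (`|Y w| - 1); have := sqr_ge0 `|Y w|; rewrite sqrrB1; lra.
Qed.

(** Scale 0 covers the degenerate law. *)
Lemma gaussian_affine (X : T -> R) : gaussian_variable P X ->
  exists m s : R, 0 <= s /\ forall A : set R, measurable A ->
    P (X @^-1` A) = N01 (affine m s @^-1` A).
Proof.
move=> [[m E]|[m [s [s0 E]]]].
  exists m, 0; split => // A mA.
  have -> : affine m 0 @^-1` A = if m \in A then setT else set0.
    apply/seteqP; case: ifPn => mA'; rewrite /affine; split => y //=; rewrite mul0r addr0 => h.
      by rewrite inE in mA'.
    by move/negP: mA' => /(_ (mem_set h)).
  have := E A mA; rewrite /pushforward => ->; rewrite diracE; case: (_ \in _) => /=.
    by rewrite probability_setT.
  by rewrite measure0.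
exists m, s; split; first exact: ltW.
by move=> A mA; rewrite -normal_prob_affine//; exact: E.
Qed.

Lemma gaussian_integral (X : T -> R) m s (mX : measurable_fun setT X) :
  (forall A : set R, measurable A -> P (X @^-1` A) = N01 (affine m s @^-1` A)) ->
  forall f : mR -> \bar R, measurable_fun setT f ->
  P.-integrable setT (f \o X) ->
  N01.-integrable setT (f \o affine m s) /\
  (\int[P]_w f (X w) = \int[N01]_y f (affine m s y))%E.
Proof.
move=> E f mf intf.
have mA := @measurable_affine R m s.
have mX' : measurable_fun setT (X : T -> mR) by exact: mX.
have i1 : (image_measure P mX').-integrable setT f.
  exact: integrable_pushforward.
have i2 : N01.-integrable setT (f \o affine m s).
  apply/integrableP; split; first exact: measurableT_comp.
  move/integrableP : (i1) => [_]; apply: le_lt_trans.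
  rewrite [leRHS](eq_measure_integral (image_measure N01 mA)); last first.
    by move=> A mA' _; exact: E.
  by rewrite (ge0_integral_pushforward mA)//=; exact: measurableT_comp.
split=> //.
transitivity (\int[image_measure P mX']_y f y)%E.
  by rewrite integral_pushforward.
transitivity (\int[image_measure N01 mA]_y f y)%E.
  by apply: eq_measure_integral => A mA' _; exact: E.
by rewrite integral_pushforward.
Qed.

(** Both laws are images of the standard normal law under affine maps: the mean
    fixes the translation and the second moment fixes the scale. *)
Lemma centered_gaussian_law (X X' : T -> R) :
  measurable_fun setT X -> measurable_fun setT X' ->
  gaussian_variable P X -> gaussian_variable P X' ->
  P.-integrable setT (fun w => (X w ^+ 2)%:E) ->
  P.-integrable setT (fun w => (X' w ^+ 2)%:E) ->
  (\int[P]_w (X w)%:E = 0)%E -> (\int[P]_w (X' w)%:E = 0)%E ->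
  (\int[P]_w (X w ^+ 2)%:E = \int[P]_w (X' w ^+ 2)%:E)%E ->
  forall A : set R, measurable A -> P (X @^-1` A) = P (X' @^-1` A).
Proof.
move=> mX mX' /gaussian_affine[m [s [s0 E]]] /gaussian_affine[m' [s' [s0' E']]].
move=> iX2 iX2' X0 X0' XX'.
have msq : measurable_fun setT (fun y : R => (y ^+ 2)%:E).
  by apply/measurable_EFinP; exact: measurable_funX.
have key (Y : T -> R) (t u : R) : measurable_fun setT Y -> 0 <= u ->
    (forall A : set R, measurable A -> P (Y @^-1` A) = N01 (affine t u @^-1` A)) ->
    P.-integrable setT (fun w => (Y w ^+ 2)%:E) -> (\int[P]_w (Y w)%:E = 0)%E ->
    t = 0 /\ (\int[P]_w (Y w ^+ 2)%:E = (u ^+ 2)%:E * second_moment R)%E.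
  move=> mY u0 EY iY2 Y0.
  have iY : P.-integrable setT (EFin \o Y) by exact: integrable_of_sqr.
  have t0 : t = 0.
    have [|h1 h2] := @gaussian_integral Y t u mY EY EFin _ iY; first exact: EFin_measurable.
    by apply: affine_mean0 h1 _; rewrite -h2.
  split=> //.
  have [_ ->] := @gaussian_integral Y t u mY EY (fun y => (y ^+ 2)%:E) msq iY2.
  rewrite /second_moment -ge0_integralZl//=.
  - by apply: eq_integral => y _; rewrite -EFinM t0 /affine add0r exprMn.
  - by move=> y _; rewrite lee_fin sqr_ge0.
  - by rewrite lee_fin sqr_ge0.
have [m0 v] := key X m s mX s0 E iX2 X0.
have [m0' v'] := key X' m' s' mX' s0' E' iX2' X0'.
suff ss : s = s' by move=> A mA; rewrite E// E'// m0 m0' ss.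
have f := integrable_fin_num measurableT iX2.
have f' := integrable_fin_num measurableT iX2'.
rewrite v in f; rewrite v' in f'; move: XX'; rewrite v v'.
move: f f'; have := second_moment_gt0 R; case: (second_moment R) => [k| |]//.
  rewrite lte_fin => k0 _ _ [] /(mulIf (lt0r_neq0 k0)) ss.
  by apply/eqP; rewrite -(eqrXn2 (n := 2))// ss.
have sq0 (u : R) : ((u ^+ 2)%:E * +oo)%E \is a fin_num -> u = 0.
  have [->//|u0] := eqVneq u 0; rewrite gt0_muley ?lte_fin ?exprn_even_gt0//.
by move=> _ /sq0 -> /sq0 ->.
Qed.

End centered_gaussian.

(** * The covariance kernel of fractional Brownian motion *)

Lemma is_derive_shiftr (R : realType) (f : R -> R) (a x df : R) :
  is_derive (x + a) (1 : R) f df -> is_derive x (1 : R) (fun y => f (y + a)) df.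
Proof.
move=> fd; rewrite -[df]mulr1.
have := @is_derive1_comp R f (fun y => y + a) x df 1.
by apply => //; rewrite -[X in is_derive _ _ _ X]addr0; apply: is_deriveD.
Qed.

Section power_kernel.
Context (R : realType) (q : R).
Hypotheses (q0 : 0 < q) (q1 : q < 1).

Lemma powR_anti (e x y : R) : e <= 0 -> 0 < x -> x <= y -> y `^ e <= x `^ e.
Proof.
move=> e0 x0 xy; rewrite -[e]opprK !(powRN _ (- e)) lef_pV2 ?posrE ?powR_gt0 ?(lt_le_trans x0)//.
by apply: ge0_ler_powR; rewrite ?oppr_ge0// nnegrE ltW// (lt_le_trans x0).
Qed.

(** With q + 1 = 2H this is the variogram; the long memory regime H > 1/2 is
    q > 0. *)
Definition abspow (x : R) := `|x| `^ (q + 1).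

Lemma is_derive_abspow (x : R) : 0 < x -> is_derive x (1 : R) abspow ((q + 1) * x `^ q).
Proof.
move=> x0; have := is_derive1_powR (q + 1) x0; rewrite addrK.
apply: near_eq_is_derive; near=> y; rewrite /abspow ger0_norm//.
by apply: ltW; near: y; exact: lt_nbhsr.
Unshelve. all: by end_near. Qed.

Lemma continuous_abspow : continuous abspow.
Proof.
have pos x : 0 < x -> {for x, continuous abspow}.
  move=> x0; apply: differentiable_continuous; apply/derivable1_diffP.
  exact: (@ex_derive _ _ _ _ _ _ _ (is_derive_abspow x0)).
move=> x; have [x0|x0|->] := ltgtP x 0; last 2 first.
- exact: pos.
- rewrite /continuous_at /abspow normr0 powR0; last by rewrite gt_eqF// addr_gt0.
  apply/cvgrPdist_lt => e e0.
  have /cvgrPdist_lt/(_ e e0) := @powR_cvg0 R (q + 1) (addr_gt0 q0 ltr01).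
  rewrite near_withinE => -[r r0 h]; exists r => // y /= yr.
  rewrite /abspow; have [->|y0] := eqVneq y 0.
    by rewrite normr0 powR0 ?subrr ?normr0// gt_eqF// addr_gt0.
  by apply: (h `|y|); rewrite /= ?normr_gt0// sub0r normrN normr_id -[`|y|]normrN -[- y]sub0r.
have -> : abspow = abspow \o -%R by apply/funext => y; rewrite /abspow/= normrN.
apply: continuous_comp; first exact: (@opp_continuous R^o).
by apply: pos; rewrite oppr_gt0.
Qed.

(** For x > 0, half the variogram is the sum of a function whose derivative is
    Lipschitz, so that its second differences are bounded by products of lengths,
    and of a convex function with bounded derivative, whose second differences
    are nonnegative and telescope. Neither the second derivative x^(q-1) near 0
    nor the growth of the derivative x^q at infinity is an obstacle then. *)
Definition lipschitz_half (x : R) := 2^-1 * abspow (1 + x) - (q + 1) / 2 * x.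
Definition convex_half (x : R) := 2^-1 * abspow x - lipschitz_half x.

(** The derivative of the convex half, up to the factor (q + 1) / 2. *)
Definition slope (x : R) := x `^ q - (1 + x) `^ q + 1.

Lemma slope_ge0 (x : R) : 0 < x -> 0 <= slope x.
Proof.
move=> x0; have x10 : 0 < 1 + x by rewrite addr_gt0.
have sp y : 0 < y -> y `^ q = y * y `^ (q - 1).
  by move=> y0; rewrite -{2}[y](powRr1 (ltW y0)) -powRD ?gt_eqF ?implybT// addrC subrK.
rewrite /slope (sp _ x10) mulrDl mul1r (sp x x0).
have h1 : (1 + x) `^ (q - 1) <= x `^ (q - 1).
  by apply: powR_anti => //; [rewrite subr_le0 ltW|rewrite lerDr].
have h2 : (1 + x) `^ (q - 1) <= 1.
  rewrite [leRHS](_ : 1 = 1 `^ (q - 1)); last by rewrite powR1.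
  by apply: powR_anti => //; [rewrite subr_le0 ltW|rewrite lerDl ltW].
have := ler_wpM2l (ltW x0) h1; lra.
Qed.

Lemma slope_le1 (x : R) : 0 < x -> slope x <= 1.
Proof.
move=> x0; rewrite /slope gerDr subr_le0; by apply: ge0_ler_powR; rewrite ?nnegrE ?lerDr ?addr_ge0// ?ltW.
Qed.

Lemma slope_nd (x y : R) : 0 < x -> x <= y -> slope x <= slope y.
Proof.
move=> x0 xy.
have d (z : R) : 0 < z -> is_derive z (1 : R) slope (q * z `^ (q - 1) - q * (1 + z) `^ (q - 1)).
  move=> z0; rewrite /slope; have z1 : 0 < 1 + z by rewrite addr_gt0.
  have d0 := is_derive1_powR q z0.
  have d1 : is_derive z (1 : R) (fun y => (1 + y) `^ q) (q * (1 + z) `^ (q - 1)).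
    under eq_fun do rewrite addrC.
    by apply: (@is_derive_shiftr R (fun y => y `^ q)); rewrite addrC; exact: is_derive1_powR.
  rewrite -[X in is_derive _ _ _ X]addr0.
  by apply: is_deriveD; apply: is_deriveB.
have [||c] := @MVT_segment R slope (fun z => q * z `^ (q - 1) - q * (1 + z) `^ (q - 1)) x y xy.
- by move=> z; rewrite in_itv/= => /andP[xz _]; apply: d; exact: lt_trans xz.
- apply: derivable_within_continuous => z; rewrite in_itv/= => /andP[xz _].
  exact: (@ex_derive _ _ _ _ _ _ _ (d z (lt_le_trans x0 xz))).
rewrite in_itv/= => /andP[xc cy] E; rewrite -subr_ge0 E mulr_ge0 ?subr_ge0//.
by rewrite ler_pM2l//; apply: powR_anti; [rewrite subr_le0 ltW|exact: lt_le_trans xc|rewrite lerDr].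
Qed.

Lemma is_derive_lipschitz_half (x : R) : 0 < x ->
  is_derive x (1 : R) lipschitz_half ((q + 1) / 2 * ((1 + x) `^ q - 1)).
Proof.
move=> x0.
have d1 : is_derive x (1 : R) (fun y => abspow (1 + y)) ((q + 1) * (1 + x) `^ q).
  under eq_fun do rewrite addrC.
  by apply: is_derive_shiftr; rewrite addrC; apply: is_derive_abspow; rewrite addr_gt0.
rewrite /lipschitz_half.
have -> : (q + 1) / 2 * ((1 + x) `^ q - 1) =
   2^-1 *: ((q + 1) * (1 + x) `^ q) - ((q + 1) / 2) *: (1 : R).
  by rewrite /GRing.scale/=; ring.
by apply: is_deriveB; apply: is_deriveZ.
Qed.

Lemma is_derive_convex_half (x : R) : 0 < x ->
  is_derive x (1 : R) convex_half ((q + 1) / 2 * slope x).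
Proof.
move=> x0; have d1 := is_derive_lipschitz_half x0; have d2 := is_derive_abspow x0.
rewrite /convex_half.
have -> : (q + 1) / 2 * slope x =
   2^-1 *: ((q + 1) * x `^ q) - (q + 1) / 2 * ((1 + x) `^ q - 1).
  by rewrite /GRing.scale/= /slope; ring.
by apply: is_deriveB; apply: is_deriveZ.
Qed.

Lemma continuous_lipschitz_half : continuous lipschitz_half.
Proof.
move=> x; apply: cvgB; apply: cvgMr.
  apply: continuous_cvg; first exact: continuous_abspow.
  by apply: cvgD; [exact: cvg_cst|exact: cvg_id].
exact: cvg_id.
Qed.

Lemma continuous_convex_half : continuous convex_half.
Proof.
move=> x; apply: cvgB; last exact: continuous_lipschitz_half.
by apply: cvgMr; exact: continuous_abspow.
Qed.

End power_kernel.

Section increment_covariance.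
Context (R : realType) (q : R).
Hypotheses (q0 : 0 < q) (q1 : q < 1).
Local Notation abspow := (abspow q).
Local Notation convex_half := (convex_half q).
Local Notation lipschitz_half := (lipschitz_half q).
Local Notation slope := (slope q).

(** The covariance of the increments over [a, b] and over [c, d]. *)
Definition incr_cov (a b c d : R) : R :=
  2^-1 * (abspow (b - c) + abspow (a - d) - abspow (b - d) - abspow (a - c)).

Lemma abspowN x : abspow (- x) = abspow x.
Proof. by rewrite /abspow normrN. Qed.

Lemma incr_covC a b c d : incr_cov a b c d = incr_cov c d a b.
Proof.
rewrite /incr_cov -(abspowN (b - c)) -(abspowN (a - d)) -(abspowN (b - d)) -(abspowN (a - c)).
by rewrite !opprB [abspow (c - b) + _]addrC.
Qed.

Let half2_le1 : (q + 1) / 2 <= 1.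
Proof. by rewrite ler_pdivrMr// mul1r; have := ltW q1; rewrite -(lerD2r 1); apply: le_trans. Qed.
Let half2_ge0 : 0 <= (q + 1) / 2.
Proof. by rewrite divr_ge0// addr_ge0// ltW. Qed.

Definition convex_part (a b y : R) := convex_half (y - a) - convex_half (y - b).
Definition lipschitz_part (a b y : R) := lipschitz_half (y - a) - lipschitz_half (y - b).

Lemma incr_cov_split a b c d : incr_cov a b c d =
  (convex_part a b d - convex_part a b c) + (lipschitz_part a b d - lipschitz_part a b c).
Proof.
have N x y : abspow (x - y) = abspow (y - x) by rewrite -abspowN opprB.
rewrite /incr_cov (N b c) (N a d) (N b d) (N a c) /convex_part /lipschitz_part /convex_half.
by ring.
Qed.

Lemma continuous_part (f : R -> R) (a b : R) : continuous f ->
  continuous (fun y => f (y - a) - f (y - b)).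
Proof.
move=> cf x; have h t : f (y - t) @[y --> x] --> f (x - t).
  apply: continuous_cvg; first exact: cf.
  by apply: cvgB; [exact: cvg_id|exact: cvg_cst].
by apply: cvgB; exact: h.
Qed.

Lemma is_derive_part (f df : R -> R) (a b y : R) :
  (forall x : R, 0 < x -> is_derive x (1 : R) f (df x)) -> a < y -> b < y ->
  is_derive y (1 : R) (fun y => f (y - a) - f (y - b)) (df (y - a) - df (y - b)).
Proof.
move=> fd ay by_; apply: is_deriveB.
  by apply: is_derive_shiftr; apply: fd; rewrite subr_gt0.
by apply: is_derive_shiftr; apply: fd; rewrite subr_gt0.
Qed.

(** Convexity: the increments over a given length b - a increase. *)
Lemma convex_part_nd (a b c d : R) : a <= b -> b <= c -> c <= d ->
  convex_part a b c <= convex_part a b d.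
Proof.
move=> ab bc; rewrite le_eqVlt => /predU1P[->//|cd'].
have D (y : R) : y \in `]c, d[ -> is_derive y (1 : R) (convex_part a b)
    ((q + 1) / 2 * slope (y - a) - (q + 1) / 2 * slope (y - b)).
  rewrite in_itv/= => /andP[cy _].
  have b_y : b < y by exact: le_lt_trans cy.
  apply: (@is_derive_part convex_half (fun x => (q + 1) / 2 * slope x)); [|exact: le_lt_trans b_y|exact: b_y].
  by move=> x x0; exact: is_derive_convex_half.
have [|z] := MVT cd' D.
  by apply: continuous_subspaceT; apply: continuous_part; exact: continuous_convex_half.
rewrite in_itv/= => /andP[cz zd] E; rewrite -subr_ge0 E mulr_ge0 ?subr_ge0//.
  by have bz : b < z by [exact: le_lt_trans cz]; rewrite ler_wpM2l// slope_nd ?subr_gt0// lerD2l lerN2.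
exact: ltW.
Qed.

Lemma convex_part_bound (a b y : R) : a <= b -> b <= y ->
  0 <= convex_part a b y <= b - a.
Proof.
rewrite le_eqVlt => /predU1P[->|ab] b_y; first by rewrite /convex_part !subrr lexx.
have ya : y - b < y - a by rewrite ltrD2l ltrN2.
have D (x : R) : x \in `]y - b, y - a[ -> is_derive x (1 : R) convex_half ((q + 1) / 2 * slope x).
  rewrite in_itv/= => /andP[cx _]; apply: is_derive_convex_half => //.
  by apply: le_lt_trans cx; rewrite subr_ge0.
have [|z] := MVT ya D.
  by apply: continuous_subspaceT; exact: continuous_convex_half.
rewrite in_itv/= => /andP[cz _] E; rewrite /convex_part E.
have z0 : 0 < z by apply: le_lt_trans cz; rewrite subr_ge0.
have -> : y - a - (y - b) = b - a by ring.
have ba : 0 <= b - a by rewrite subr_ge0 ltW.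
have s0 := slope_ge0 q0 q1 z0; have s1 := slope_le1 q0 z0.
apply/andP; split; first by apply: mulr_ge0 => //; exact: mulr_ge0.
by rewrite ler_piMl// mulr_ile1.
Qed.

Lemma lipschitz_part_incr (a b c d : R) : a <= b -> b <= c -> c <= d ->
  0 <= lipschitz_part a b d - lipschitz_part a b c <= (b - a) * (d - c).
Proof.
move=> ab bc cd.
pose dl x := (q + 1) / 2 * ((1 + x) `^ q - 1).
have D (y : R) : y \in `]c, d[ -> is_derive y (1 : R) (lipschitz_part a b)
    (dl (y - a) - dl (y - b)).
  rewrite in_itv/= => /andP[cy _].
  have b_y : b < y by exact: le_lt_trans cy.
  apply: (@is_derive_part lipschitz_half dl); [|exact: le_lt_trans b_y|exact: b_y].
  by move=> x x0; exact: is_derive_lipschitz_half.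
have [|z] := MVT_segment cd D.
  by apply: continuous_subspaceT; apply: continuous_part; exact: continuous_lipschitz_half.
rewrite in_itv/= => /andP[cz _] ->.
have cd0 : 0 <= d - c by rewrite subr_ge0.
have ab' : 1 + (z - b) <= 1 + (z - a) by rewrite !lerD2l lerN2.
have zb : 0 <= z - b by rewrite subr_ge0 (le_trans bc).
have D' (y : R) : y \in `]1 + (z - b), 1 + (z - a)[ ->
    is_derive y (1 : R) (fun y => y `^ q) (q * y `^ (q - 1)).
  rewrite in_itv/= => /andP[cy _]; apply: is_derive1_powR.
  by apply: le_lt_trans cy; rewrite addr_ge0.
have [|x] := MVT_segment ab' D'.
  apply: derivable_within_continuous => y; rewrite in_itv/= => /andP[cy _].
  apply: (@ex_derive _ _ _ _ _ _ _ (is_derive1_powR _ _)).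
  by apply: lt_le_trans cy; rewrite ltr_wpDr.
rewrite in_itv/= => /andP[zx _] E.
have x1 : 1 <= x by apply: le_trans zx; rewrite lerDl.
have x0 : 0 < x by exact: lt_le_trans x1.
have px : x `^ (q - 1) <= 1.
  rewrite [leRHS](_ : 1 = 1 `^ (q - 1)); last by rewrite powR1.
  by apply: powR_anti => //; rewrite subr_le0 ltW.
have p0 : 0 <= x `^ (q - 1) by exact: powR_ge0.
have -> : dl (z - a) - dl (z - b) = (q + 1) / 2 * (q * x `^ (q - 1)) * (b - a).
  have E2 : b - a = 1 + (z - a) - (1 + (z - b)) by ring.
  by rewrite [in RHS]E2 -[RHS]mulrA -E /dl; ring.
have ba : 0 <= b - a by rewrite subr_ge0.
have qp : 0 <= q * x `^ (q - 1) by rewrite mulr_ge0// ltW.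
have qp1 : q * x `^ (q - 1) <= 1 by rewrite mulr_ile1// ltW.
apply/andP; split; first by do 2 (apply: mulr_ge0 => //); exact: mulr_ge0.
by rewrite ler_wpM2r// ler_piMl// mulr_ile1.
Qed.

Lemma incr_cov_ge0 (a b c d : R) : a <= b -> b <= c -> c <= d -> 0 <= incr_cov a b c d.
Proof.
move=> ab bc cd; rewrite incr_cov_split addr_ge0 ?subr_ge0 ?convex_part_nd//.
by have /andP[+ _] := lipschitz_part_incr ab bc cd; rewrite subr_ge0.
Qed.

Lemma incr_cov_diag (a b : R) : a <= b ->
  0 <= incr_cov a b a b <= (b - a) + (b - a) ^+ 2.
Proof.
move=> ab; have E : incr_cov a b a b = (b - a) `^ (q + 1).
  have N x y : abspow (x - y) = abspow (y - x) by rewrite -abspowN opprB.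
  rewrite /incr_cov !subrr (N a b) /abspow normr0 powR0; last by rewrite gt_eqF// addr_gt0.
  by rewrite !subr0 ger0_norm ?subr_ge0//; lra.
rewrite E powR_ge0/=; have l0 : 0 <= b - a by rewrite subr_ge0.
move: l0; set l := b - a; rewrite le_eqVlt => /predU1P[<-|l0].
  by rewrite powR0 ?addr_ge0 ?sqr_ge0// gt_eqF// addr_gt0.
have -> : l `^ (q + 1) = l * l `^ q.
  by rewrite powRD ?(gt_eqF l0) ?implybT// mulrC powRr1// ltW.
have -> : l + l ^+ 2 = l * (1 + l) by rewrite mulrDr mulr1 expr2.
rewrite ler_pM2l//.
have [l1|l1] := leP l 1.
  apply: (@le_trans _ _ 1); last by rewrite lerDl ltW.
  rewrite [leRHS](_ : 1 = 1 `^ q); last by rewrite powR1.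
  by apply: ge0_ler_powR => //; rewrite ?nnegrE ?ltW.
apply: (@le_trans _ _ l); last by rewrite lerDr.
by apply: ler1_powR; rewrite ltW.
Qed.

(** Along a row the convex parts telescope to a bounded quantity, which is paid
    for by the sup norm K; the other parts are bounded cell by cell, which is
    paid for by the L1 norm. *)
Lemma incr_cov_row (p : nat -> R) (h : nat -> R) (K : R) (m j : nat) :
  (forall i, p i <= p i.+1) -> (forall i, 0 <= h i <= K) -> (j < m)%N ->
  \sum_(k < m | (j < k)%N) h k * incr_cov (p j) (p j.+1) (p k) (p k.+1) <=
  (p j.+1 - p j) * (K + \sum_(k < m) h k * (p k.+1 - p k)).
Proof.
move=> pS hK jm.
have pnd : {homo p : x y / (x <= y)%N >-> x <= y} by apply: homo_leq => //; exact: le_trans.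
pose F := convex_part (p j) (p j.+1).
have K0 : 0 <= K by have /andP[h0] := hK 0%N; exact: le_trans.
apply: (@le_trans _ _ (\sum_(k < m | (j < k)%N) (K * (F (p k.+1) - F (p k)) +
    (p j.+1 - p j) * (h k * (p k.+1 - p k))))).
  apply: ler_sum => k jk; have /andP[h0 hk] := hK k.
  rewrite incr_cov_split mulrDr lerD//.
    by rewrite ler_wpM2r// subr_ge0; apply: convex_part_nd => //; exact: pnd.
  rewrite mulrCA ler_wpM2l//.
  by have /andP[] := lipschitz_part_incr (pS j) (pnd _ _ jk) (pS k).
rewrite big_split/= mulrDr lerD//.
  rewrite -mulr_sumr -(big_geq_mkord j.+1 m xpredT (fun k => F (p k.+1) - F (p k))).
  rewrite (telescope_sumr (fun k => F (p k)))// mulrC ler_wpM2r//.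
  have /andP[_ h1] := convex_part_bound (pS j) (pnd _ _ jm).
  have /andP[h2 _] := convex_part_bound (pS j) (lexx (p j.+1)).
  rewrite -/F in h1 h2; lra.
rewrite -mulr_sumr ler_wpM2l ?subr_ge0//.
rewrite [leRHS](bigID (fun k : 'I_m => (j < k)%N))/= lerDl sumr_ge0// => k _.
by have /andP[h0 _] := hK k; rewrite mulr_ge0// subr_ge0.
Qed.

(** By symmetry the quadratic form consists of twice the rows above the diagonal
    and of the diagonal, each of them at most N1 (K + N1). *)
Lemma incr_cov_form (p : nat -> R) (f : nat -> R) (K N1 : R) (m : nat) :
  (forall i, p i <= p i.+1) -> (forall i, `|f i| <= K) ->
  N1 = \sum_(k < m) `|f k| * (p k.+1 - p k) ->
  \sum_(j < m) \sum_(k < m) f j * f k * incr_cov (p j) (p j.+1) (p k) (p k.+1) <=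
  3 * N1 * (K + N1).
Proof.
move=> pS fK N1E.
have pnd : {homo p : x y / (x <= y)%N >-> x <= y} by apply: homo_leq => //; exact: le_trans.
have hK i : 0 <= `|f i| <= K by rewrite normr_ge0 fK.
have K0 : 0 <= K by have /andP[h0] := hK 0%N; exact: le_trans.
have l0 i : 0 <= p i.+1 - p i by rewrite subr_ge0.
pose rho j k := incr_cov (p j) (p j.+1) (p k) (p k.+1).
have rhoC j k : rho j k = rho k j by exact: incr_covC.
have rho0 j k : 0 <= rho j k.
  have [jk|kj|->] := ltngtP j k.
  - by apply: incr_cov_ge0 => //; exact: pnd.
  - by rewrite rhoC; apply: incr_cov_ge0 => //; exact: pnd.
  - by have /andP[] := incr_cov_diag (pS k).
pose g j k := `|f j| * `|f k| * rho j k.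
have gC j k : g j k = g k j by rewrite /g rhoC [`|f j| * _]mulrC.
apply: (@le_trans _ _ (\sum_(j < m) \sum_(k < m) g j k)).
  apply: ler_sum => j _; apply: ler_sum => k _; apply: ler_wpM2r; first exact: rho0.
  by rewrite -normrM ler_norm.
have E : \sum_(j < m) \sum_(k < m) g j k =
   (\sum_(j < m) \sum_(k < m | (j < k)%N) g j k) * 2 + \sum_(j < m) g j j.
  have -> : \sum_(j < m) \sum_(k < m) g j k = \sum_(j < m)
     (\sum_(k < m | (j < k)%N) g j k + (\sum_(k < m | (k < j)%N) g j k + g j j)).
    apply: eq_bigr => j _; rewrite (bigID (fun k : 'I_m => (j < k)%N))/=; congr (_ + _).
    rewrite (bigD1 j)/= ?ltnn// addrC; congr (_ + _); apply: eq_bigl => k.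
    by rewrite -leqNgt ltn_neqAle andbC.
  rewrite !big_split/= addrA; congr (_ + _).
  rewrite mulr_natr mulr2n; congr (_ + _).
  rewrite (exchange_big_dep xpredT)//=.
  by apply: eq_bigr => j _; apply: eq_bigr => k _; exact: gC.
have row : \sum_(j < m) \sum_(k < m | (j < k)%N) g j k <= N1 * (K + N1).
  rewrite {1}N1E mulr_suml; apply: ler_sum => j _.
  rewrite (eq_bigr (fun k : 'I_m => `|f j| * (`|f k| * rho j k))); last first.
    by move=> k _; rewrite /g mulrA.
  rewrite -mulr_sumr -mulrA ler_wpM2l// N1E.
  exact: (@incr_cov_row p (fun k => `|f k|) K m j pS hK (ltn_ord j)).
have diag : \sum_(j < m) g j j <= N1 * (K + N1).
  rewrite {1}N1E mulr_suml; apply: ler_sum => j _.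
  have /andP[_ hd] := incr_cov_diag (pS j).
  rewrite /g -!mulrA ler_wpM2l//.
  apply: (@le_trans _ _ (`|f j| * ((p j.+1 - p j) + (p j.+1 - p j) ^+ 2))).
    by rewrite ler_wpM2l.
  rewrite (mulrDr `|f j|) (mulrDr (p j.+1 - p j)) lerD//.
    by rewrite mulrC ler_wpM2l.
  rewrite expr2 mulrCA ler_wpM2l// N1E (bigD1 j)//= lerDl sumr_ge0// => k _.
  by rewrite mulr_ge0.
by rewrite E; lra.
Qed.

End increment_covariance.

(** * Integrals of step functions against fractional Brownian motion *)

(** A step function sum of c 1_[a, b[ is represented by the list of its triples
    (c, a, b), and integrated against the increments of a process. *)
Definition step_sum (R : realType) (T : Type) (B : R -> T -> R) (l : seq (R * R * R)) (w : T) : R :=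
  \sum_(p <- l) p.1.1 * (B p.2 w - B p.1.2 w).

Definition step_shift (R : realType) (h : R) (l : seq (R * R * R)) :=
  [seq (p.1.1, p.1.2 + h, p.2 + h) | p <- l].

Lemma probability_lty d (T : measurableType d) (R : realType) (P : probability T R) : (P setT < +oo)%E.
Proof. by rewrite probability_setT ltry. Qed.

Section fbm_moments.
Context (d : measure_display) (T : measurableType d) (R : realType)
  (P : probability T R) (H : R) (B : R -> T -> R).
Hypotheses (H2 : 2^-1 < H) (H1 : H < 1) (fB : fractional_brownian_motion P H B).
Local Notation q := (2 * H - 1).

Lemma hurst_gt0 : 0 < q. Proof. by move: H2; lra. Qed.
Lemma hurst_lt1 : q < 1. Proof. by move: H1; lra. Qed.

Let mB t : measurable_fun setT (B t). Proof. exact: fbm_measurable fB t. Qed.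

Lemma fbm_moment2 t s : (\int[P]_w (B t w * B s w)%:E =
  (2^-1 * (abspow q t + abspow q s - abspow q (t - s)))%:E)%E.
Proof.
have := fbm_covariance fB t s; rewrite unlock !(fbm_centered fB) /= unlock.
rewrite /abspow subrK => <-.
by apply: eq_integral => w _; rewrite /= !fctE /= !subr0.
Qed.

Lemma fbm_sqr_integrable t : P.-integrable setT (fun w => (B t w ^+ 2)%:E).
Proof.
apply/integrableP; split; first by apply/measurable_EFinP; exact: measurable_funX.
under eq_integral do rewrite gee0_abs ?lee_fin ?sqr_ge0// expr2.
by rewrite fbm_moment2 ltry.
Qed.

Lemma sqr_integrable_mul (X Y : T -> R) :
  measurable_fun setT X -> measurable_fun setT Y ->
  P.-integrable setT (fun w => (X w ^+ 2)%:E) ->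
  P.-integrable setT (fun w => (Y w ^+ 2)%:E) ->
  P.-integrable setT (fun w => (X w * Y w)%:E).
Proof.
move=> mX mY iX iY; have iXY := integrableD measurableT iX iY.
apply: le_integrable iXY => //; first by apply/measurable_EFinP; exact: measurable_funM.
move=> w _ /=; rewrite lee_fin [leRHS]ger0_norm ?addr_ge0 ?sqr_ge0//.
rewrite normrM -[X w ^+ 2]real_normK ?num_real// -[Y w ^+ 2]real_normK ?num_real//.
have := sqr_ge0 (`|X w| - `|Y w|); have := normr_ge0 (X w); have := normr_ge0 (Y w).
have : 0 <= `|X w| * `|Y w| by rewrite mulr_ge0.
by rewrite sqrrB; lra.
Qed.

Lemma fbm_incr_moment a b c e :
  P.-integrable setT (fun w => ((B b w - B a w) * (B e w - B c w))%:E) /\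
  (\int[P]_w ((B b w - B a w) * (B e w - B c w))%:E = (incr_cov q a b c e)%:E)%E.
Proof.
have ii t s : P.-integrable setT (fun w => (B t w * B s w)%:E).
  by apply: sqr_integrable_mul => //; exact: fbm_sqr_integrable.
have E : (fun w => ((B b w - B a w) * (B e w - B c w))%:E) =
  (fun w => ((B b w * B e w)%:E - (B b w * B c w)%:E) - ((B a w * B e w)%:E - (B a w * B c w)%:E))%E.
  by apply/funext => w; rewrite -!EFinB; congr EFin; ring.
have i1 t s u : P.-integrable setT (fun w => (B t w * B s w)%:E - (B t w * B u w)%:E)%E.
  exact: integrableB.
split; first by rewrite E; apply: integrableB.
have I t s u : (\int[P]_w ((B t w * B s w)%:E - (B t w * B u w)%:E) =
    \int[P]_w (B t w * B s w)%:E - \int[P]_w (B t w * B u w)%:E)%E.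
  exact: integralB.
rewrite E; apply: (etrans (integralB measurableT (i1 b e c) (i1 a e c))).
rewrite !I !fbm_moment2 -!EFinB; congr EFin.
by rewrite /incr_cov; ring.
Qed.

Lemma measurable_step_sum l : measurable_fun setT (step_sum B l).
Proof.
apply: measurable_sum => p; apply: measurable_funM => //.
exact: measurable_funB.
Qed.

Lemma step_sum_moment2 l :
  P.-integrable setT (fun w => (step_sum B l w ^+ 2)%:E) /\
  (\int[P]_w (step_sum B l w ^+ 2)%:E = (\sum_(p <- l) \sum_(p' <- l)
     p.1.1 * p'.1.1 * incr_cov q p.1.2 p.2 p'.1.2 p'.2)%:E)%E.
Proof.
pose X (p p' : R * R * R) (w : T) :=
  ((p.1.1 * p'.1.1)%:E * ((B p.2 w - B p.1.2 w) * (B p'.2 w - B p'.1.2 w))%:E)%E.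
have iX p p' : P.-integrable setT (X p p').
  by apply: integrableZl => //; exact: (fbm_incr_moment _ _ _ _).1.
have E : (fun w => (step_sum B l w ^+ 2)%:E) = (fun w => \sum_(p <- l) \sum_(p' <- l) X p p' w)%E.
  apply/funext => w; rewrite expr2 /step_sum mulr_suml -sumEFin; apply: eq_bigr => p _.
  rewrite mulr_sumr -sumEFin; apply: eq_bigr => p' _.
  by rewrite /X -EFinM; congr EFin; ring.
have iXs p : P.-integrable setT (fun w => \sum_(p' <- l) X p p' w)%E by apply: integrable_sum.
rewrite E; split; first by apply: integrable_sum.
rewrite integral_sum// -sumEFin; apply: eq_bigr => p _.
rewrite integral_sum// -sumEFin; apply: eq_bigr => p' _.
rewrite integralZl//; last exact: (fbm_incr_moment _ _ _ _).1.
by rewrite (fbm_incr_moment _ _ _ _).2 EFinM.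
Qed.

Lemma step_sum_mean l : (\int[P]_w (step_sum B l w)%:E = 0)%E.
Proof.
have iB t : P.-integrable setT (fun w => (B t w)%:E).
  by apply: integrable_of_sqr => //; exact: fbm_sqr_integrable.
have mean0 t : (\int[P]_w (B t w)%:E = 0)%E.
  by have := fbm_centered fB t; rewrite unlock.
have iX (p : R * R * R) : P.-integrable setT (fun w => (p.1.1 * (B p.2 w - B p.1.2 w))%:E).
  exact: (integrableZl measurableT p.1.1 (integrableB measurableT (iB p.2) (iB p.1.2))).
under eq_integral do rewrite /step_sum -sumEFin.
rewrite integral_sum// big1// => p _.
under eq_integral do rewrite EFinM EFinB.
rewrite integralZl//; last exact: integrableB.
by rewrite integralB// !mean0 subee// mule0.
Qed.

Lemma step_sum_gaussian l : gaussian_variable P (step_sum B l).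
Proof.
pose l' := flatten [seq [:: (p.1.1, p.2); (- p.1.1, p.1.2)] | p <- l].
have E w : step_sum B l w = \sum_(p <- l') p.1 * B p.2 w.
  rewrite /step_sum /l' {l'}; elim: l => [|p l ih]; first by rewrite !big_nil.
  by rewrite big_cons ih /= !big_cons/= mulrBr mulNr addrA.
have -> : step_sum B l = fun w => \sum_(i < size l')
    (tnth (in_tuple l') i).1 * B (tnth (in_tuple l') i).2 w.
  by apply/funext => w; rewrite E big_tnth.
exact: (fbm_gaussian fB).
Qed.

Lemma incr_cov_shift h a b c e : incr_cov q (a + h) (b + h) (c + h) (e + h) = incr_cov q a b c e.
Proof. have E x y : x + h - (y + h) = x - y by ring.
by rewrite /incr_cov !E. Qed.

(** The variance is unchanged since the increments are stationary, and a centred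
    Gaussian law is determined by its variance. *)
Lemma step_sum_shift_law h l (A : set R) : measurable A ->
  P (step_sum B (step_shift h l) @^-1` A) = P (step_sum B l @^-1` A).
Proof.
move=> mA; apply: centered_gaussian_law => //; rewrite ?step_sum_mean//.
- exact: measurable_step_sum.
- exact: measurable_step_sum.
- exact: step_sum_gaussian.
- exact: step_sum_gaussian.
- exact: (step_sum_moment2 _).1.
- exact: (step_sum_moment2 _).1.
rewrite !(step_sum_moment2 _).2 big_map; congr EFin; apply: eq_bigr => p _.
rewrite big_map; apply: eq_bigr => p' _ /=; by rewrite incr_cov_shift.
Qed.

End fbm_moments.

Section refinement.
Context (R : realType).
Local Notation mu := (@lebesgue_measure R).

Definition step_fun (l : seq (R * R * R)) (s : R) : R :=
  \sum_(p <- l) p.1.1 * ((p.1.2 <= s) && (s < p.2))%:R.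

Variables (p : nat -> R) (m : nat).
Hypothesis pS : forall i, p i <= p i.+1.

Let pnd i j : (i <= j)%N -> p i <= p j.
Proof. by move=> ij; apply: (homo_leq (r := fun x y : R => x <= y)) ij => //; exact: le_trans. Qed.

Let plt i j : p i < p j -> (i < j)%N.
Proof. by rewrite ltnNge => ij; apply/negP => /pnd; rewrite leNgt ij. Qed.

Definition on_grid (x : R) := exists2 i, (i <= m)%N & x = p i.

Lemma grid_telescope (F : R -> R) a b : on_grid a -> on_grid b -> a <= b ->
  \sum_(i < m) ((a <= p i) && (p i < b))%:R * (F (p i.+1) - F (p i)) = F b - F a.
Proof.
move=> [ia iam aE] [ib ibm bE] ab.
(* Clamping to [a, b] turns the sum over the cells of [a, b] into a sum over
   all cells. *)
pose c x := Num.max a (Num.min x b).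
have -> : F b - F a = F (c (p m)) - F (c (p 0%N)).
  congr (F _ - F _); rewrite /c.
    by rewrite (min_idPr _) ?(max_idPr _)// bE pnd.
  by rewrite (max_idPl _)// ge_min aE pnd.
rewrite -(telescope_sumr (fun i => F (c (p i))))// big_mkord; apply: eq_bigr => i _.
have [ai|ia'] := leP a (p i) => /=; last first.
  rewrite mul0r /c (max_idPl _) ?(max_idPl _) ?subrr//.
    by rewrite ge_min ltW.
  by rewrite ge_min aE pnd//; apply: plt; rewrite -aE.
have [ib'|bi] := ltP (p i) b.
  rewrite mul1r /c (min_idPl _); last by rewrite bE pnd//; apply: plt; rewrite -bE.
  rewrite (min_idPl (ltW ib')) (max_idPr ai) (max_idPr _)//.
  exact: le_trans (pS i).
rewrite mul0r /c (min_idPr (le_trans bi (pS i))) (min_idPr bi) subrr//.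
Qed.

Variable l : seq (R * R * R).
Hypothesis lgrid : forall x, x \in l -> [/\ on_grid x.1.2, on_grid x.2 & x.1.2 <= x.2].

Lemma step_sum_refine (T : Type) (B : R -> T -> R) w : step_sum B l w =
  \sum_(i < m) step_fun l (p i) * (B (p i.+1) w - B (p i) w).
Proof.
under [RHS]eq_bigr do rewrite mulr_suml.
rewrite exchange_big/=; apply: eq_big_seq => x /lgrid[ga gb ab].
rewrite -(grid_telescope (fun t => B t w) ga gb ab) mulr_sumr.
by apply: eq_bigr => i _; rewrite mulrA.
Qed.

Lemma step_fun_cell i s : (i < m)%N -> p i <= s -> s < p i.+1 -> step_fun l s = step_fun l (p i).
Proof.
move=> im pis spi; apply: eq_big_seq => x /lgrid[[a am ->] [b bm ->] ab].
congr (_ * (nat_of_bool _)%:R); congr (_ && _).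
  apply/idP/idP => [h|h]; last exact: le_trans pis.
  by apply: pnd; rewrite -ltnS; apply: plt; exact: le_lt_trans spi.
apply/idP/idP => [h|h]; first exact: le_lt_trans h.
by apply: lt_le_trans spi _; apply: pnd; exact: plt.
Qed.

Lemma grid_cells_le1 s : \sum_(i < m) ((p i <= s) && (s < p i.+1))%:R <= 1 :> R.
Proof.
have -> : \sum_(i < m) ((p i <= s) && (s < p i.+1))%:R =
   \sum_(i < m) ((s < p i.+1)%R%:R - (s < p i)%R%:R) :> R.
  apply: eq_bigr => i _; have [pis|spi] := leP (p i) s.
    by rewrite subr0.
  by rewrite (lt_le_trans spi (pS i)) subrr.
rewrite -(big_mkord xpredT (fun i => (s < p i.+1)%R%:R - (s < p i)%R%:R : R)).
rewrite (telescope_sumr (fun i => (s < p i)%R%:R : R))//.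
by case: (s < p m); case: (s < p 0%N); rewrite /= ?subrr ?subr0 ?sub0r// lerN10.
Qed.

Lemma measurable_step_fun : measurable_fun setT (step_fun l).
Proof.
apply: measurable_sum => x; apply: measurable_funM => //.
have -> : (fun s : R => ((x.1.2 <= s) && (s < x.2))%:R) = \1_(`[x.1.2, x.2[%classic) :> (R -> R).
  by apply/funext => s; rewrite indicE mem_setE in_itv.
exact: measurable_indic.
Qed.

Lemma grid_norm_le_integral :
  ((\sum_(i < m) `|step_fun l (p i)| * (p i.+1 - p i))%:E <=
   \int[mu]_s `|step_fun l s|%:E)%E.
Proof.
pose I i : set R := `[p i, p i.+1[%classic.
have mI i : measurable_fun setT (\1_(I i) : measurableTypeR R -> R).
  by apply: measurable_indic; exact: measurable_itv.
have cell i : ((`|step_fun l (p i)| * (p i.+1 - p i))%:E =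
    \int[mu]_s (`|step_fun l (p i)| * \1_(I i) s)%:E)%E.
  under eq_integral do rewrite EFinM.
  rewrite ge0_integralZl//=; last by apply/measurable_EFinP; exact: mI.
  have iI : (\int[mu]_s (\1_(I i) s)%:E = mu (I i))%E.
    have h : measurable (I i : set (measurableTypeR R)) by exact: measurable_itv.
    by rewrite integral_indic// setIT.
  rewrite iI lebesgue_measure_itv/= lte_fin EFinM; congr (_ * _)%E.
  case: ltP => // h; have -> : p i.+1 = p i by apply/le_anti; rewrite h pS.
  by rewrite subrr.
rewrite -sumEFin; under eq_bigr do rewrite cell.
rewrite -ge0_integral_sum//; last first.
  by move=> i; apply/measurable_EFinP; apply: measurable_funM => //; exact: mI.
apply: ge0_le_integral => //.
- by move=> s _; apply: sume_ge0 => i _; rewrite lee_fin mulr_ge0.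
- apply: emeasurable_sum => i; apply/measurable_EFinP; apply: measurable_funM => //; exact: mI.
- by apply/measurable_EFinP; apply: measurableT_comp => //; exact: measurable_step_fun.
move=> s _; rewrite sumEFin lee_fin.
apply: (@le_trans _ _ (\sum_(i < m) `|step_fun l s| * ((p i <= s) && (s < p i.+1))%:R)).
  apply: ler_sum => i _; rewrite indicE mem_setE in_itv/=.
  by case: andP => [[h1 h2]|_]; rewrite ?mulr0// (step_fun_cell (ltn_ord i) h1 h2).
by rewrite -mulr_sumr ler_piMr// grid_cells_le1.
Qed.

End refinement.

(** Over a grid that contains all the end points, the combination of increments
    has the values of the step function as its coefficients, and its second
    moment is the quadratic form bounded by incr_cov_form. *)
Lemma step_sum_moment2_le (d : measure_display) (T : measurableType d) (R : realType)
    (P : probability T R) (H : R) (B : R -> T -> R) (l : seq (R * R * R)) (K N : R) :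
  2^-1 < H -> H < 1 -> fractional_brownian_motion P H B ->
  (forall x, x \in l -> x.1.2 <= x.2) ->
  (forall s, `|step_fun l s| <= K) ->
  (\int[lebesgue_measure]_s `|step_fun l s|%:E <= N%:E)%E ->
  (\int[P]_w (step_sum B l w ^+ 2)%:E <= (3 * N * (K + N))%:E)%E.
Proof.
move=> H2 H1 fB lle lK lN.
pose e := sort <=%R (flatten [seq [:: x.1.2; x.2] | x <- l]).
pose m := (size e).-1; pose p i := nth (last 0 e) e i.
have se : sorted <=%R e by apply: sort_sorted; exact: le_total.
have pS i : p i <= p i.+1.
  have [ie|ei] := ltnP i.+1 (size e).
    exact: (sortedP _ se).
  have [ie|ei'] := ltnP i (size e); last by rewrite /p !nth_default// (leq_trans ei').
  rewrite /p [leRHS]nth_default//.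
  have -> : i = (size e).-1.
    by apply/eqP; rewrite -eqSS prednK ?(leq_trans _ ie)// eqn_leq ie ei.
  by rewrite nth_last; case: (e) ie.
have grid x : x \in e -> on_grid p m x.
  move=> xe; exists (index x e); last by rewrite /p nth_index.
  by rewrite /m -ltnS (leq_trans _ (leqSpred _))// index_mem.
have lgrid x : x \in l -> [/\ on_grid p m x.1.2, on_grid p m x.2 & x.1.2 <= x.2].
  move=> xl; split; last exact: lle.
    by apply: grid; rewrite mem_sort; apply/flatten_mapP; exists x => //; rewrite !inE eqxx.
  by apply: grid; rewrite mem_sort; apply/flatten_mapP; exists x => //; rewrite !inE eqxx orbT.
pose l2 := [seq (step_fun l (p i), p i, p i.+1) | i <- iota 0 m].
have iotaE (F : nat -> R) : \sum_(i <- iota 0 m) F i = \sum_(i < m) F i.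
  by rewrite -(big_mkord xpredT F) /index_iota subn0.
have E w : step_sum B l w = step_sum B l2 w.
  by rewrite (step_sum_refine pS lgrid) /step_sum big_map iotaE.
under eq_integral do rewrite E.
rewrite (step_sum_moment2 fB l2).2 lee_fin big_map.
pose N1 := \sum_(i < m) `|step_fun l (p i)| * (p i.+1 - p i).
have q0 := hurst_gt0 H2; have q1 := hurst_lt1 H1.
have N1N : N1 <= N.
  by rewrite -lee_fin; apply: le_trans lN; exact: grid_norm_le_integral.
have N10 : 0 <= N1 by apply: sumr_ge0 => i _; rewrite mulr_ge0// subr_ge0.
have K0 : 0 <= K by exact: le_trans (lK 0).
apply: (@le_trans _ _ (3 * N1 * (K + N1))).
  apply: le_trans (incr_cov_form q0 q1 pS (fun i => lK (p i)) erefl).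
  rewrite le_eqVlt; apply/orP; left; apply/eqP.
  rewrite iotaE; apply: eq_bigr => j _; rewrite big_map iotaE.
  by apply: eq_bigr.
by rewrite ler_pM ?lerD// ?ler_pM ?mulr_ge0 ?addr_ge0.
Qed.

(** * Increments of a two-sided Levy process *)

Lemma measurable_process_sigma d (T : measurableType d) (R : realType) (D : set R)
    (X : R -> T -> R) (t : R) : D t ->
  @measurable_fun _ _ (g_sigma_algebraType (\bigcup_(t in D) preimage_set_system setT (X t) measurable)) R setT (X t).
Proof.
move=> Dt _ A mA; rewrite setTI; apply: sub_sigma_algebra; exists t => //.
by exists A => //; rewrite setTI.
Qed.

Section two_sided.
Context d (T : measurableType d) (R : realType) (P : probability T R).
Variables X1 X2 : R -> T -> R.
Hypotheses (L1 : levy_process P X1) (L2 : levy_process P X2).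
Hypothesis (same : same_finite_dim_laws P [set t : R | 0 <= t] X1 X2).
Hypothesis (indep : independent_processes P [set t : R | 0 <= t] X1 X2).

Definition incr_law (l : R) (A : set R) : \bar R := P ((X1 l \- X1 0) @^-1` A).

Let mX1 (t : R) : 0 <= t -> measurable_fun setT (X1 t).
Proof. exact: levy_measurable L1 t. Qed.
Let mX2 (t : R) : 0 <= t -> measurable_fun setT (X2 t).
Proof. exact: levy_measurable L2 t. Qed.

Lemma incr_law1 (s l : R) A : 0 <= s -> 0 <= l -> measurable A ->
  P ((X1 (s + l) \- X1 s) @^-1` A) = incr_law l A.
Proof. by move=> s0 l0 mA; exact: (levy_stationary_increments L1). Qed.

Lemma incr_law2 (s l : R) A : 0 <= s -> 0 <= l -> measurable A ->
  P ((X2 (s + l) \- X2 s) @^-1` A) = incr_law l A.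
Proof.
move=> s0 l0 mA; have := levy_stationary_increments L2 s0 l0 mA.
rewrite /pushforward => ->; rewrite /incr_law.
pose t (i : 'I_2) : R := if i == ord0 then l else 0.
have tD i : [set t : R | 0 <= t] (t i) by rewrite /t /=; case: ifP.
have m2 : measurable_fun setT (fun x : 2.-tuple R => tnth x ord0 - tnth x ord_max).
  by apply: measurable_funB; exact: measurable_tnth.
have mA' : measurable ((fun x : 2.-tuple R => tnth x ord0 - tnth x ord_max) @^-1` A).
  by rewrite -[X in measurable X]setTI; exact: m2.
have := same tD mA'; rewrite /finite_dim_law /pushforward => E.
have F (X : R -> T -> R) : (fun w => [tuple X (t i) w | i < 2]) @^-1`
   ((fun x : 2.-tuple R => tnth x ord0 - tnth x ord_max) @^-1` A) = (X l \- X 0) @^-1` A.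
  by apply/seteqP; split => w /=; rewrite !tnth_mktuple /t/=.
by rewrite !F in E.
Qed.

(** The two-sided process up to a null set at each time. The left limits on the
    negative side are replaced with values at fixed times, so that the
    finite-dimensional laws can be computed from those of X1 and X2. *)
Definition two_sided (t : R) (w : T) : R :=
  if 0 < t then X1 t w - X1 0 w else X2 0 w - X2 (- t) w.

Lemma measurable_two_sided t : measurable_fun setT (two_sided t).
Proof.
rewrite /two_sided; case: ltP => t0; apply: measurable_funB; [exact: mX1 (ltW t0)|exact: mX1|exact: mX2|].
by apply: mX2; rewrite oppr_ge0.
Qed.

Lemma two_sided_incr_pos (s t : R) w : 0 <= s -> s < t ->
  two_sided t w - two_sided s w = X1 t w - X1 s w.
Proof.
rewrite /two_sided le_eqVlt => /predU1P[<- t0|s0 st].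
  by rewrite t0 ltxx oppr0 subrr subr0.
by rewrite s0 (lt_trans s0 st); ring.
Qed.

Lemma two_sided_incr_neg (s t : R) w : t <= 0 -> s < t ->
  two_sided t w - two_sided s w = X2 (- s) w - X2 (- t) w.
Proof.
move=> t0 st; rewrite /two_sided !ltNge t0 (le_trans (ltW st) t0)/=; ring.
Qed.

(** As 0 is a point of the grid, each cell lies on one side of 0, where the
    increments are those of X1 or of X2. *)
Lemma two_sided_grid (m r : nat) (p : nat -> R) (A : nat -> set R) :
  (forall i, (i < m)%N -> p i < p i.+1) -> (r <= m)%N -> p r = 0 ->
  (forall i, measurable (A i)) ->
  P (\bigcap_(i < m) ((two_sided (p i.+1) \- two_sided (p i)) @^-1` A i)) =
  (\prod_(i < m) incr_law (p i.+1 - p i) (A i))%E.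
Proof.
move=> pS rm pr mA.
have pnd i j : (i <= j)%N -> (j <= m)%N -> p i <= p j.
  elim: j => [|j ih]; first by rewrite leqn0 => /eqP ->.
  rewrite leq_eqVlt => /predU1P[->//|]; rewrite ltnS => ij jm.
  by rewrite (le_trans (ih ij (ltnW jm)))// ltW// pS.
pose left_ := \bigcap_(i : 'I_r) ((X2 (- p (r - i.+1)%N) \- X2 (- p (r - i)%N)) @^-1` A (r - i.+1)%N).
pose right_ := \bigcap_(i : 'I_(m - r)) ((X1 (p (r + i.+1)%N) \- X1 (p (r + i)%N)) @^-1` A (r + i)%N).
have nn1 (i : nat) : (i <= m - r)%N -> 0 <= p (r + i)%N.
  by move=> im; rewrite -pr pnd ?leq_addr// -leq_subRL.
have nn2 (i : nat) : (i <= r)%N -> 0 <= - p (r - i)%N.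
  by move=> im; rewrite oppr_ge0 -pr pnd ?leq_subr.
have -> : \bigcap_(i < m) ((two_sided (p i.+1) \- two_sided (p i)) @^-1` A i) = right_ `&` left_.
  apply/seteqP; split => [w h|w [h1 h2] i /= im].
    split=> i _.
      have im : (r + i < m)%N by rewrite -ltn_subRL.
      by have /= := h _ im; rewrite two_sided_incr_pos ?addnS// ?pS// nn1// ltnW.
    have ir : (r - i.+1 < r)%N by rewrite ltn_subrL (leq_trans _ (ltn_ord i)).
    have E : (r - i.+1).+1 = (r - i)%N by rewrite subnSK.
    have /= := h _ (leq_trans ir rm).
    by rewrite two_sided_incr_neg ?pS// ?(leq_trans ir)// E// -oppr_ge0 nn2// ltnW.
  have [ir|ri] := ltnP i r.
    have := h2 (Ordinal (rev_ord_proof (Ordinal ir))) I => /=.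
    rewrite !subnSK// subKn//; last exact: ltnW.
    rewrite (subKn ir) two_sided_incr_neg//; last exact: pS.
    by rewrite -pr pnd.
  have im' : (i - r < m - r)%N by rewrite ltn_sub2r// (leq_ltn_trans ri).
  have := h1 (Ordinal im') I => /=.
  by rewrite addnS subnKC// two_sided_incr_pos ?pS// -pr pnd// ltnW.
have sub_ (X : R -> T -> R) (t s : R) C : 0 <= t -> 0 <= s -> measurable C ->
    process_sigma_algebra [set t : R | 0 <= t] X ((X t \- X s) @^-1` C).
  move=> t0 s0 mC; rewrite /process_sigma_algebra.
  have := @measurable_funB _ (g_sigma_algebraType (\bigcup_(t in [set t : R | 0 <= t]) preimage_set_system setT (X t) measurable)) R setT (X t) (X s)
    (measurable_process_sigma t0) (measurable_process_sigma s0) measurableT C mC.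
  by rewrite setTI.
have sr : process_sigma_algebra [set t : R | 0 <= t] X1 right_.
  apply: (@fin_bigcap_measurable _ (g_sigma_algebraType _)) => // i _.
  by apply: sub_ => //; apply: nn1 => //; exact: ltnW.
have sl : process_sigma_algebra [set t : R | 0 <= t] X2 left_.
  apply: (@fin_bigcap_measurable _ (g_sigma_algebraType _)) => // i _.
  by apply: sub_ => //; apply: nn2 => //; exact: ltnW.
rewrite indep//.
transitivity ((\prod_(r <= i < m) incr_law (p i.+1 - p i) (A i)) *
    (\prod_(0 <= i < r) incr_law (p i.+1 - p i) (A i)))%E; last first.
    rewrite muleC -(big_mkord xpredT (fun i => incr_law (p i.+1 - p i) (A i))).
    by rewrite [RHS](big_cat_nat (leq0n r) rm).
congr (_ * _)%E.
  have := @levy_independent_increments _ _ _ _ _ L1 (m - r)%N (fun i => p (r + i)%N).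
  rewrite /= nn1// => /(_ isT) E; rewrite /right_ (E _ (fun i => A (r + i)%N))//; last first.
    by move=> i im; rewrite addnS pS// -ltn_subRL.
  have -> : index_iota r m = index_iota (0 + r)%N m by [].
  rewrite big_addn big_mkord; apply: eq_bigr => i _.
  have im : (r + i < m)%N by rewrite -ltn_subRL.
  rewrite addnS [(i + r)%N]addnC -(@incr_law1 (p (r + i)%N)) ?subrKC//.
    by rewrite nn1// ltnW.
  by rewrite subr_ge0 ltW// pS.
  have := @levy_independent_increments _ _ _ _ _ L2 r (fun i => - p (r - i)%N).
  rewrite /= nn2// => /(_ isT) E; rewrite /left_ (E _ (fun i => A (r - i.+1)%N))//; last first.
    move=> i ir; rewrite ltrN2 -(subnSK ir) pS// (leq_trans _ rm)//.
    by rewrite ltn_subrL (leq_trans _ ir).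
  rewrite big_nat_rev big_mkord; apply: eq_bigr => i _.
  have ir : (r - i.+1 < r)%N by rewrite ltn_subrL (leq_trans _ (ltn_ord i)).
  rewrite add0n subnSK// -(@incr_law2 (- p (r - i)%N)) ?nn2 1?ltnW//; last first.
    by rewrite subr_ge0 ltW// -(subnSK (ltn_ord i)) pS// (leq_trans ir).
  by rewrite addrA addNr add0r.
Qed.

(** All the values are sums of increments over a common grid that contains 0 and
    - h. Translated by h, this grid still contains 0, and the lengths of its
    cells are the same. *)
Lemma two_sided_shift (n : nat) (s : 'I_n -> R) (h : R) (A : set (n.-tuple R)) :
  measurable A ->
  P ((fun w => [tuple two_sided (s i + h) w - two_sided h w | i < n]) @^-1` A) =
  P ((fun w => [tuple two_sided (s i) w - two_sided 0 w | i < n]) @^-1` A).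
Proof.
move=> mA; pose e : seq R := sort <=%R (undup (0 :: - h :: codom s)).
pose m := (size e).-1; pose p i := nth 0 e i.
have mem_e (x : R) : (x \in e) = (x \in [:: 0, - h & codom s]) by rewrite mem_sort mem_undup.
have se : sorted <%R e by rewrite lt_sorted_uniq_le sort_uniq undup_uniq sort_sorted//; exact: le_total.
have szm : size e = m.+1.
  by rewrite /m prednK//; have := mem_e 0; rewrite inE eqxx /=; case: (e).
have pS i : (i < m)%N -> p i < p i.+1.
  by move=> im; apply: (sortedP 0 se); rewrite szm.
have idx (x : R) : x \in e -> (index x e <= m)%N by rewrite -index_mem szm.
have pidx (x : R) : x \in e -> p (index x e) = x by move=> xe; rewrite /p nth_index.
have e0 : (0 : R) \in e by rewrite mem_e inE eqxx.
have eh : - h \in e by rewrite mem_e !inE eqxx orbT.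
have es i : s i \in e by rewrite mem_e !inE codom_f !orbT.
pose Inc (c : R) w := [tuple two_sided (p i.+1 + c) w - two_sided (p i + c) w | i < m].
pose part (k : nat) (x : m.-tuple R) := \sum_(j < m) (if (j < k)%N then tnth x j else 0).
pose Phi (x : m.-tuple R) := [tuple part (index (s i) e) x - part (index (0 : R) e) x | i < n].
have mPhi : measurable_fun setT Phi.
  have mpart k : measurable_fun setT (part k).
    by apply: measurable_sum => j; case: (j < k)%N => //; exact: measurable_tnth.
  apply/measurable_fun_tnthP => i.
  rewrite (_ : _ \o _ = fun x => part (index (s i) e) x - part (index (0 : R) e) x).
    exact: measurable_funB.
  by apply/funext => x; rewrite /= tnth_mktuple.
have mInc c : measurable_fun setT (Inc c).
  apply/measurable_fun_tnthP => i.
  rewrite (_ : _ \o _ = two_sided (p i.+1 + c) \- two_sided (p i + c)).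
    by apply: measurable_funB; exact: measurable_two_sided.
  by apply/funext => w; rewrite /= tnth_mktuple.
have PhiE c w : Phi (Inc c w) = [tuple two_sided (s i + c) w - two_sided (0 + c) w | i < n].
  apply: eq_from_tnth => i; rewrite !tnth_mktuple.
  have tel k : (k <= m)%N -> part k (Inc c w) =
      two_sided (p k + c) w - two_sided (p 0%N + c) w.
    move=> km; rewrite -(telescope_sumr (fun i => two_sided (p i + c) w))// big_mkord.
    rewrite (big_ord_widen _ (fun i => two_sided (p i.+1 + c) w - two_sided (p i + c) w) km).
    by rewrite /part -big_mkcond; apply: eq_bigr => j _; rewrite tnth_mktuple.
  by rewrite !tel ?idx// !pidx//; ring.
(* The grid translated by c is compared with the grid itself. *)
have key c (B : set (m.-tuple R)) : - c \in e -> measurable B ->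
    P (Inc c @^-1` B) = P (Inc 0 @^-1` B).
  move=> ce mB.
  have fin c' : (image_measure P (mInc c') setT < +oo)%E.
    by rewrite /= /pushforward preimage_setT; exact: probability_lty.
  apply: (rect_unique (m1 := image_measure P (mInc c)) (m2 := image_measure P (mInc 0))) => // D mD.
  pose A' (i : nat) := if insub i is Some j then D j else setT.
  have mA' i : measurable (A' i) by rewrite /A'; case: insubP.
  have E c' : - c' \in e -> P (Inc c' @^-1` rect D) = (\prod_(i < m) incr_law (p i.+1 - p i) (A' i))%E.
    move=> ce'; have := @two_sided_grid m (index (- c') e) (fun i => p i + c') A' _ (idx _ ce') _ mA'.
    rewrite pidx// addNr => /(_ _ erefl) G.
    transitivity (\prod_(i < m) incr_law (p i.+1 + c' - (p i + c')) (A' i))%E; last first.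
      by apply: eq_bigr => i _; rewrite opprD addrACA subrr addr0.
    rewrite -G; last by move=> i im; rewrite ltrD2r pS.
    congr (P _); apply/seteqP; split => w.
      move=> /= h' i /= im; have := h' (Ordinal im).
      by rewrite tnth_mktuple /A' insubT.
    move=> h' i; have := h' i (ltn_ord i).
    by rewrite /= tnth_mktuple /A' valK.
  by rewrite /= /pushforward !E// oppr0.
have H c : - c \in e -> P ((fun w => [tuple two_sided (s i + c) w - two_sided (0 + c) w | i < n]) @^-1` A) =
    P (Inc 0 @^-1` (Phi @^-1` A)).
  move=> ce; rewrite -(key c)//; last by rewrite -[X in measurable X]setTI; exact: mPhi.
  by congr (P _); apply/seteqP; split => w /=; rewrite PhiE.
have := H h eh; have := H 0; rewrite oppr0 => /(_ e0) <-.
under [in RHS]eq_fun do under eq_mktuple do rewrite !addr0.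
by under eq_fun do under eq_mktuple do rewrite add0r.
Qed.

End two_sided.

(** * Regular paths *)

Section one_sided_limits.
Context (R : realType).
Implicit Types (f : R -> R) (s l e : R).

Lemma cvg_rightP f s l : f r @[r --> s^'+] --> l <->
  forall e, 0 < e -> exists2 d, 0 < d & forall r, s < r -> r < s + d -> `|l - f r| <= e.
Proof.
split.
  move=> /cvgrPdist_le h e e0; have := h e e0; rewrite near_withinE => -[d d0 hd].
  exists d => // r sr rd; apply: hd => //=; rewrite distrC gtr0_norm ?subr_gt0//.
  by rewrite ltrBlDl.
move=> h; apply/cvgrPdist_le => e e0; have [d d0 hd] := h e e0.
rewrite near_withinE; exists d => // r /=; rewrite ltr_distlC => /andP[_ rd] sr.
exact: hd.
Qed.

Lemma cvg_leftP f s l : f r @[r --> s^'-] --> l <->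
  forall e, 0 < e -> exists2 d, 0 < d & forall r, s - d < r -> r < s -> `|l - f r| <= e.
Proof.
split.
  move=> /cvgrPdist_le h e e0; have := h e e0; rewrite near_withinE => -[d d0 hd].
  exists d => // r sr rd; apply: hd => //=; rewrite gtr0_norm ?subr_gt0//.
  by rewrite ltrBlDl -ltrBlDr.
move=> h; apply/cvgrPdist_le => e e0; have [d d0 hd] := h e e0.
rewrite near_withinE; exists d => // r /=; rewrite ltr_distlC => /andP[dr _] sr.
exact: hd.
Qed.

Lemma left_limit_near f a s l e : cvg (f r @[r --> s^'-]) -> a < s ->
  (forall r, a < r -> r < s -> `|l - f r| <= e) -> `|l - lim (f r @[r --> s^'-])| <= e.
Proof.
move=> cf as_ h; have cd : `|l - f r| @[r --> s^'-] --> `|l - lim (f r @[r --> s^'-])|.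
  by apply: cvg_norm; apply: cvgB; [exact: cvg_cst|exact: cf].
rewrite -(cvg_lim _ cd)//; apply: limr_le; first by apply/cvg_ex; eexists; exact: cd.
by near=> r; apply: h; near: r; [exact: nbhs_left_gt|exact: nbhs_left_lt].
Unshelve. all: by end_near. Qed.

Definition cadlag_on_halfline f :=
  (forall t, 0 <= t -> f s @[s --> t^'+] --> f t) /\
  (forall t, 0 < t -> cvg (f s @[s --> t^'-])).

Variables (f1 f2 : R -> R).
Hypotheses (c1 : cadlag_on_halfline f1) (c2 : cadlag_on_halfline f2).

(** A path of the two-sided process in terms of the paths of its two halves. *)
Definition glue t := if 0 <= t then f1 t else - lim (f2 s @[s --> (- t)^'-]).

Lemma glue_right s : glue r @[r --> s^'+] --> glue s.
Proof.
apply/cvg_rightP => e e0; have [s0|s0] := leP 0 s.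
  have [d d0 hd] := (cvg_rightP _ _ _).1 (c1.1 s s0) e e0.
  exists d => // r sr rd; rewrite /glue s0 (le_trans s0 (ltW sr)).
  exact: hd.
have s0' : 0 < - s by rewrite oppr_gt0.
have [d d0 hd] := (cvg_leftP _ _ _).1 (c2.2 _ s0') e e0.
exists (Num.min d (- s)) => [|r sr]; first by rewrite lt_min d0.
rewrite -ltrBlDl lt_min => /andP[rd rs].
have r0 : r < 0 by lra.
rewrite /glue (leNgt 0 s) (leNgt 0 r) s0 r0/= -opprD normrN.
have rs' : - s - d < - r by lra.
apply: (left_limit_near (c2.2 _ _) rs'); first by rewrite oppr_gt0.
by move=> u u1 u2; apply: hd => //; lra.
Qed.

Lemma glue_left s : cvg (glue r @[r --> s^'-]).
Proof.
have [s0|s0] := ltP 0 s.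
  have := c1.2 s s0 => /cvg_ex[l /cvg_leftP hl]; apply/cvg_ex; exists l.
  apply/cvg_leftP => e e0; have [d d0 hd] := hl e e0.
  exists (Num.min d s) => [|r]; first by rewrite lt_min d0.
  rewrite ltrBlDr -ltrBlDl lt_min => /andP[rd rs] sr; rewrite /glue ifT; last by lra.
  by apply: hd => //; lra.
have s0' : 0 <= - s by rewrite oppr_ge0.
apply/cvg_ex; exists (- f2 (- s)); apply/cvg_leftP => e e0.
have [d d0 hd] := (cvg_rightP _ _ _).1 (c2.1 _ s0') e e0.
exists d => // r rs rd; have r0 : r < 0 by lra.
rewrite /glue (leNgt 0 r) r0/= -opprD normrN.
have sr : - s < - r by lra.
apply: (left_limit_near (c2.2 _ _) sr); first by rewrite oppr_gt0.
by move=> u u1 u2; apply: hd => //; lra.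
Qed.

Lemma glue_infty : f2 t @[t --> +oo] --> +oo -> glue t @[t --> -oo] --> -oo.
Proof.
move=> /cvgryPge h; apply/cvgrNyPle => A; have [M [_ hM]] := h (- A).
near=> t.
have t0 : t < 0 by near: t; exact: nbhs_ninfty_lt.
have tM : t < - M by near: t; apply: nbhs_ninfty_lt; exact: num_real.
rewrite /glue (leNgt 0 t) t0/= lerNl.
apply: limr_ge; first by apply: c2.2; rewrite oppr_gt0.
near=> u; apply: hM.
by near: u; apply: nbhs_left_gt; rewrite ltrNr.
Unshelve. all: by end_near. Qed.

End one_sided_limits.

Section fixed_times.
Context d (T : measurableType d) (R : realType) (P : probability T R).
Variable X : R -> T -> R.
Hypothesis L : levy_process P X.

Lemma levy_cadlag_ae : {ae P, forall w, cadlag_on_halfline (X ^~ w)}.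
Proof. exact: levy_cadlag L. Qed.

(** Stochastic continuity rules out a jump at a given time. *)
Lemma levy_left_limit t : 0 < t ->
  {ae P, forall w, lim (X s w @[s --> t^'-]) = X t w}.
Proof.
move=> t0; have mX s : 0 <= s -> measurable_fun setT (X s) by exact: levy_measurable L s.
pose tau n : R := t - t * n.+1%:R^-1.
have tau0 n : 0 <= tau n.
  by rewrite subr_ge0 ler_piMr ?(ltW t0)// invf_le1// ler1n.
have taut n : tau n < t by rewrite ltrBlDr ltrDl mulr_gt0// invr_gt0.
have ctau : tau n @[n --> \oo] --> t.
  rewrite -[X in _ --> X](subr0 t); apply: cvgB; first exact: cvg_cst.
  rewrite -[X in _ --> X](mulr0 t); apply: cvgMr; exact: cvg_harmonic.
pose E j n := [set w | j.+1%:R^-1 < `|X (tau n) w - X t w|].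
have mE j n : measurable (E j n).
  rewrite -[X in measurable X]setTI; apply: (measurable_fun_ltr (f := fun=> j.+1%:R^-1)) => //.
  by apply: measurableT_comp => //; apply: measurable_funB; apply: mX => //; exact: ltW.
have mEk j k : measurable (\bigcap_(n >= k) E j n).
  by apply: bigcap_measurable => [|n _]; [exists k => /=|exact: mE].
have E0 j k : P (\bigcap_(n >= k) E j n) = 0%E.
  have j0 : (0 : R) < j.+1%:R^-1 by rewrite invr_gt0.
  have h := levy_stochastically_continuous L (ltW t0) j0.
  have hc : P (E j n) @[n --> \oo] --> 0%E.
    apply: (@cvg_comp _ _ _ tau (fun s => P [set w | j.+1%:R^-1 < `|X s w - X t w|]) _ _ _ _ h).
    move=> A [r r0 hA]; have /cvgrPdist_lt/(_ r r0) := ctau.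
    by apply: filterS => n hn; apply: hA => //; exact: tau0.
  apply/eqP; rewrite eq_le measure_ge0 andbT.
  rewrite -(cvg_lim _ hc)//; apply: lime_ge; first by apply/cvg_ex; eexists; exact: hc.
  near=> n; apply: le_measure; rewrite ?inE//.
  by apply: bigcap_inf => /=; near: n; exact: nbhs_infty_ge.
have neg : P.-negligible (\bigcup_j \bigcup_k \bigcap_(n >= k) E j n).
  do 2 (apply: negligible_bigcup => ?); rewrite negligibleP//; exact: E0.
have nae : {ae P, forall w, ~ (\bigcup_j \bigcup_k \bigcap_(n >= k) E j n) w}.
  by apply: (negligibleS _ neg) => w /= /contrapT.
apply: filterS2 levy_cadlag_ae nae => w [_ cl] hw.
have := cl t t0; set l := lim _ => cvl.
have cX : X (tau n) w @[n --> \oo] --> l.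
  by move/cvg_at_leftP : (cvl : _ --> l); apply.
apply: contrapT => /eqP ne; apply: hw.
have e0 : 0 < `|l - X t w| / 2 by rewrite divr_gt0// normr_gt0 subr_eq0.
have [j _ hj] := near_infty_natSinv_lt (PosNum e0).
have /cvgrPdist_lt/(_ _ e0)[k _ hk] := cX.
exists j => //; exists k => // n /= kn.
have h1 := hk n kn; have h2 := hj j (leqnn j).
have h3 : `|l - X t w| <= `|l - X (tau n) w| + `|X (tau n) w - X t w|.
  by rewrite (le_trans _ (ler_normD _ _))// addrA subrK.
have half (a b c : R) : b < a / 2 -> a <= b + c -> a / 2 < c by lra.
exact: lt_trans h2 (half _ _ _ h1 h3).
Unshelve. all: by end_near. Qed.

End fixed_times.

Definition rat_seq (R : realType) (i : nat) : R :=
  if unpickle i is Some q then ratr (q : rat) else 0.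

Lemma rat_seq_dense (R : realType) (a b : R) : a < b ->
  exists i, a < rat_seq R i /\ rat_seq R i < b.
Proof.
move=> /rat_in_itvoo[q]; rewrite in_itv/= => /andP[aq qb].
by exists (pickle q); rewrite /rat_seq pickleK.
Qed.

Lemma right_continuous_ge (R : realType) (f : R -> R) (t c : R) :
  f r @[r --> t^'+] --> f t -> (forall i, t < rat_seq R i -> c <= f (rat_seq R i)) -> c <= f t.
Proof.
move=> /cvg_rightP h hc; rewrite leNgt; apply/negP => fc.
have e0 : 0 < (c - f t) / 2 by rewrite divr_gt0// subr_gt0.
have [d d0 hd] := h _ e0.
have td : t < t + d by rewrite ltrDl.
have [i [ti itd]] := rat_seq_dense td.
have := hd _ ti itd; rewrite ler_norml => /andP[+ _]; have := hc i ti; lra.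
Qed.

Section transience.
Context d (T : measurableType d) (R : realType) (P : probability T R).
Variables X1 X2 : R -> T -> R.
Hypotheses (L1 : levy_process P X1) (L2 : levy_process P X2).
Hypothesis (same : same_finite_dim_laws P [set t : R | 0 <= t] X1 X2).

Let tm (n i : nat) : R := Num.max n%:R (rat_seq R i).
Let tm0 n i : 0 <= tm n i. Proof. by rewrite le_max ler0n. Qed.
Let F (X : R -> T -> R) n (c : R) i := [set w | X (tm n i) w < c].

Let mF X n c i : levy_process P X -> measurable (F X n c i).
Proof.
move=> L; rewrite -[X in measurable X]setTI; apply: measurable_fun_ltr => //.
exact: levy_measurable L _ (tm0 n i).
Qed.

Let same_F n c M : P (\big[setU/set0]_(i < M) F X1 n c i) = P (\big[setU/set0]_(i < M) F X2 n c i).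
Proof.
pose t (i : 'I_M) := tm n i.
have mA : measurable (\big[setU/set0]_(i < M) [set x : M.-tuple R | tnth x i < c]).
  apply: bigsetU_measurable => i _; rewrite -[X in measurable X]setTI.
  by apply: measurable_fun_ltr => //; exact: measurable_tnth.
have := same (t := t) (fun i => tm0 n i) mA; rewrite /finite_dim_law /pushforward.
have E (X : R -> T -> R) : (fun w => [tuple X (t i) w | i < M]) @^-1`
    (\big[setU/set0]_(i < M) [set x : M.-tuple R | tnth x i < c]) = \big[setU/set0]_(i < M) F X n c i.
  rewrite (big_morph (fun A => (fun w => [tuple X (t i) w | i < M]) @^-1` A)
    (id1 := set0) (op1 := setU)) //; apply: eq_bigr => i _.
  by apply/seteqP; split=> w /=; rewrite tnth_mktuple.
by rewrite !E.
Qed.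

Let same_bigF n c : P (\bigcup_i F X1 n c i) = P (\bigcup_i F X2 n c i).
Proof.
have cv X : levy_process P X ->
    P (\big[setU/set0]_(i < M) F X n c i) @[M --> \oo] --> P (\bigcup_i F X n c i).
  move=> L; 
  have -> : \bigcup_i F X n c i = \bigcup_M \big[setU/set0]_(i < M) F X n c i.
    apply/seteqP; split=> w [i _]; last first.
      by rewrite -bigcup_mkord => -[k _ ?]; exists k.
    by move=> Fi; exists i.+1 => //; rewrite -bigcup_mkord; exists i => /=.

  have h := @nondecreasing_cvg_mu _ _ _ P (fun M => \big[setU/set0]_(i < M) F X n c i).
  apply: h.
  - by move=> M; apply: bigsetU_measurable => i _; exact: mF.
  - by apply: bigcup_measurable => M _; apply: bigsetU_measurable => i _; exact: mF.
  - by move=> x y xy; apply/subsetPset; exact: subset_bigsetU.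
rewrite -(cvg_lim _ (cv X1 L1))// -(cvg_lim _ (cv X2 L2))//.
by congr (limn _); apply/funext => M; exact: same_F.
Qed.

(** By right-continuity, the event of not drifting to infinity is described by
    countably many values, so that it has the same probability for X1 and X2. *)
Lemma levy_drift_transfer :
  {ae P, forall w, X1 t w @[t --> +oo] --> +oo} ->
  {ae P, forall w, X2 t w @[t --> +oo] --> +oo}.
Proof.
move=> h1.
have mE X n c : levy_process P X -> measurable (\bigcup_i F X n c i).
  by move=> L; apply: bigcup_measurable => i _; exact: mF.
have decr X c : nonincreasing_seq (fun n => \bigcup_i F X n c i).
  move=> m n mn; apply/subsetPset => w [i _ hi].
  have mn' : (m%:R : R) <= n%:R by rewrite ler_nat.
  have [j hj] : exists j, tm m j = tm n i.
    have [le_|lt_] := lerP n%:R (rat_seq R i).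
      exists i; rewrite /tm (max_idPr le_).
      by apply/max_idPr; exact: le_trans mn' le_.
    exists (pickle (n%:R : rat)); rewrite /tm (max_idPl (ltW lt_)).
    by rewrite {1}/rat_seq pickleK ratr_nat; apply/max_idPr.
  by exists j => //; rewrite /F/= hj.
have z1 c : P (\bigcap_n \bigcup_i F X1 n c i) = 0%E.
  have mC : measurable (\bigcap_n \bigcup_i F X1 n c i).
    by apply: bigcap_measurable => // n _; exact: mE.
  apply/(negligibleP P mC).
  apply: negligibleS h1 => w /= hn /cvgryPge/(_ c)[A [_ hA]].
  have [i _] := hn (Num.bound `|A|) I; rewrite /F/= ltNge => /negP; apply; apply: hA.
  rewrite (le_lt_trans (ler_norm _))// (lt_le_trans (archi_boundP _)) ?normr_id//.
  by rewrite /tm le_max lexx.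
have z2 c : P (\bigcap_n \bigcup_i F X2 n c i) = 0%E.
  have cv X : levy_process P X ->
    P (\bigcup_i F X n c i) @[n --> \oo] --> P (\bigcap_n \bigcup_i F X n c i).
    move=> L; have h := @nonincreasing_cvg_mu _ _ _ P (fun n => \bigcup_i F X n c i).
    apply: h => //.
    - by rewrite (le_lt_trans (probability_le1 _ _))// ?ltry//; exact: mE.
    - by move=> n; exact: mE.
    - by apply: bigcap_measurable => // n _; exact: mE.
  rewrite -(z1 c) -(cvg_lim _ (cv X1 L1))// -(cvg_lim _ (cv X2 L2))//.
  by congr (limn _); apply/funext => M; rewrite same_bigF.
have neg : P.-negligible (\bigcup_(j : nat) \bigcap_n \bigcup_i F X2 n j%:R i).
  apply: negligible_bigcup => j; 
  apply/(negligibleP P); last exact: z2.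
  by apply: bigcap_measurable => // n _; exact: mE.
have nae : {ae P, forall w, ~ (\bigcup_(j : nat) \bigcap_n \bigcup_i F X2 n j%:R i) w}.
  by apply: (negligibleS _ neg) => w /= /contrapT.
apply: filterS2 (levy_cadlag_ae L2) nae => w [cr _] hw.
apply/cvgryPge => A.
have [j Aj] : exists j : nat, A <= j%:R.
  by exists (Num.bound `|A|); rewrite (le_trans (ler_norm _))// ltW// archi_boundP.
have : ~ (\bigcap_n \bigcup_i F X2 n j%:R i) w by move=> h; apply: hw; exists j.
move=> /existsNP[n /not_implyP[_ hn]].
exists n%:R; split=> // t nt; rewrite (le_trans Aj)//.
apply: (right_continuous_ge (f := X2 ^~ w)); first by apply: cr; rewrite (le_trans (ler0n _ n))// ltW.
move=> i ti; rewrite leNgt; apply/negP => lt_; apply: hn; exists i => //.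
by rewrite /F/= /tm (max_idPr _)// ltW// (lt_trans nt).
Qed.

End transience.

Section almost_sure.
Context d (T : measurableType d) (R : realType) (P : probability T R).

Lemma probability_ae_eq (A B : set T) : measurable A -> measurable B ->
  {ae P, forall w, A w <-> B w} -> P A = P B.
Proof.
move=> mA mB h.
have E C : measurable C -> P C = (\int[P]_w (\1_C w)%:E)%E.
  by move=> mC; rewrite integral_indic// setIT.
rewrite (E _ mA) (E _ mB); apply: ae_eq_integral => //.
1,2: by apply/measurable_EFinP; exact: measurable_indic.
apply: filterS h => w h _; rewrite !indicE; congr (_%:R%:E).
by have [a|a] := boolP (w \in A); have [b|b] := boolP (w \in B) => //;
  move: a b; rewrite ?notin_setE ?in_setE => a b; [case: b|case: a]; apply/h.
Qed.

Lemma law_ae_eq (n : nat) (X Y : 'I_n -> T -> R) (A : set (n.-tuple R)) :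
  (forall i, measurable_fun setT (X i)) -> (forall i, measurable_fun setT (Y i)) ->
  (forall i, {ae P, forall w, X i w = Y i w}) -> measurable A ->
  P ((fun w => [tuple X i w | i < n]) @^-1` A) = P ((fun w => [tuple Y i w | i < n]) @^-1` A).
Proof.
move=> mX mY h mA.
have m (Z : 'I_n -> T -> R) : (forall i, measurable_fun setT (Z i)) ->
    measurable ((fun w => [tuple Z i w | i < n]) @^-1` A).
  move=> mZ; rewrite -[X in measurable X]setTI.
  suff : measurable_fun setT (fun w => [tuple Z i w | i < n]) by apply.
  apply/measurable_fun_tnthP => i; rewrite (_ : _ \o _ = Z i)//.
  by apply/funext => w /=; rewrite tnth_mktuple.
apply: probability_ae_eq; [exact: m|exact: m|].
apply: (filterS _ (filter_forall (F := almost_everywhere P) _ h)) => w /= hw.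
suff -> : [tuple X i w | i < n] = [tuple Y i w | i < n] by [].
by apply/eq_from_tnth => i; rewrite !tnth_mktuple.
Qed.

End almost_sure.

(** What remains of the two-sided Levy process once it is modified on a null set:
    every path is regular, and only the stationarity of the increments is kept
    of the Levy property. *)
Record drifting_path_process d (T : measurableType d) (R : realType)
    (P : probability T R) (x : R -> T -> R) : Prop := {
  path_measurable : forall t : R, measurable_fun setT (x t) ;
  path_right : forall (w : T) (t : R), x s w @[s --> t^'+] --> x t w ;
  path_left : forall (w : T) (t : R), cvg (x s w @[s --> t^'-]) ;
  path_drift : forall w : T, x t w @[t --> -oo] --> -oo ;
  path_increments : forall (n : nat) (s : 'I_n -> R) (h : R) (A : set (n.-tuple R)),
    measurable A ->
    P ((fun w => [tuple x (s i + h) w - x h w | i < n]) @^-1` A) =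
    P ((fun w => [tuple x (s i) w - x 0 w | i < n]) @^-1` A) }.

Section modification.
Context d (T : measurableType d) (R : realType) (P : probability T R).

Lemma regular_modification (xi : R -> T -> R) :
  two_sided_levy_process P xi ->
  {ae P, forall w, xi t w @[t --> +oo] --> +oo} ->
  exists x, drifting_path_process P x /\ {ae P, forall w, forall t, xi t w = x t w}.
Proof.
move=> [X1 [X2 [L1 L2 same indep hxi]]] drift.
have drift1 : {ae P, forall w, X1 t w @[t --> +oo] --> +oo}.
  apply: filterS drift => w h; apply: cvg_trans h; apply: near_eq_cvg.
  by near=> t; rewrite hxi ifT.
have drift2 := levy_drift_transfer L1 L2 same drift1.
have good : {ae P, forall w, (X1 0 w = 0 /\ X2 0 w = 0) /\
    ((cadlag_on_halfline (X1 ^~ w) /\ cadlag_on_halfline (X2 ^~ w)) /\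
    X2 t w @[t --> +oo] --> +oo)}.
  apply: filterS2 (filterI (levy_start0 L1) (levy_start0 L2)) _ => [w|].
    by move=> h1 h2; split; [exact: h1|exact: h2].
  by apply: filterI drift2; apply: filterI; exact: levy_cadlag_ae.
have [N [mN PN hN]] := good.
have goodN w : ~ N w -> (X1 0 w = 0 /\ X2 0 w = 0) /\
    ((cadlag_on_halfline (X1 ^~ w) /\ cadlag_on_halfline (X2 ^~ w)) /\
    X2 t w @[t --> +oo] --> +oo).
  by move=> Nw; apply: contrapT => h; apply: Nw; exact: hN.
have aeN : {ae P, forall w, ~ N w} by exists N; split=> // w /= /contrapT.
have xiE w t : xi t w = glue (X1 ^~ w) (X2 ^~ w) t by rewrite hxi.
(* On the exceptional set the path is the identity, which drifts to - oo. *)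
pose x t w := xi t w * \1_(~` N) w + t * \1_N w.
have xin w t : ~ N w -> x t w = xi t w.
  by move=> Nw; rewrite /x !indicE mem_set// memNset// mulr0 addr0 mulr1.
have xE w : ~ N w -> x^~ w = glue (X1 ^~ w) (X2 ^~ w).
  by move=> Nw; apply/funext => t; rewrite xin// xiE.
have x0 w : N w -> x ^~ w = id.
  move=> Nw; apply/funext => t; rewrite /x !indicE [w \in N]mem_set// memNset.
    by rewrite mulr0 add0r mulr1.
  by move=> /(_ Nw).
have mI : measurable_fun setT (\1_(~` N) : T -> R).
  by apply: measurable_indic; exact: measurableC.
have mx t : measurable_fun setT (x t).
  rewrite (_ : x t = (fun w => xi t w * \1_(~` N) w) \+ (fun w => t * \1_N w))//.
  apply: measurable_funD; last by apply: measurable_funM => //; exact: measurable_indic.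
  have [t0|t0] := lerP 0 t.
    have -> : (fun w => xi t w * \1_(~` N) w) = X1 t \* \1_(~` N).
      by apply/funext => w; rewrite hxi t0.
    by apply: measurable_funM => //; exact: levy_measurable L1 _ t0.
  pose r n : R := - t * (1 - n.+2%:R^-1).
  apply: (@measurable_fun_cvg _ _ _ _ (fun n w => - X2 (r n) w * \1_(~` N) w)).
    move=> n; apply: measurable_funM => //; apply: measurableT_comp => //.
    apply: levy_measurable L2 _ _; rewrite mulr_ge0 ?oppr_ge0 1?ltW//.
    by rewrite subr_gt0 invf_lt1// ltr1n.
  move=> w _; have [Nw|/[dup] Nw /goodN[_ [[_ [_ cl]] _]]] := pselect (N w).
    rewrite indicE memNset => [|/(_ Nw)//]; rewrite mulr0.
    by under eq_fun do rewrite mulr0; exact: cvg_cst.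
  rewrite hxi leNgt t0/=; apply: cvgMl; apply: cvgN.
  have nt0 : 0 < - t by rewrite oppr_gt0.
  have /cvg_leftP c := cl _ nt0.
  apply/cvgrPdist_le => e e0; have [dl d0 hd] := c _ e0.
  near=> n; apply: hd.
    rewrite /r mulrBr mulr1 ltrD2l ltrN2 ltr_pdivrMr// mulrC -ltr_pdivrMr//.
    apply: (@lt_trans _ _ n%:R); last by rewrite ltr_nat.
    by near: n; exact: nbhs_infty_gtr.
  rewrite /r mulrBr mulr1 gtrBl// mulr_gt0// invr_gt0 ltr0n//.
have aeE t : {ae P, forall w, x t w = two_sided X1 X2 t w}.
  have [t0|t0] := lerP 0 t.
    apply: filterS aeN => w Nw; have [[s1 s2] _] := goodN _ Nw.
    rewrite xin// hxi t0 /two_sided.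
    have [_|] := ltrP 0 t; first by rewrite s1 subr0.
    move=> t0'; have -> : t = 0 by apply/le_anti/andP; split.
    by rewrite s1 oppr0 s2 subr0.
  have nt0 : 0 < - t by rewrite oppr_gt0.
  apply: filterS2 aeN (levy_left_limit L2 nt0) => w Nw l.
  have [[s1 s2] _] := goodN _ Nw.
  by rewrite xin// hxi leNgt t0/= l /two_sided ltNge ltW//= s2 sub0r.
exists x; split; last first.
  by apply: filterS aeN => w Nw t; rewrite xin//.
split.
- exact: mx.
- move=> w t; have [/x0 xw|/[dup] Nw /xE xw] := pselect (N w).
    by rewrite -[x t w]/((x ^~ w) t) xw; apply: cvg_within; exact: cvg_id.
  have [_ [[c1 c2] _]] := goodN _ Nw.
  by rewrite -[x t w]/((x ^~ w) t) xw; exact: glue_right.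
- move=> w t; have [/x0 xw|/[dup] Nw /xE xw] := pselect (N w).
    by rewrite xw; apply/cvg_ex; exists t; apply: cvg_within; exact: cvg_id.
  have [_ [[c1 c2] _]] := goodN _ Nw.
  by rewrite xw; exact: glue_left.
- move=> w; have [/x0 ->|/[dup] Nw /xE ->] := pselect (N w); first exact: cvg_id.
  by have [_ [[c1 c2] l]] := goodN _ Nw; exact: glue_infty.
- move=> n s h A mA.
  transitivity (P ((fun w => [tuple two_sided X1 X2 (s i + h) w - two_sided X1 X2 h w | i < n]) @^-1` A)).
    apply: (law_ae_eq (X := fun i w => x (s i + h) w - x h w)
      (Y := fun i w => two_sided X1 X2 (s i + h) w - two_sided X1 X2 h w)) => // i.
    1: exact: measurable_funB.
    1: by apply: measurable_funB; exact: measurable_two_sided L1 L2 _.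
    by apply: filterS2 (aeE (s i + h)) (aeE h) => w -> ->.
  rewrite two_sided_shift//; apply/esym.
  apply: (law_ae_eq (X := fun i w => x (s i) w - x 0 w)
      (Y := fun i w => two_sided X1 X2 (s i) w - two_sided X1 X2 0 w)) => // i.
  1: exact: measurable_funB.
  1: by apply: measurable_funB; exact: measurable_two_sided L1 L2 _.
  by apply: filterS2 (aeE (s i)) (aeE 0) => w -> ->.
Unshelve. all: by end_near. Qed.

End modification.

(** * Suprema over the past *)

Section cadlag_paths.
Context (R : realType).

Lemma cadlag_locally_bounded (f : R -> R) (a b : R) :
  (forall t : R, f s @[s --> t^'+] --> f t) -> (forall t : R, cvg (f s @[s --> t^'-])) ->
  exists K : R, forall s, a <= s -> s <= b -> f s <= K.
Proof.
move=> fr fl.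
have /compact_near_coveringP cov := @segment_compact R a b.
have /= h : forall t : R, `[a, b]%classic t -> \forall t' \near t & K \near (+oo : set_system R), f t' <= K.
  move=> t _; have /cvg_rightP/(_ _ ltr01)[d1 d10 h1] := fr t; pose d1' : R := d1.
  have /cvg_leftP/(_ _ ltr01)[d2 d20 h2] := fl t.
  set l := lim _ in h2.
  exists ([set r | `|t - r| < Num.min d1 d2], [set K | Num.max (f t + 1) (l + 1) < K]) => /=.
    split; first by apply: nbhsx_ballx; rewrite lt_min d10.
    by exists (Num.max (f t + 1) (l + 1)); split; first exact: num_real.
  move=> [r K] /= []; rewrite lt_min gt_max => /andP[/ltr_normlP[r1 r2] /ltr_normlP[r3 r4]] /andP[K1 K2].
  have [tr|rt|<-] := ltgtP t r.
  - have r5 : r < t + d1 by lra.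
    by have := h1 r tr r5; rewrite ler_norml => /andP[? ?]; lra.
  - have : t - d2 < r by lra.
    by move=> /h2/(_ rt); rewrite -/l ler_norml => /andP[? ?]; lra.
  - lra.
have [M [_ hM]] := cov _ _ _ _ h.
exists (M + 1) => s as_ sb; apply: (hM (M + 1)); first by rewrite ltrDl.
by rewrite /= in_itv/= as_.
Qed.

Variable f : R -> R.
Hypothesis fr : forall t : R, f s @[s --> t^'+] --> f t.
Hypothesis fl : forall t : R, cvg (f s @[s --> t^'-]).
Hypothesis drift : f s @[s --> -oo] --> -oo.

Lemma drifting_path_bounded (b : R) : exists K : R, forall s, s <= b -> f s <= K.
Proof.
have /cvgrNyPle/(_ 0)[A [_ hA]] := drift.
have [K hK] := cadlag_locally_bounded A b fr fl.
exists (Num.max 0 K) => s sb; rewrite le_max.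
by have [/hA ->//|As] := ltrP s A; rewrite hK ?orbT.
Qed.

Definition past_sup (j : nat) : R := sup [set expR (f s) | s in [set s | s <= - j%:R]].

Lemma past_sup_has j : has_sup [set expR (f s) | s in [set s : R | s <= - j%:R]].
Proof.
split; first by exists (expR (f (- j%:R))), (- j%:R) => //=.
have [K hK] := drifting_path_bounded (- j%:R).
by exists (expR K) => _ [s /= sj <-]; rewrite ler_expR hK.
Qed.

Lemma past_sup_ub j s : s <= - j%:R -> expR (f s) <= past_sup j.
Proof. by move=> sj; apply: ub_le_sup (past_sup_has j).2 _ _; exists s. Qed.

Lemma past_sup_gt0 j : 0 < past_sup j.
Proof. exact: lt_le_trans (expR_gt0 _) (past_sup_ub (lexx _)). Qed.

Lemma past_sup_le j c : (forall s, s <= - j%:R -> expR (f s) <= c) -> past_sup j <= c.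
Proof.
move=> h; apply: ge_sup => [|_ [s sj <-]]; last exact: h.
exact: (past_sup_has j).1.
Qed.

Lemma past_sup_anti i j : (i <= j)%N -> past_sup j <= past_sup i.
Proof.
move=> ij; apply: past_sup_le => s sj; apply: past_sup_ub.
by rewrite (le_trans sj)// lerN2 ler_nat.
Qed.

Lemma past_sup_drop : exists k, past_sup k.+1 < past_sup k.
Proof.
apply: contrapT => h.
have e k : past_sup k = past_sup 0.
  elim: k => // k IH; apply/le_anti/andP; split; first exact: past_sup_anti.
  by rewrite -IH leNgt; apply/negP => lt_; apply: h; exists k.
have p0 := past_sup_gt0 0.
have /cvgrNyPle/(_ (ln (past_sup 0 / 2)))[A [_ hA]] := drift.
have : past_sup (Num.bound `|A|) <= past_sup 0 / 2.
  apply: past_sup_le => s sA; rewrite -[leRHS]lnK ?posrE ?divr_gt0// ler_expR; apply: hA.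
  rewrite (le_lt_trans sA)// ltrNl (le_lt_trans (ler_norm _))// normrN.
  exact: archi_boundP.
by rewrite e; lra.
Qed.

(** Right-continuity lets the supremum be approached along rational times. *)
Lemma past_sup_rat (k n : nat) (e : R) : 0 < e -> exists i, n%:R <= rat_seq R i /\
  past_sup (k + n) - e < expR (f (- k%:R - rat_seq R i)).
Proof.
move=> e0; have [_ [s /= sj <-] es] := sup_adherent e0 (past_sup_has (k + n)).
rewrite -/(past_sup _) in es.
have [sj'|sj'] := leP (- (k + n)%:R) s.
  exists (pickle (n%:R : rat)); rewrite /rat_seq pickleK ratr_nat; split=> //.
  by rewrite -opprD -natrD; have -> : - (k + n)%:R = s by apply/le_anti; rewrite sj' sj.
pose c := ln (Num.max (past_sup (k + n) - e) (expR (f s) / 2)).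
have m0 : 0 < Num.max (past_sup (k + n) - e) (expR (f s) / 2).
  by rewrite lt_max divr_gt0 ?expR_gt0 ?orbT.
have cs : c < f s.
  rewrite -ltr_expR lnK ?posrE// gt_max es/=; have := expR_gt0 (f s); lra.
have e1 : 0 < (f s - c) / 2 by rewrite divr_gt0// subr_gt0.
have /cvg_rightP/(_ _ e1)[dl d0 hd] := @fr s.
have [i [i1 i2]] : exists i, - k%:R - Num.min (s + dl) (- (k + n)%:R) < rat_seq R i /\ rat_seq R i < - k%:R - s.
  by apply: rat_seq_dense; rewrite ltrD2l ltrN2 lt_min sj' ltrDl d0.
have : - k%:R - rat_seq R i < Num.min (s + dl) (- (k + n)%:R) by lra.
rewrite lt_min natrD => /andP[i3 i4].
exists i; split; first lra.
have i5 : s < - k%:R - rat_seq R i by lra.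
have := hd _ i5 i3; rewrite ler_norml => /andP[h1 h2].
have : c < f (- k%:R - rat_seq R i) by lra.
rewrite -ltr_expR lnK ?posrE//; apply: le_lt_trans.
by rewrite le_max lexx.
Qed.

(** The times are written - k - q because the joint law of the increments from
    time - k to such times does not depend on k. *)
Definition partial_sup (M k n : nat) : R :=
  \big[Num.max/0]_(i < M | n%:R <= rat_seq R i) expR (f (- k%:R - rat_seq R i)).

Lemma partial_sup_cvg k n : partial_sup M k n @[M --> \oo] --> past_sup (k + n).
Proof.
have ub M : partial_sup M k n <= past_sup (k + n).
  apply: bigmax_le => [|i ni]; first exact/ltW/past_sup_gt0.
  by apply: past_sup_ub; rewrite natrD; lra.
apply/cvgrPdist_lt => e e0; have [i [ni hi]] := past_sup_rat k n e0.
exists i.+1 => // M /= iM; rewrite ger0_norm ?subr_ge0//.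
have : expR (f (- k%:R - rat_seq R i)) <= partial_sup M k n.
  exact: (@le_bigmax_cond _ _ _ _ (Ordinal iM) (fun j : 'I_M => n%:R <= rat_seq R j)
    (fun j : 'I_M => expR (f (- k%:R - rat_seq R j)))).
lra.
Qed.

End cadlag_paths.

Section mean_bounds.
Context d (T : measurableType d) (R : realType) (P : probability T R).

Lemma same_law_Rintegral d' (T' : measurableType d') (f g : T -> T') (phi : T' -> R) (M : R) :
  measurable_fun setT f -> measurable_fun setT g -> measurable_fun setT phi ->
  (forall y, `|phi y| <= M) ->
  (forall A, measurable A -> P (f @^-1` A) = P (g @^-1` A)) ->
  \int[P]_w phi (f w) = \int[P]_w phi (g w).
Proof.
move=> mf mg mphi phiM fg.
have mphiE : measurable_fun setT (EFin \o phi) by apply/measurable_EFinP.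
have E h (mh : measurable_fun setT h) : (\int[P]_w (phi (h w))%:E =
    \int[image_measure P mh]_y (phi y)%:E)%E.
  rewrite (integral_pushforward mh)// preimage_setT.
  apply: (@bounded_integrable _ _ _ _ _ (phi \o h) M) => //; first exact: probability_lty.
    exact: measurableT_comp.
  by move=> w; exact: phiM.
rewrite /Rintegral (E _ mf) (E _ mg); congr fine; apply: eq_measure_integral => A mA _.
exact: fg.
Qed.

(** By monotone convergence the supremum of the sequence has a finite mean. *)
Lemma mean_bounded_ae (f : nat -> T -> R) (C : R) :
  (forall n, measurable_fun setT (f n)) -> (forall n w, 0 <= f n w) ->
  (forall w, {homo f ^~ w : m n / (m <= n)%N >-> m <= n}) ->
  (forall n, \int[P]_w f n w <= C) ->
  (forall n, P.-integrable setT (EFin \o f n)) ->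
  {ae P, forall w, exists K, forall n, f n w <= K}.
Proof.
move=> mf f0 f_nd fC fi.
pose g n w := (f n w)%:E; pose L w := ereal_sup (range (g ^~ w)).
have gL w : g n w @[n --> \oo] --> L w.
  by apply: ereal_nondecreasing_cvgn => m n mn; rewrite /g lee_fin; exact: f_nd.
have mg n : measurable_fun setT (g n) by apply/measurable_EFinP.
have mL : measurable_fun setT L by apply: emeasurable_fun_cvg (mg) _ => w _; exact: gL.
have L0 w : (0 <= L w)%E.
  apply: (@le_trans _ _ (g 0%N w)); first by rewrite lee_fin.
  by apply: ereal_sup_ubound; exists 0%N.
have iL : (\int[P]_w L w <= C%:E)%E.
  have -> : (\int[P]_w L w = \int[P]_w limn (g ^~ w))%E.
    by apply: eq_integral => w _; apply/esym/cvg_lim => //; exact: gL.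
  rewrite monotone_convergence//; last 2 first.
  - by move=> n w _; rewrite lee_fin.
  - by move=> w _ m n mn; rewrite lee_fin; exact: f_nd.
  apply: lime_le.
    apply: ereal_nondecreasing_is_cvgn => m n mn; apply: ge0_le_integral => //.
    - by move=> w _; rewrite lee_fin.
    - by move=> w _; rewrite lee_fin; exact: f_nd.
  apply: nearW => n; rewrite -[leLHS]fineK ?lee_fin; first exact: fC.
  exact: integrable_fin_num (fi n).
have : P.-integrable setT L.
  apply/integrableP; split=> //.
  by under eq_integral do rewrite gee0_abs//; rewrite (le_lt_trans iL)// ltry.
move=> /(integrable_ae measurableT); apply: filterS => w /(_ I) Lw.
exists (fine (L w)) => n; rewrite -lee_fin fineK//.
by apply: ereal_sup_ubound; exists n.
Qed.

Lemma measurable_bigmax (I : Type) (r : seq I) (p : pred I) (F : I -> T -> R) :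
  (forall i, measurable_fun setT (F i)) ->
  measurable_fun setT (fun w => \big[Num.max/0]_(i <- r | p i) F i w).
Proof.
move=> mF; elim: r => [|i r IH].
  by under eq_fun do rewrite big_nil; exact: measurable_cst.
under eq_fun do rewrite big_cons; case: (p i) => //.
exact: measurable_maxr.
Qed.

Lemma measurable_inv_ge0 (f : T -> R) : measurable_fun setT f ->
  (forall w, 0 <= f w) -> measurable_fun setT (fun w => (f w)^-1).
Proof.
move=> mf f0; under eq_fun do rewrite -powR_inv1//.
apply: (@measurableT_comp _ _ _ _ _ _ (fun x : R => x `^ (-1))) => //.
Qed.

End mean_bounds.

Lemma bigmax_scale (R : realType) (I : Type) (r : seq I) (p : pred I) (F : I -> R) (c : R) :
  0 <= c -> \big[Num.max/0]_(i <- r | p i) (c * F i) = c * \big[Num.max/0]_(i <- r | p i) F i.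
Proof.
move=> c0; elim/big_rec2: _ => [|i y z _ ->]; first by rewrite mulr0.
by rewrite maxr_pMr.
Qed.

Section past_suprema.
Context d (T : measurableType d) (R : realType) (P : probability T R) (x : R -> T -> R).
Hypothesis px : drifting_path_process P x.

Let U j w := past_sup (x ^~ w) j.
Let V M k n w := partial_sup (x ^~ w) M k n.
Let mx := path_measurable px.

Let U0 j w : 0 < U j w.
Proof. by apply: past_sup_gt0; [exact: path_right px w|exact: path_left px w|exact: path_drift px w]. Qed.

Let Uanti i j w : (i <= j)%N -> U j w <= U i w.
Proof. by apply: past_sup_anti; [exact: path_right px w|exact: path_left px w|exact: path_drift px w]. Qed.

Let V_cvg k n w : V M k n w @[M --> \oo] --> U (k + n) w.
Proof. by apply: partial_sup_cvg; [exact: path_right px w|exact: path_left px w|exact: path_drift px w]. Qed.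

Let V0 M k n w : 0 <= V M k n w.
Proof. exact: bigmax_ge_id. Qed.

Let Vanti M k n w : V M k n w <= V M k 0 w.
Proof. by apply: sub_bigmax => i; apply: le_trans; rewrite ler_nat. Qed.

Let mV M k n : measurable_fun setT (V M k n).
Proof. by apply: measurable_bigmax => i; apply: measurableT_comp. Qed.

Let mU j : measurable_fun setT (U j).
Proof.
have h w : V M 0 j w @[M --> \oo] --> U j w by have := @V_cvg 0 j w; rewrite add0n.
exact: (@measurable_fun_cvg _ _ _ _ (fun M => V M 0 j) (U j) (fun M => @mV M 0%N j) (fun w _ => h w)).
Qed.

Let ratio_le1 (a b : R) : 0 <= a -> a <= b -> `|a / b| <= 1.
Proof.
move=> a0 ab; rewrite ger0_norm ?divr_ge0 ?(le_trans a0)//.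
have [->|b0] := eqVneq b 0; first by rewrite invr0 mulr0.
by rewrite ler_pdivrMr ?mul1r// lt_neqAle eq_sym b0 (le_trans a0).
Qed.

Let cvg_mean k n :
  (\int[P]_w (V M k n w / V M k 0 w))%R @[M --> \oo] --> (\int[P]_w (U (k + n) w / U k w))%R.
Proof.
apply: (@bounded_Rintegral_cvg _ _ _ P _ (fun M w => V M k n w / V M k 0 w) _ 1).
- exact: probability_lty.
- by move=> M; apply: measurable_funM => //; exact: measurable_inv_ge0.
- by move=> M w; exact: ratio_le1.
- move=> w; apply: cvgM; first exact: V_cvg.
  by apply: cvgV; rewrite ?gt_eqF//; have := @V_cvg k 0 w; rewrite addn0.
Qed.

(** The factor exp(x(- k)) cancels in the ratio of the two suprema, which
    therefore depends on the increments from time - k only; their law is the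
    same for every k. *)
Let mean_ratio_shift M k n :
  (\int[P]_w (V M k n w / V M k 0 w) = \int[P]_w (V M 0 n w / V M 0 0 w))%R.
Proof.
pose W j (y : M.-tuple R) := \big[Num.max/0]_(i < M | j%:R <= rat_seq R i) expR (tnth y i).
have mW j : measurable_fun setT (W j).
  by apply: measurable_bigmax => i; apply: measurableT_comp => //; exact: measurable_tnth.
have W0 j y : 0 <= W j y.
  exact: bigmax_ge_id.
pose Y h w := [tuple x (- rat_seq R i + h) w - x h w | i < M].
have mY h : measurable_fun setT (Y h).
  apply/measurable_fun_tnthP => i; rewrite (_ : _ \o _ = x (- rat_seq R i + h) \- x h).
    exact: measurable_funB.
  by apply/funext => w /=; rewrite tnth_mktuple.
have VW j l w : V M j l w = expR (x (- j%:R) w) * W l (Y (- j%:R) w).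
  rewrite /W -bigmax_scale ?expR_ge0//; apply: eq_bigr => i _.
  by rewrite tnth_mktuple -expRD; congr expR; rewrite [- rat_seq R i + _]addrC; ring.
have E j w : V M j n w / V M j 0 w = W n (Y (- j%:R) w) / W 0%N (Y (- j%:R) w).
  by rewrite !VW -mulf_div divff ?mul1r// gt_eqF// expR_gt0.
transitivity (\int[P]_w ((fun y => W n y / W 0%N y) (Y (- k%:R) w)))%R.
  by apply: eq_Rintegral => w _; rewrite E.
transitivity (\int[P]_w ((fun y => W n y / W 0%N y) (Y (- 0%:R) w)))%R; last first.
  by apply: eq_Rintegral => w _; rewrite E.
apply: (same_law_Rintegral (phi := fun y => W n y / W 0%N y) (M := 1)) => //.
- by apply: measurable_funM => //; exact: measurable_inv_ge0.
- move=> y; apply: ratio_le1 => //; apply: sub_bigmax => i.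
  by apply: le_trans; rewrite ler_nat.
- move=> A mA; have h := path_increments px (fun i : 'I_M => - rat_seq R i) (- k%:R) mA.
  rewrite /Y h oppr0.
  by congr (P (_ @^-1` A)); apply/funext => w; apply: eq_mktuple => i; rewrite addr0.
Qed.

Let mean_ratio k n :
  (\int[P]_w (U (k + n) w / U k w) = \int[P]_w (U n w / U 0 w))%R.
Proof.
have c1 := @cvg_mean k n; have := @cvg_mean 0 n.
rewrite (_ : (fun M => _) = (fun M => \int[P]_w (V M k n w / V M k 0 w))%R).
  by move=> c2; rewrite -(cvg_lim _ c1)// -(cvg_lim _ c2).
by apply/funext => M; rewrite mean_ratio_shift.
Qed.

Let iratio i j : (j <= i)%N -> P.-integrable setT (EFin \o (fun w => U i w / U j w)).
Proof.
move=> ji; apply: (@bounded_integrable _ _ _ _ _ _ 1); first exact: probability_lty.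
- by apply: measurable_funM => //; apply: measurable_inv_ge0 => // w; exact: ltW.
- by move=> w; apply: ratio_le1; [exact: ltW|exact: Uanti].
Qed.

(** Nonnegative since the suprema decrease with k. Its mean is a difference of two
    consecutive values of a sequence that does not depend on k. *)
Let drop k n w : R := U (k.+1 + n) w / U k.+1 w - U (k + n.+1) w / U k w.

Let drop_ge0 k n w : 0 <= drop k n w.
Proof.
rewrite /drop addSnnS subr_ge0 ler_pM2l// lef_pV2 ?posrE//; exact: Uanti.
Qed.

Let idrop k n : P.-integrable setT (EFin \o drop k n).
Proof.
have h1 : P.-integrable setT (EFin \o (fun w => U (k.+1 + n) w / U k.+1 w)).
  by apply: iratio; rewrite leq_addr.
have h2 : P.-integrable setT (EFin \o (fun w => U (k + n.+1) w / U k w)).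
  by apply: iratio; rewrite leq_addr.
exact: eq_integrable (integrableB measurableT h1 h2).
Qed.

Let drop_sum k N w : R := \sum_(n < N) drop k n w.

Let idrop_sum k N : P.-integrable setT (EFin \o drop_sum k N).
Proof.
rewrite (_ : _ \o _ = fun w => (\sum_(n < N) (drop k n w)%:E)%E).
  by apply: integrable_sum => // n _; exact: idrop.
by apply/funext => w /=; rewrite sumEFin.
Qed.

Let drop_sum_mean k N : (\int[P]_w drop_sum k N w <= 1)%R.
Proof.
have -> : (\int[P]_w drop_sum k N w =
    \int[P]_w (U 0 w / U 0 w) - \int[P]_w (U N w / U 0 w))%R.
  elim: N => [|N IH].
    by rewrite subrr /drop_sum; under eq_Rintegral do rewrite big_ord0; rewrite Rintegral_cst// mul0r.
  transitivity (\int[P]_w (drop_sum k N w + drop k N w))%R.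
    by apply: eq_Rintegral => w _; rewrite /drop_sum big_ord_recr.
  rewrite RintegralD// IH RintegralB//; last 2 first.
  - by apply: iratio; rewrite leq_addr.
  - by apply: iratio; rewrite leq_addr.
  rewrite (mean_ratio k.+1 N) (mean_ratio k N.+1).
  by rewrite addrA subrK.
have -> : (\int[P]_w (U 0 w / U 0 w) = 1)%R.
  under eq_Rintegral do rewrite divff ?gt_eqF//.
  by rewrite Rintegral_cst// mul1r -[RHS]/(fine 1%E); congr fine; exact: probability_setT.
by rewrite gerBl Rintegral_ge0// => w _; rewrite divr_ge0// ltW.
Qed.

(** The sum of the drops is the partial sum of the suprema beyond k + 1, times
    1 / U_(k+1) - 1 / U_k. This factor is positive for some k, since the positive
    suprema tend to 0. *)
Lemma past_sup_summable :
  {ae P, forall w, exists K : R, forall N, \sum_(j < N) past_sup (x ^~ w) j <= K}.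
Proof.
have h k : {ae P, forall w, exists K, forall N, drop_sum k N w <= K}.
  apply: (@mean_bounded_ae _ _ _ _ _ 1).
  - by move=> N; apply/measurable_EFinP; exact: measurable_int (idrop_sum k N).
  - by move=> N w; exact: sumr_ge0.
  - move=> w; apply: homo_leq => //[a b c|N]; first exact: le_trans.
    by rewrite /drop_sum big_ord_recr/= lerDl.
  - exact: drop_sum_mean.
  - exact: idrop_sum.
have := ae_foralln h; apply: filterS => w hw.
have [k Uk] : exists k, U k.+1 w < U k w.
  by apply: past_sup_drop; [exact: path_right px w|exact: path_left px w|exact: path_drift px w].
have [K hK] := hw k.
have c0 : 0 < (U k.+1 w)^-1 - (U k w)^-1 by rewrite subr_gt0 ltf_pV2// posrE.
exists (k.+1%:R * U 0 w + K / ((U k.+1 w)^-1 - (U k w)^-1)) => N.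
apply: (@le_trans _ _ (\sum_(j < k.+1 + N) U j w)).
  rewrite -!(big_mkord xpredT (fun j => U j w)) (big_cat_nat (n := N) _ (leq_addl _ _))//=.
  by rewrite lerDl sumr_ge0// => i _; exact: ltW.
rewrite big_split_ord/= lerD//.
  apply: (@le_trans _ _ (\sum_(i < k.+1) U 0 w)); first by apply: ler_sum => i _; exact: Uanti.
  by rewrite sumr_const card_ord mulr_natl.
rewrite ler_pdivlMr// mulr_suml; apply: le_trans (hK N).
by apply: ler_sum => i _; rewrite /drop -addSnnS mulrBr.
Qed.

End past_suprema.

(** * Riemann step functions along one path *)

(** Partitions of a half-line up to t that become finer and reach further into
    the past; the k-th one has m k intervals. Allowing any number of intervals
    makes this notion stable under passage to subsequences. *)
Record refining (R : realType) (t : R) (m : nat -> nat) (u : nat -> nat -> R) : Prop := {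
  refining_last : forall k, u k (m k) = t ;
  refining_lt : forall k i, (i < m k)%N -> u k i < u k i.+1 ;
  refining_mesh : forall e : R, 0 < e ->
    \forall k \near \oo, forall i, (i < m k)%N -> u k i.+1 - u k i < e ;
  refining_start : forall A : R, \forall k \near \oo, u k 0%N < A }.

Lemma refining_sub (R : realType) (t : R) m u (phi : nat -> nat) :
  @refining R t m u -> (forall k, k <= phi k)%N ->
  refining t (m \o phi) (u \o phi).
Proof.
move=> [h1 h2 h3 h4] le_; split.
- by move=> k; exact: h1.
- by move=> k i; exact: h2.
- move=> e e0; have [n _ hn] := h3 e e0.
  by exists n => // k /= nk; apply: hn => /=; exact: leq_trans nk (le_ k).
- move=> A; have [n _ hn] := h4 A.
  by exists n => // k /= nk; apply: hn => /=; exact: leq_trans nk (le_ k).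
Qed.

Definition path_steps (R : realType) (f : R -> R) (m : nat) (u : nat -> R) : seq (R * R * R) :=
  [seq (expR (f (u i)), u i, u i.+1) | i <- iota 0 m].

Section path_steps.
Context (R : realType) (f : R -> R).

Lemma path_steps_sorted m (u : nat -> R) : (forall i, (i < m)%N -> u i < u i.+1) ->
  forall p, p \in path_steps f m u -> p.1.2 <= p.2.
Proof. by move=> um p /mapP[i]; rewrite mem_iota/= => /um/ltW ui ->. Qed.

Lemma step_fun_path_stepsS m (u : nat -> R) s : step_fun (path_steps f m.+1 u) s =
  step_fun (path_steps f m u) s + expR (f (u m)) * ((u m <= s) && (s < u m.+1))%:R.
Proof.
have iS : iota 0 m.+1 = iota 0 m ++ [:: m] by rewrite -addn1 iotaD.
by rewrite /step_fun /path_steps iS map_cat big_cat/= big_seq1.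
Qed.

Lemma step_fun_path_steps m (u : nat -> R) s : (forall i, (i < m)%N -> u i < u i.+1) ->
  [/\ u 0%N <= u m, s < u 0%N \/ u m <= s -> step_fun (path_steps f m u) s = 0 &
    u 0%N <= s -> s < u m -> exists i, [/\ (i < m)%N, u i <= s, s < u i.+1 &
      step_fun (path_steps f m u) s = expR (f (u i))]].
Proof.
elim: m => [|m IH] um.
  split=> // [_|us su]; first by rewrite /step_fun big_nil.
  by have := le_lt_trans us su; rewrite ltxx.
have [u0 h1 h2] := IH (fun i im => um i (ltnW im)).
have umS := um m (ltnSn m); rewrite step_fun_path_stepsS; split.
- by rewrite (le_trans u0)// ltW.
- case=> [su|us].
    rewrite h1 ?add0r; last by left.
    by rewrite leNgt (lt_le_trans su u0)//= mulr0.
  rewrite h1 ?add0r; last by right; rewrite (le_trans (ltW umS)).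
  by rewrite ltNge us andbF mulr0.
- move=> us su; have [um_s|s_um] := leP (u m) s.
    exists m; split=> //; rewrite h1 ?add0r; last by right.
    by rewrite su mulr1.
  have [i [im ui iu E]] := h2 us s_um.
  by exists i; split=> //; [exact: ltnW|rewrite E mulr0 addr0].
Qed.

End path_steps.

Section riemann_step_functions.
Context (R : realType) (f : R -> R) (t : R).
Hypothesis fr : forall t : R, f s @[s --> t^'+] --> f t.
Hypothesis fl : forall t : R, cvg (f s @[s --> t^'-]).
Hypothesis drift : f s @[s --> -oo] --> -oo.
Hypothesis summable : exists K : R, forall N, \sum_(j < N) past_sup f j <= K.
Hypothesis t0 : 0 <= t.
Local Notation mu := (@lebesgue_measure R).
Local Notation mR := (measurableTypeR R).
Local Notation stepf m u := (step_fun (path_steps f m u)).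

Lemma stepf_bounded : exists2 K : R, 0 <= K & forall m (u : nat -> R) s, u m = t ->
  (forall i, (i < m)%N -> u i < u i.+1) -> 0 <= stepf m u s <= K.
Proof.
have [K hK] := drifting_path_bounded fr fl drift t.
exists (expR K); first exact: expR_ge0.
move=> m u s ut um; have [_ h1 h2] := step_fun_path_steps f s um.
have [us|us] := leP (u 0%N) s; last by rewrite h1 ?lexx ?expR_ge0//; left.
have [su|su] := ltP s (u m); last by rewrite h1 ?lexx ?expR_ge0//; right.
have [i [_ ui _ ->]] := h2 us su.
by rewrite expR_ge0 ler_expR hK// -ut (le_trans ui)// ltW.
Qed.

(** A single integrable function dominates all the step functions: on the
    j-th unit interval of the past it is the supremum over the past of time -j. *)
Lemma stepf_envelope : exists2 env : mR -> \bar R, mu.-integrable setT env &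
  forall m (u : nat -> R) (s : mR), u m = t -> (forall i, (i < m)%N -> u i < u i.+1) ->
    ((stepf m u s)%:E <= env s)%E.
Proof.
have [K0 K00 hK0] := stepf_bounded.
have [K hK] := summable.
(* The interval of index 0 also contains ]0, t]. *)
pose c j := if j is 0%N then K0 else past_sup f j.
pose A j : set mR := if j is 0%N then `](-1), t]%classic else `](- j.+1%:R), (- j%:R)]%classic.
have c0 j : 0 <= c j by case: j => // j; exact/ltW/past_sup_gt0.
have mA j : measurable (A j) by case: j => [|j]; exact: measurable_itv.
pose h j (s : mR) := (c j * \1_(A j) s)%:E.
have h0 j s : (0 <= h j s)%E by rewrite lee_fin mulr_ge0.
have mh j : measurable_fun setT (h j).
  by apply/measurable_EFinP; apply: measurable_funM => //; exact: measurable_indic.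
pose env s := (\sum_(0 <= j <oo) h j s)%E.
have menv : measurable_fun setT env.
  by apply: (ge0_emeasurable_sum (P := xpredT)).
have env0 s : (0 <= env s)%E by apply: nneseries_ge0.
have mu_itv (a b : R) : a < b -> mu `]a, b]%classic = (b - a)%:E.
  by move=> ab; rewrite lebesgue_measure_itv/= lte_fin ab -EFinB.
have ih j : (\int[mu]_s h j s = (c j * (if j is 0%N then t + 1 else 1))%:E)%E.
  transitivity (\int[mu]_s ((c j)%:E * (\1_(A j) s)%:E))%E.
    by apply: eq_integral => s _; rewrite -EFinM.
  rewrite ge0_integralZl ?lee_fin//; last first.
    by apply/measurable_EFinP; exact: measurable_indic.
  rewrite integral_indic// setIT EFinM; congr (_ * _)%E.
  case: j => [|j].
    have lt1 : -1 < t by rewrite (lt_le_trans _ t0)// ltrN10.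
    by have := mu_itv _ _ lt1; rewrite opprK.
  have ltj : - j.+2%:R < - j.+1%:R :> R by rewrite ltrN2 ltr_nat.
  have e1 : - j.+1%:R - - j.+2%:R = 1 :> R by rewrite opprK addrC -natrB// subSnn.
  by have := mu_itv _ _ ltj; rewrite e1.
exists env.
  apply/integrableP; split=> //.
  under eq_integral do rewrite gee0_abs//.
  rewrite integral_nneseries//.
  apply: (@le_lt_trans _ _ (K0 * (t + 1) + K)%:E); last exact: ltry.
  apply: lime_le.
    by apply: is_cvg_nneseries => j _ _; exact: integral_ge0.
  apply: nearW => N; under eq_bigr do rewrite ih.
  rewrite sumEFin lee_fin big_mkord.
  case: N => [|N].
    rewrite big_ord0 addr_ge0//; first by rewrite mulr_ge0// addr_ge0.
    by have := hK 0%N; rewrite big_ord0.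
  rewrite big_ord_recl/= lerD2l; apply: le_trans (hK N.+1).
  rewrite big_ord_recl/=; under eq_bigr do rewrite mulr1.
  by rewrite lerDr; exact/ltW/past_sup_gt0.
move=> m u s ut um.
have [_ h1 h2] := step_fun_path_steps f s um.
have := hK0 m u s ut um => /andP[_ sK].
have [us|us] := leP (u 0%N) s; last by rewrite h1 ?env0//; left.
have [su|su] := ltP s (u m); last by rewrite h1 ?env0//; right.
have [i [_ ui _ E]] := h2 us su.
have dom j : A j s -> stepf m u s <= c j -> ((stepf m u s)%:E <= env s)%E.
  move=> As sc; apply: (@le_trans _ _ (\sum_(0 <= i < j.+1) h i s)%E).
    rewrite big_nat_recr//=; apply: (@le_trans _ _ (h j s)).
      by rewrite lee_fin indicE mem_set// mulr1.
    by rewrite leeDr// sume_ge0.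
  by apply: nneseries_lim_ge.
have [s1|s1] := ltP (-1) s.
  by apply: (dom 0%N) => //=; rewrite in_itv/= s1 -ut ltW.
have ns0 : 0 <= - s by lra.
have /andP[j1 j2] := trunc_itv ns0.
have [j Ej] : exists j, Num.trunc (- s) = j.+1.
  case: (Num.trunc (- s)) j2 => [|j] j2; last by exists j.
  by move: j2; rewrite ltrNl ltNge s1.
rewrite Ej in j1 j2.
apply: (dom j.+1); first by rewrite /= in_itv/=; apply/andP; split; lra.
rewrite E; apply: past_sup_ub => //; lra.
Qed.

Lemma stepf_cvg m (u : nat -> nat -> R) s : refining t m u ->
  (forall k i, s <> u k i) ->
  stepf (m k) (u k) s @[k --> \oo] --> (if s < t then expR (lim (f r @[r --> s^'-])) else 0).
Proof.
move=> ref su; have [st|st] := ltP s t; last first.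
  rewrite (_ : (fun k => _) = cst 0); first exact: cvg_cst.
  apply/funext => k /=.
  have [_ h1 _] := step_fun_path_steps f s (@refining_lt _ _ _ _ ref k).
  by rewrite h1//; right; rewrite (refining_last ref).
have expl : expR (f r) @[r --> s^'-] --> expR (lim (f r @[r --> s^'-])).
  by apply: continuous_cvg => //; exact: continuous_expR.
apply/cvgrPdist_le => e e0.
have /cvg_leftP/(_ _ e0)[dl d0 hd] := expl.
near=> k.
have [_ _ h2] := step_fun_path_steps f s (@refining_lt _ _ _ _ ref k).
have [] := h2.
- by apply: ltW; near: k; exact: refining_start ref s.
- by rewrite (refining_last ref).
move=> i [im ui us ->]; apply: hd; last by rewrite lt_neqAle ui andbT; apply/eqP => /esym; exact: su.
have : u k i.+1 - u k i < dl.
  by move: i im {ui us}; near: k; exact: refining_mesh ref _ d0.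
move: us; set a := u k i.+1; set b := u k i; lra.
Unshelve. all: by end_near. Qed.

(** The step functions of both sequences tend to the left limits of exp(f), except
    at the countably many points of the partitions. *)
Lemma stepf_L1 m u m' v : refining t m u -> refining t m' v ->
  (\int[mu]_s `|stepf (m k) (u k) s - stepf (m' k) (v k) s|%:E)%E @[k --> \oo] --> 0%E.
Proof.
move=> ru rv.
have [env ienv henv] := stepf_envelope.
have [K0 _ hK] := stepf_bounded.
pose F k (s : mR) := `|stepf (m k) (u k) s - stepf (m' k) (v k) s|%:E.
have mF k : measurable_fun setT (F k).
  apply/measurable_EFinP; apply: measurableT_comp => //.
  by apply: measurable_funB; exact: measurable_step_fun.
pose Q : set mR := \bigcup_(p in [set: nat * nat]) [set u p.1 p.2; v p.1 p.2].
have Q0 : mu.-negligible Q.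
  have cQ : countable Q 
    by apply: bigcup_countable => // p _; exact/finite_set_countable/finite_set2.
  apply/negligibleP; last exact: countable_lebesgue_measure0.
  by apply: countable_measurable cQ => r; exact: measurable_set1.
have ae0 : {ae mu, forall s, setT s -> F k s @[k --> \oo] --> 0%E}.
  apply: negligibleS Q0 => s /= /not_implyP[_ ns]; apply: contrapT => Qs; apply: ns.
  have nu k i : s <> u k i by move=> su; apply: Qs; exists (k, i) => //; left.
  have nv k i : s <> v k i by move=> sv; apply: Qs; exists (k, i) => //; right.
  apply: cvg_EFin; first exact: nearW.
  rewrite -[X in _ --> X](normr0 R) -[X in `|X|](subrr (if s < t then expR (lim (f r @[r --> s^'-])) else 0)).
  by apply: cvg_norm; apply: cvgB; exact: stepf_cvg.
have dom : {ae mu, forall s, forall k, setT s -> (`|F k s| <= env s)%E}.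
  apply: nearW => s k _.
  have /andP[a0 _] := hK _ _ s (refining_last ru k) (@refining_lt _ _ _ _ ru k).
  have /andP[b0 _] := hK _ _ s (refining_last rv k) (@refining_lt _ _ _ _ rv k).
  have ha := henv _ _ s (refining_last ru k) (@refining_lt _ _ _ _ ru k).
  have hb := henv _ _ s (refining_last rv k) (@refining_lt _ _ _ _ rv k).
  move: a0 b0 ha hb; rewrite /F /= normr_id.
  set a := stepf _ _ _; set b := stepf _ _ _ => a0 b0 ha hb.
  have [ab|ba] := leP a b.
    by apply: le_trans hb; rewrite lee_fin ler_norml; apply/andP; split; lra.
  by apply: le_trans ha; rewrite lee_fin ler_norml; apply/andP; split; lra.
have [_ _] := dominated_convergence measurableT mF (measurable_cst 0%E) ae0 ienv dom.
by rewrite integral0.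
Qed.

End riemann_step_functions.

(** * Riemann sums for two different partitions *)

Lemma chebyshev_sqr d (T : measurableType d) (R : realType) (P : probability T R)
    (D : T -> R) (e : R) : 0 < e -> measurable_fun setT D ->
  (P [set w | (e < `|D w|)%R] <= (e ^- 2)%:E * \int[P]_w (D w ^+ 2)%:E)%E.
Proof.
move=> e0 mD.
have mA : measurable [set w | (e < `|D w|)%R].
  rewrite -[X in measurable X]setTI; apply: measurable_fun_ltr => //.
  exact: measurableT_comp.
have mD2 : measurable_fun setT (fun w => (D w ^+ 2)%:E).
  by apply/measurable_EFinP; exact: measurable_funX.
have e2 : 0 <= e ^- 2 by rewrite invr_ge0 exprn_ge0// ltW.
have -> : P [set w | (e < `|D w|)%R] = (\int[P]_w (\1_[set w | (e < `|D w|)%R] w)%:E)%E.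
  by rewrite integral_indic// setIT.
rewrite -ge0_integralZl//; last by move=> w _; rewrite lee_fin sqr_ge0.
apply: ge0_le_integral => //.
- by apply/measurable_EFinP; exact: measurable_indic.
- exact: measurable_funeM.
- move=> w _; rewrite -EFinM lee_fin indicE.
  have [|_] := boolP (w \in _); last by rewrite mulr_ge0// sqr_ge0.
  rewrite in_setE/= => /ltW eD; rewrite mulrC ler_pdivlMr ?exprn_gt0// mul1r.
  by rewrite -[D w ^+ 2]real_normK ?num_real// lerXn2r// nnegrE ltW.
Qed.

Section pathwise_integrals.
Context d (T : measurableType d) (R : realType) (P : probability T R).
Variables (H : R) (B : R -> T -> R).
Hypotheses (H2 : 2^-1 < H) (H1 : H < 1) (fB : fractional_brownian_motion P H B).
Context (f : R -> R) (t : R).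
Hypothesis fr : forall t : R, f s @[s --> t^'+] --> f t.
Hypothesis fl : forall t : R, cvg (f s @[s --> t^'-]).
Hypothesis drift : f s @[s --> -oo] --> -oo.
Hypothesis summable : exists K : R, forall N, \sum_(j < N) past_sup f j <= K.
Hypothesis t0 : 0 <= t.

(** The difference is itself the integral of a step function, which is bounded and
    small in L1. *)
Lemma step_sum_path_L2 m u m' v : refining t m u -> refining t m' v ->
  (\int[P]_w ((step_sum B (path_steps f (m k) (u k)) w -
    step_sum B (path_steps f (m' k) (v k)) w) ^+ 2)%:E)%E @[k --> \oo] --> 0%E.
Proof.
move=> ru rv.
have [K0 K00 hK] := stepf_bounded t fr fl drift.
pose neg (l : seq (R * R * R)) := [seq (- p.1.1, p.1.2, p.2) | p <- l].
pose l k := path_steps f (m k) (u k) ++ neg (path_steps f (m' k) (v k)).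
have lfun k s : step_fun (l k) s =
    step_fun (path_steps f (m k) (u k)) s - step_fun (path_steps f (m' k) (v k)) s.
  rewrite /step_fun big_cat/= -sumrN [X in _ + X]big_map; congr (_ + _).
  by apply: eq_bigr => p _; rewrite mulNr.
have lsum k w : step_sum B (l k) w =
    step_sum B (path_steps f (m k) (u k)) w - step_sum B (path_steps f (m' k) (v k)) w.
  rewrite /step_sum big_cat/= -sumrN [X in _ + X]big_map; congr (_ + _).
  by apply: eq_bigr => p _; rewrite mulNr.
have lsorted k p : p \in l k -> p.1.2 <= p.2.
  rewrite mem_cat => /orP[|/mapP[q + ->]].
    exact: path_steps_sorted (@refining_lt _ _ _ _ ru k) _.
  exact: path_steps_sorted (@refining_lt _ _ _ _ rv k) _.
have lK k s : `|step_fun (l k) s| <= K0.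
  have /andP[a0 b0] := hK _ _ s (refining_last ru k) (@refining_lt _ _ _ _ ru k).
  have /andP[c0 d0] := hK _ _ s (refining_last rv k) (@refining_lt _ _ _ _ rv k).
  rewrite lfun ler_norml; apply/andP; split; lra.
have /fine_cvgP[fin cN] := stepf_L1 fr fl drift summable t0 ru rv.
set N := fine \o _ in cN.
have ub : \forall k \near \oo, (0 <= \int[P]_w ((step_sum B (path_steps f (m k) (u k)) w -
    step_sum B (path_steps f (m' k) (v k)) w) ^+ 2)%:E <= (3 * N k * (K0 + N k))%:E)%E.
  near=> k; apply/andP; split; first by apply: integral_ge0 => w _; rewrite lee_fin sqr_ge0.
  under eq_integral do rewrite -lsum.
  apply: (step_sum_moment2_le H2 H1 fB (@lsorted k) (lK k)).
  under eq_integral do rewrite lfun.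
  by rewrite /N /= fineK//; near: k.
apply: (squeeze_cvge ub); first exact: cvg_cst.
apply: cvg_EFin; first exact: nearW.
rewrite (_ : fine \o _ = fun k => 3 * N k * (K0 + N k))//.
have -> : 0 = 3 * 0 * (K0 + 0) :> R by rewrite mulr0 mul0r.
by apply: cvgM; [apply: cvgMr|apply: cvgD => //; exact: cvg_cst].
Unshelve. all: by end_near. Qed.

End pathwise_integrals.

Section riemann_sums.
Context (d1 d2 : measure_display) (T1 : measurableType d1) (T2 : measurableType d2)
  (R : realType) (P1 : probability T1 R) (P2 : probability T2 R).
Variables (H : R) (B : R -> T2 -> R) (x : R -> T1 -> R).
Hypotheses (H2 : 2^-1 < H) (H1 : H < 1) (fB : fractional_brownian_motion P2 H B).
Hypothesis px : drifting_path_process P1 x.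

Lemma riemann_sumE t m u w : riemann_sum x B t m u w =
  expR (- x t w.1) * step_sum B (path_steps (x ^~ w.1) m u) w.2.
Proof.
rewrite /riemann_sum /step_sum big_map mulr_sumr.
rewrite -(big_mkord xpredT (fun i => expR (- x t w.1 + x (u i) w.1) * (B (u i.+1) w.2 - B (u i) w.2))).
by rewrite /index_iota subn0; apply: eq_bigr => i _; rewrite expRD mulrA.
Qed.

Lemma measurable_riemann_sum t m u : measurable_fun setT (riemann_sum x B t m u).
Proof.
have m1 s : measurable_fun setT (fun w : T1 * T2 => x s w.1).
  by apply: (measurableT_comp (path_measurable px s)).
have m2 s : measurable_fun setT (fun w : T1 * T2 => B s w.2).
  by apply: (measurableT_comp (fbm_measurable fB s)).
apply: measurable_sum => i; apply: measurable_funM; last exact: measurable_funB.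
by apply: measurableT_comp => //; apply: measurable_funD => //; exact: measurableT_comp.
Qed.

(** Given the path of x, the difference is small in mean square; the conditional
    probabilities are then integrated by dominated convergence. *)
Lemma riemann_sums_close t m u m' v : 0 <= t -> refining t m u -> refining t m' v ->
  forall e : R, 0 < e -> (P1 \x P2)%E [set w | e < `|riemann_sum x B t (m k) (u k) w -
    riemann_sum x B t (m' k) (v k) w|] @[k --> \oo] --> 0%E.
Proof.
move=> t0 ru rv e e0.
pose A k := [set w | e < `|riemann_sum x B t (m k) (u k) w -
    riemann_sum x B t (m' k) (v k) w|].
have mA k : measurable (A k).
  rewrite -[X in measurable X]setTI; apply: measurable_fun_ltr => //.
  by apply: measurableT_comp => //; apply: measurable_funB; exact: measurable_riemann_sum.
pose h k w1 := P2 (xsection (A k) w1).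
have mh k : measurable_fun setT (h k) by exact: measurable_fun_xsection (mA k).
have h1 k w1 : (h k w1 <= 1)%E by apply: probability_le1; exact: measurable_xsection.
have h0 : {ae P1, forall w1, setT w1 -> h k w1 @[k --> \oo] --> 0%E}.
  apply: filterS (past_sup_summable px) => w1 sm _.
  have L2 := step_sum_path_L2 H2 H1 fB (@path_right _ _ _ _ _ px w1)
    (@path_left _ _ _ _ _ px w1) (@path_drift _ _ _ _ _ px w1) sm t0 ru rv.
  pose c := expR (- x t w1).
  pose D k w2 := step_sum B (path_steps (x ^~ w1) (m k) (u k)) w2 -
    step_sum B (path_steps (x ^~ w1) (m' k) (v k)) w2.
  have mD k : measurable_fun setT (D k) by apply: measurable_funB; exact: (measurable_step_sum fB).
  have ub : \forall k \near \oo, (0 <= h k w1 <= ((e / c) ^- 2)%:E * \int[P2]_w2 (D k w2 ^+ 2)%:E)%E.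
    apply: nearW => k; apply/andP; split; first exact: measure_ge0.
    apply: le_trans (chebyshev_sqr P2 _ (mD k)); last by rewrite divr_gt0// expR_gt0.
    rewrite /h (_ : xsection (A k) w1 = [set w | e / c < `|D k w|])//.
    apply/seteqP; split=> w2; rewrite /xsection/= ?in_setE /A /= !riemann_sumE/= -mulrBr normrM;
      by rewrite gtr0_norm ?expR_gt0// ltr_pdivrMr ?expR_gt0// mulrC.
  apply: (squeeze_cvge ub); first exact: cvg_cst.
  by rewrite -[X in _ --> X](mule0 ((e / c) ^- 2)%:E); apply: cvgeZl.
have dom : {ae P1, forall w1, forall k, setT w1 -> (`|h k w1| <= (EFin \o cst (1%R : R)) w1)%E}.
  by apply: nearW => w1 k _; rewrite gee0_abs// measure_ge0.
have [_ _] := dominated_convergence measurableT mh (measurable_cst 0%E) h0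
  (finite_measure_integrable_cst P1 (1%R : R) measurableT) dom.
by rewrite integral0.
Qed.

End riemann_sums.

(** * Limits in probability *)

Section convergence_in_probability.
Context d (T : measurableType d) (R : realType) (P : probability T R).

Lemma measurable_gap (f g : T -> R) (e : R) : measurable_fun setT f -> measurable_fun setT g ->
  measurable [set w | e < `|f w - g w|].
Proof.
move=> mf mg; rewrite -[X in measurable X]setTI; apply: measurable_fun_ltr => //.
by apply: measurableT_comp => //; exact: measurable_funB.
Qed.

Lemma cvg_bounded_variation (u b : nat -> R) (K : R) :
  (forall j, `|u j.+1 - u j| <= b j) -> (forall n, \sum_(j < n) b j <= K) -> cvgn u.
Proof.
move=> ub bK.
have b0 j : 0 <= b j by apply: le_trans (ub j).
have cb : cvgn (series b).
  apply: nondecreasing_is_cvgn; last first.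
    by exists K => _ [n _ <-]; rewrite /series/= big_mkord.
  apply: homo_leq => //[a c c'|n]; first exact: le_trans.
  by rewrite /series/= big_nat_recr//= lerDl.
have ct : cvgn (series (telescope u)).
  apply: normed_cvg; apply: series_le_cvg cb => //.
  by move=> n; exact: normr_ge0.
rewrite (_ : u = (fun n => series (telescope u) n + u 0%N)).
  by apply: is_cvgD => //; exact: is_cvg_cst.
by apply/funext => n; rewrite telescopeK /= subrK.
Qed.

(** By the Borel-Cantelli lemma a subsequence converges almost surely, and its
    limit is at a distance larger than e from a given term only if, from some
    rank on, the subsequence is. *)
Lemma cauchy_in_probability (X : nat -> T -> R) : (forall n, measurable_fun setT (X n)) ->
  (forall e : R, 0 < e -> exists N, forall k l, (N <= k)%N -> (N <= l)%N ->
    (P [set w | (e < `|X k w - X l w|)%R] <= e%:E)%E) ->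
  exists2 Y, measurable_fun setT Y & cvg_in_probability P \oo X Y.
Proof.
move=> mX cX.
pose b j : R := 2^-1 ^+ j.
have b_gt0 j : 0 < b j by rewrite exprn_gt0// invr_gt0.
have bsum n : \sum_(j < n) b j <= 2.
  suff -> : \sum_(j < n) b j = 2 - 2 * b n by rewrite gerBl mulr_ge0// ltW.
  elim: n => [|n IH]; first by rewrite big_ord0 /b expr0; lra.
  by rewrite big_ord_recr/= IH /b exprS; lra.
have [N hN] : exists N, forall j k l, (N j <= k)%N -> (N j <= l)%N ->
    (P [set w | (b j < `|X k w - X l w|)%R] <= (b j)%:E)%E.
  have /choice[N hN] j := cX (b j) (b_gt0 j).
  by exists N.
pose phi j := (\sum_(i < j.+1) (N i).+1)%N.
have phi_ge i j : (i <= j)%N -> (N i <= phi j)%N.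
  move=> ij; rewrite /phi (bigD1 (Ordinal (ij : i < j.+1)%N))//=.
  by rewrite (leq_trans (leqnSn _))// leq_addr.
have phi_id j : (j <= phi j)%N.
  apply: (@leq_trans (\sum_(i < j.+1) 1)%N); first by rewrite sum_nat_const card_ord muln1.
  exact: leq_sum.
pose F j := [set w | b j < `|X (phi j.+1) w - X (phi j) w|].
have mF j : measurable (F j) by exact: measurable_gap.
have F0 : P (lim_sup_set F) = 0%E.
  apply: lim_sup_set_cvg0 => //; apply: (@le_lt_trans _ _ 2%:E); last exact: ltry.
  apply: lime_le; first by apply: is_cvg_nneseries => j _ _; exact: measure_ge0.
  apply: nearW => n; apply: (@le_trans _ _ (\sum_(0 <= j < n) (b j)%:E)%E).
    by apply: lee_sum => j _; apply: hN; exact: phi_ge.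
  by rewrite sumEFin lee_fin big_mkord.
pose G := ~` lim_sup_set F.
have mL : measurable (lim_sup_set F).
  by apply: bigcap_measurable => // n _; apply: bigcup_measurable => j _; exact: mF.
have mG : measurable G by exact: measurableC.
have cG w : G w -> cvgn (fun j => X (phi j) w).
  move=> Gw; have [J hJ] : exists J, forall j, (J <= j)%N -> `|X (phi j.+1) w - X (phi j) w| <= b j.
    apply: contrapT => h; apply: Gw => J _; apply: contrapT => hJ; apply: h.
    by exists J => j Jj; rewrite leNgt; apply/negP => lt_; apply: hJ; exists j.
  have cv : cvgn (fun j => X (phi (maxn j J)) w).
    apply: (cvg_bounded_variation (b := b)) bsum => j; have [Jj|jJ] := leqP J j.
      by rewrite (maxn_idPl (leqW Jj)); exact: hJ.
    by rewrite (maxn_idPr jJ) subrr normr0 ltW.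
  apply/cvg_ex; exists (limn (fun j => X (phi (maxn j J)) w)); apply: cvg_trans cv.
  by apply: near_eq_cvg; exists J => // j /= Jj; rewrite (maxn_idPl Jj).
pose Y w := limn (fun j => X (phi j) w * \1_G w).
have cY w : X (phi j) w * \1_G w @[j --> \oo] --> Y w.
  suff : cvgn (fun j => X (phi j) w * \1_G w) by [].
  rewrite indicE; have [|_] := boolP (w \in G).
    by rewrite in_setE => /cG h; apply: is_cvgMl.
  by under eq_fun do rewrite mulr0; exact: is_cvg_cst.
have mY : measurable_fun setT Y.
  apply: (@measurable_fun_cvg _ _ _ _ (fun j w => X (phi j) w * \1_G w)) => [j|w _].
    by apply: measurable_funM => //; exact: measurable_indic.
  exact: cY.
exists Y => //.
have main e : 0 < e -> exists N, forall k, (N <= k)%N ->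
    (P [set w | (e < `|X k w - Y w|)%R] <= e%:E)%E.
  move=> e0; have [M hM] := cX e e0; exists M => k Mk.
  pose E j := [set w | e < `|X k w - X (phi j) w|].
  have mE j : measurable (E j) by exact: measurable_gap.
  (* Fatou's lemma for sets: P(liminf E) <= e. *)
  pose C n := \bigcap_(j in [set j | (n <= j)%N]) E j.
  have mC n : measurable (C n) by apply: bigcap_measurable => [|j _ //]; exists n => /=.
  have PC n : (P (C n) <= e%:E)%E.
    apply: (@le_trans _ _ (P (E (maxn n M)))).
      apply: le_measure; rewrite ?inE// => w; apply => /=; exact: leq_maxl.
    by apply: hM => //; apply: leq_trans (phi_id _); exact: leq_maxr.
  have PUC : (P (\bigcup_n C n) <= e%:E)%E.
    have ndC : {homo C : m n / (m <= n)%N >-> (m <= n)%O}.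
      by move=> m n mn; apply/subsetPset => w h j /= nj; apply: h => /=; exact: leq_trans mn nj.
    have cv := @nondecreasing_cvg_mu _ _ _ P C mC (bigcup_measurable (fun n _ => mC n)) ndC.
    rewrite -(cvg_lim _ cv)//; apply: lime_le; first by apply/cvg_ex; eexists; exact: cv.
    exact: nearW.
  apply: (@le_trans _ _ (P ((\bigcup_n C n) `|` lim_sup_set F))).
    apply: le_measure; rewrite ?inE.
    - exact: measurable_gap.
    - by apply: measurableU => //; exact: bigcup_measurable.
    move=> w /= ew; have [Gw|] := pselect (G w); last by move=> /contrapT; right.
    left; have := cY w; rewrite indicE mem_set// => cYw.
    have cXw : `|X k w - X (phi j) w| @[j --> \oo] --> `|X k w - Y w|.
      apply: cvg_norm; apply: cvgB; first exact: cvg_cst.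
      by under eq_fun do rewrite -[X (phi _) w]mulr1.
    have [n _ hn] := cvgr_gt _ cXw _ ew.
    by exists n => // j /= nj; exact: hn.
  have h := measureU2 P (bigcup_measurable (fun n _ => mC n)) mL.
  have h' : (P (\bigcup_n C n) + P (lim_sup_set F) <= e%:E)%E by rewrite F0 adde0.
  exact: le_trans (h _) h'.
move=> e e0; apply/fine_cvgP; split.
  by apply: nearW => n; apply: fin_num_measure; exact: measurable_gap.
apply/cvgrPdist_le => dl d0.
have md : 0 < Num.min e dl by rewrite lt_min e0.
have [M hM] := main _ md.
near=> n; rewrite sub0r normrN ger0_norm ?fine_ge0// -lee_fin fineK ?fin_num_measure//; last first.
  exact: measurable_gap.
apply: (@le_trans _ _ (P [set w | (Num.min e dl < `|X n w - Y w|)%R])).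
  apply: le_measure; rewrite ?inE; try exact: measurable_gap.
  by move=> w /=; apply: le_lt_trans; rewrite ge_min lexx.
apply: le_trans (hM n _) _; last by rewrite lee_fin ge_min lexx orbT.
by near: n; exists M.
Unshelve. all: by end_near. Qed.

End convergence_in_probability.

(** * Existence of the integral *)

Lemma admissible_refining (R : realType) (t : R) u :
  admissible_partitions t u -> refining t succn (fun k => u k.+1).
Proof.
move=> au; split.
- by move=> k; exact: (partition_last au).
- by move=> k i; exact: (partition_increasing au).
- move=> e e0; have /cvgrPdist_lt/(_ e e0)[n _ hn] := partition_mesh_cvg0 au.
  exists n => // k /= nk i ik; have := hn k.+1 (leqW nk).
  rewrite sub0r normrN => /(le_lt_trans (ler_norm _)); apply: le_lt_trans.
  exact: (@le_bigmax_cond _ _ _ _ (Ordinal ik) xpredT (fun j : 'I_k.+1 => u k.+1 j.+1 - u k.+1 j)).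
- move=> A; have /cvgryPgt/(_ (- A))[n _ hn] := partition_start_cvgy au.
  by exists n => // k /= nk; have := hn k.+1 (leqW nk); rewrite ltrN2.
Qed.

(** The n intervals of length 1 / sqrt n cover a length sqrt n. The dependence on t
    is a translation, which is what stationarity needs. *)
Definition uniform_partition (R : realType) (t : R) (n i : nat) : R :=
  t - (n%:R - i%:R) / Num.sqrt n%:R.

Lemma uniform_partition_admissible (R : realType) (t : R) :
  admissible_partitions t (uniform_partition t).
Proof.
have step n i : uniform_partition t n i.+1 - uniform_partition t n i = (Num.sqrt n%:R)^-1.
  by rewrite /uniform_partition -[i.+1]addn1 natrD; ring.
have s0 n : (0 < n)%N -> 0 < Num.sqrt (n%:R : R) by rewrite sqrtr_gt0 ltr0n.
have meshE n : (0 < n)%N -> mesh n (uniform_partition t n) = (Num.sqrt n%:R)^-1.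
  case: n => // n _; apply/le_anti/andP; split.
    by apply: bigmax_le => [|i _]; rewrite ?step// invr_ge0 sqrtr_ge0.
  rewrite -(step n.+1 0%N).
  exact: (@le_bigmax_cond _ _ _ _ ord0 xpredT (fun j : 'I_n.+1 =>
    uniform_partition t n.+1 j.+1 - uniform_partition t n.+1 j)).
have start n : - uniform_partition t n 0 = Num.sqrt n%:R - t.
  rewrite /uniform_partition subr0 opprB; congr (_ - _).
  have [->|n0] := eqVneq n 0%N; first by rewrite mul0r sqrtr0.
  by rewrite -{1}[n%:R]sqr_sqrtr// expr2 mulfK// gt_eqF// s0// lt0n.
have cvgs : Num.sqrt (n%:R : R) @[n --> \oo] --> +oo.
  apply/cvgryPge => A; near=> n.
  rewrite (le_trans (ler_norm _))// -sqrtr_sqr ler_sqrt//.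
  by near: n; exact: nbhs_infty_ger.
split.
- by move=> n n0; rewrite /uniform_partition subrr mul0r subr0.
- by move=> n i ni; rewrite -subr_gt0 step invr_gt0 s0// (leq_ltn_trans _ ni).
- move=> m n /andP[m0 mn]; rewrite !meshE ?(leq_trans m0)//.
  by rewrite lef_pV2 ?posrE ?s0 ?(leq_trans m0)// ler_sqrt// ler_nat.
- apply/cvgrPdist_lt => e e0; near=> n.
  have n0 : (0 < n)%N by near: n; exact: nbhs_infty_gt.
  rewrite sub0r normrN meshE// ger0_norm ?invr_ge0 ?sqrtr_ge0//.
  rewrite invf_plt ?posrE ?s0//; near: n; exact: (cvgryPgt _).1 cvgs _.
- by move=> m n /andP[m0 mn]; rewrite !start lerD2r ler_sqrt// ler_nat.
- apply/cvgryPge => A; near=> n; rewrite start lerBrDr.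
  by near: n; exact: (cvgryPge _).1 cvgs _.
Unshelve. all: by end_near. Qed.

(** The completed product probability is by construction the restriction of an
    outer measure; monotonicity and subadditivity hold therefore for all sets. *)
Section completion.
Context (d1 d2 : measure_display) (T1 : measurableType d1) (T2 : measurableType d2)
  (R : realType) (P1 : probability T1 R) (P2 : probability T2 R).
Local Notation PP := (complete_product_prob P1 P2).
Local Notation TT := (complete_product P1 P2).

Lemma complete_prod_prob_le (A B : set (T1 * T2)) : A `<=` B -> (PP A <= PP B)%E.
Proof. exact: (@le_outer_measure _ _ (mu_ext (P1 \x P2)%E)). Qed.

Lemma complete_prod_probU (A B : set (T1 * T2)) : (PP (A `|` B) <= PP A + PP B)%E.
Proof. exact: (@outer_measureU2 _ _ (mu_ext (P1 \x P2)%E)). Qed.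

Lemma complete_prod_probE (A : set (T1 * T2)) : measurable A -> PP A = (P1 \x P2)%E A.
Proof. by move=> mA; exact: (measurable_mu_extE (P1 \x P2)%E). Qed.

Lemma complete_prod_prob_ge0 (A : set (T1 * T2)) : (0 <= PP A)%E.
Proof. exact: outer_measure_ge0. Qed.

Lemma complete_prod_measurable (A : set (T1 * T2)) :
  measurable A -> measurable (A : set TT).
Proof. by move=> mA; apply: sub_caratheodory; exact: sub_sigma_algebra. Qed.

Lemma complete_prod_measurable_fun d (U : measurableType d) (f : T1 * T2 -> U) :
  measurable_fun setT f -> measurable_fun setT (f : TT -> U).
Proof.
move=> mf _ A mA; rewrite setTI; apply: complete_prod_measurable.
by rewrite -[X in measurable X]setTI; exact: mf.
Qed.

Lemma complete_prod_null (Q : set T1) : P1.-negligible Q -> PP (fst @^-1` Q) = 0%E.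
Proof.
move=> [N [mN PN QN]]; apply/le_anti; rewrite complete_prod_prob_ge0 andbT.
apply: le_trans (complete_prod_prob_le (B := N `*` setT) _) _.
  by move=> w /= /QN.
rewrite complete_prod_probE; last exact: measurableX.
have := product_measure1E P1 P2 mN (@measurableT _ T2).
by rewrite [X in (X * _)%E](_ : _ = 0%E)// mul0e => ->.
Qed.

(** A modification of the paths of the first component on a null set need not give
    measurable functions, but the outer measure does not see it. *)
Lemma cvg_in_probability_modif (X X' : nat -> T1 * T2 -> R) (Y : TT -> R) (Q : set T1) :
  P1.-negligible Q -> (forall n w, ~ Q w.1 -> X n w = X' n w) ->
  cvg_in_probability PP \oo X Y -> cvg_in_probability PP \oo X' Y.
Proof.
move=> Q0 XX cX e e0; apply: (squeeze_cvge (f := cst 0%E) _ _ (cX e e0)); last exact: cvg_cst.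
apply: nearW => n; rewrite complete_prod_prob_ge0/=.
apply: (@le_trans _ _ (PP ([set w | e < `|X n w - Y w|] `|` fst @^-1` Q))).
  apply: complete_prod_prob_le => w /= h; have [|nQ] := pselect (Q w.1); first by right.
  by left; rewrite XX.
by apply: le_trans (complete_prod_probU _ _) _; rewrite complete_prod_null// adde0.
Qed.

Lemma cvg_in_probability_complete (X : nat -> T1 * T2 -> R) (Y : T1 * T2 -> R) :
  (forall n, measurable_fun setT (X n)) -> measurable_fun setT Y ->
  cvg_in_probability (P1 \x P2)%E \oo X Y -> cvg_in_probability PP \oo X Y.
Proof.
move=> mX mY cX e e0; apply: cvg_trans (cX e e0); apply: near_eq_cvg; apply: nearW => n.
by apply/esym/complete_prod_probE; exact: measurable_gap.
Qed.

End completion.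

Lemma cvg_in_probability_close d (T : measurableType d) (R : realType) (P : probability T R)
    (X X' : nat -> T -> R) (Y : T -> R) :
  (forall n, measurable_fun setT (X n)) -> (forall n, measurable_fun setT (X' n)) ->
  measurable_fun setT Y ->
  cvg_in_probability P \oo X Y ->
  (forall e : R, 0 < e -> P [set w | e < `|X' n w - X n w|] @[n --> \oo] --> 0%E) ->
  cvg_in_probability P \oo X' Y.
Proof.
move=> mX mX' mY cX cXX' e e0.
have e2 : 0 < e / 2 by rewrite divr_gt0.
pose a n := P [set w | e / 2 < `|X' n w - X n w|].
pose b n := P [set w | e / 2 < `|X n w - Y w|].
have cab : (a n + b n)%E @[n --> \oo] --> 0%E.
  by rewrite -[X in _ --> X](adde0 0%E); apply: cvgeD => //; [exact: cXX'|exact: cX].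
apply: (squeeze_cvge (f := cst 0%E) _ _ cab); last exact: cvg_cst.
apply: nearW => n; rewrite measure_ge0/=.
have m1 : measurable [set w | e / 2 < `|X' n w - X n w|] by exact: measurable_gap.
have m2 : measurable [set w | e / 2 < `|X n w - Y w|] by exact: measurable_gap.
apply: le_trans _ (measureU2 P m1 m2).
apply: le_measure; rewrite ?inE; [exact: measurable_gap|exact: measurableU|].
move=> w /= h; have := ler_distD (X n w) (X' n w) (Y w).
have [|h1] := ltP (e / 2) `|X' n w - X n w|; first by left.
by move=> h2; right; lra.
Qed.

Section existence.
Context (d1 d2 : measure_display) (T1 : measurableType d1) (T2 : measurableType d2)
  (R : realType) (P1 : probability T1 R) (P2 : probability T2 R).
Variables (H : R) (B : R -> T2 -> R) (x : R -> T1 -> R).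
Hypotheses (H2 : 2^-1 < H) (H1 : H < 1) (fB : fractional_brownian_motion P2 H B).
Hypothesis px : drifting_path_process P1 x.
Let P : probability (T1 * T2)%type R := (P1 \x P2)%E.

(** If the Cauchy property failed along one sequence of partitions, two of its
    subsequences would contradict riemann_sums_close. *)
Lemma riemann_sum_limit (t : R) : 0 <= t ->
  exists2 Y : T1 * T2 -> R, measurable_fun setT Y &
    forall m v, refining t m v ->
    cvg_in_probability (P1 \x P2)%E \oo (fun k => riemann_sum x B t (m k) (v k)) Y.
Proof.
move=> t0; have ru := admissible_refining (uniform_partition_admissible t).
pose X k := riemann_sum x B t k.+1 (uniform_partition t k.+1).
have mX k : measurable_fun setT (X k) by exact: (measurable_riemann_sum fB px).
have [||Y mY cY] := @cauchy_in_probability _ _ _ P X.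
- exact: mX.
- move=> e e0; apply: contrapT => h.
  have /choice[phi hphi] : forall N, exists kl : nat * nat, [/\ (N <= kl.1)%N, (N <= kl.2)%N &
      ~ (P [set w | (e < `|X kl.1 w - X kl.2 w|)%R] <= e%:E)%E].
    move=> N; apply: contrapT => hN; apply: h; exists N => k l Nk Nl.
    by apply: contrapT => hkl; apply: hN; exists (k, l).
  have r1 := refining_sub (phi := fun N => (phi N).1) ru (fun N => let: And3 a _ _ := hphi N in a).
  have r2 := refining_sub (phi := fun N => (phi N).2) ru (fun N => let: And3 _ a _ := hphi N in a).
  have c := riemann_sums_close H2 H1 fB px t0 r1 r2 e0.
  have /fine_cvgP[_ /cvgrPdist_lt/(_ e e0)[N _ /(_ N (leqnn N))/=]] := c.
  rewrite sub0r normrN => /(le_lt_trans (ler_norm _))/ltW lt_e.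
  have [_ _] := hphi N; apply; rewrite -[leLHS]fineK ?lee_fin//.
  by apply: fin_num_measure; exact: measurable_gap.
exists Y => // m v rv; apply: (@cvg_in_probability_close _ _ _ P X) => //.
- by move=> n; exact: (measurable_riemann_sum fB px).
- by move=> e e0; exact: (riemann_sums_close H2 H1 fB px t0 rv ru e0).
Qed.

Lemma exists_Ybar (xi : R -> T1 -> R) (t : R) :
  {ae P1, forall w, forall t, xi t w = x t w} -> 0 <= t ->
  exists Y : complete_product P1 P2 -> R, is_Ybar xi B t Y.
Proof.
move=> xix t0; have [Y mY cY] := riemann_sum_limit t0.
exists Y; split; first exact: complete_prod_measurable_fun.
move=> u /admissible_refining ru.
apply: (cvg_in_probability_modif (X := fun n => riemann_sum x B t n (u n))) xix _ _.
  move=> n w /contrapT xw; apply: eq_bigr => i _; by rewrite !xw.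
move=> e e0; rewrite -cvg_shiftS.
have := cvg_in_probability_complete _ mY (cY _ _ ru) e0.
by apply => n; exact: (measurable_riemann_sum fB px).
Qed.

End existence.

(** * Stationarity *)

Section same_law.
Context d (T : measurableType d) (R : realType) (P : probability T R).

Lemma same_law_ge0_integral d' (T' : measurableType d') (f g : T -> T') (phi : T' -> \bar R) :
  measurable_fun setT f -> measurable_fun setT g -> measurable_fun setT phi ->
  (forall y, (0 <= phi y)%E) ->
  (forall A, measurable A -> P (f @^-1` A) = P (g @^-1` A)) ->
  (\int[P]_w phi (f w) = \int[P]_w phi (g w))%E.
Proof.
move=> mf mg mphi phi0 fg.
have E h (mh : measurable_fun setT h) : (\int[P]_w (phi (h w)) =
    \int[image_measure P mh]_y (phi y))%E.
  by rewrite (ge0_integral_pushforward mh).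
by rewrite (E _ mf) (E _ mg); apply: eq_measure_integral => A mA _; exact: fg.
Qed.

End same_law.

Section shift_invariance.
Context (d1 d2 : measure_display) (T1 : measurableType d1) (T2 : measurableType d2)
  (R : realType) (P1 : probability T1 R) (P2 : probability T2 R).
Variables (H : R) (B : R -> T2 -> R) (x : R -> T1 -> R).
Hypothesis fB : fractional_brownian_motion P2 H B.
Hypothesis px : drifting_path_process P1 x.

Lemma path_difference_law (K : nat) (s t : 'I_K -> R) (h : R) (A : set (K.-tuple R)) :
  measurable A ->
  P1 ((fun w => [tuple x (s k + h) w - x (t k + h) w | k < K]) @^-1` A) =
  P1 ((fun w => [tuple x (s k) w - x (t k) w | k < K]) @^-1` A).
Proof.
move=> mA.
pose r (i : 'I_(K + K)) := match fintype.split i with inl k => s k | inr k => t k end.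
pose g (y : (K + K).-tuple R) := [tuple tnth y (lshift K k) - tnth y (rshift K k) | k < K].
have mg : measurable_fun setT g.
  apply/measurable_fun_tnthP => k.
  rewrite (_ : _ \o _ = (fun y => tnth y (lshift K k)) \- (fun y => tnth y (rshift K k))).
    by apply: measurable_funB; exact: measurable_tnth.
  by apply/funext => y /=; rewrite tnth_mktuple.
pose Z h' w := [tuple x (r i + h') w - x h' w | i < K + K].
have E h' : (fun w => [tuple x (s k + h') w - x (t k + h') w | k < K]) = g \o Z h'.
  apply/funext => w /=; apply/eq_from_tnth => k; rewrite !tnth_mktuple.
  have -> : r (lshift K k) = s k by rewrite /r (unsplitK (inl k : 'I_K + 'I_K)).
  have -> : r (rshift K k) = t k by rewrite /r (unsplitK (inr k : 'I_K + 'I_K)).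
  by rewrite opprB addrA subrK.
have mgA : measurable (g @^-1` A) by rewrite -[X in measurable X]setTI; exact: mg.
have E0 : (fun w => [tuple x (s k) w - x (t k) w | k < K]) = g \o Z 0.
  by rewrite -E; apply/funext => w; apply: eq_mktuple => k; rewrite !addr0.
have Z0 : (fun w => [tuple x (r i) w - x 0 w | i < K + K]) = Z 0.
  by apply/funext => w; apply: eq_mktuple => k; rewrite !addr0.
have := path_increments px r h mgA; rewrite Z0 -/(Z h) => Zh.
by rewrite E E0 !comp_preimage.
Qed.

(** Shifting all times by h changes neither the joint law of the differences of
    x nor, once these are held fixed, the law of the combination of increments
    of B. The cosine is shifted by 1 in order to integrate nonnegative functions
    throughout. *)
Lemma functional_shift (K : nat) (th s t a b : 'I_K -> R) (c h : R) :
  (\int[P1 \x P2]_w (1 + cos (\sum_k th k * expR (x (s k + h) w.1 - x (t k + h) w.1) *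
      (B (b k + h) w.2 - B (a k + h) w.2) + c))%:E =
   \int[P1 \x P2]_w (1 + cos (\sum_k th k * expR (x (s k) w.1 - x (t k) w.1) *
      (B (b k) w.2 - B (a k) w.2) + c))%:E)%E.
Proof.
have cos1 (z : R) : (0 <= (1 + cos z)%:E)%E.
  by rewrite lee_fin; have := cos_max z; rewrite ler_norml => /andP[? ?]; lra.
have mcos d (T : measurableType d) (f : T -> R) : measurable_fun setT f ->
    measurable_fun setT (fun w => (1 + cos (f w + c))%:E).
  move=> mf; apply/measurable_EFinP; apply: measurable_funD => //.
  apply: measurableT_comp; first exact: continuous_measurable_fun (@continuous_cos R).
  exact: measurable_funD.
pose Phi h' (p : K.-tuple R * T2) : \bar R := (1 + cos (\sum_k th k * expR (tnth p.1 k) *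
      (B (b k + h') p.2 - B (a k + h') p.2) + c))%:E.
have mPhi h' : measurable_fun setT (Phi h').
  apply: mcos; apply: measurable_sum => k; apply: measurable_funM.
    apply: measurable_funM => //; apply: measurableT_comp => //.
    exact: (measurableT_comp (measurable_tnth k)).
  by apply: measurable_funB; exact: (measurableT_comp (fbm_measurable fB _)).
pose D h' w := [tuple x (s k + h') w - x (t k + h') w | k < K].
have mD h' : measurable_fun setT (D h').
  apply/measurable_fun_tnthP => k; rewrite (_ : _ \o _ = x (s k + h') \- x (t k + h')).
    by apply: measurable_funB; exact: path_measurable px _.
  by apply/funext => w /=; rewrite tnth_mktuple.
pose F h' (w : T1 * T2) : \bar R := (1 + cos (\sum_k th k * expR (x (s k + h') w.1 - x (t k + h') w.1) *
      (B (b k + h') w.2 - B (a k + h') w.2) + c))%:E.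
have mF h' : measurable_fun setT (F h').
  apply: mcos; apply: measurable_sum => k; apply: measurable_funM.
    apply: measurable_funM => //; apply: measurableT_comp => //.
    by apply: measurable_funB; exact: (measurableT_comp (path_measurable px _)).
  by apply: measurable_funB; exact: (measurableT_comp (fbm_measurable fB _)).
have fub h' : (\int[P1 \x P2]_w F h' w = \int[P1]_w fubini_F P2 (Phi h') (D h' w))%E.
  have F0 w : (0 <= F h' w)%E by exact: cos1.
  apply: etrans (@fubini_tonelli1 _ _ _ _ _ P1 P2 (F h') (mF h') F0) _.
  apply: eq_integral => w1 _; apply: eq_integral => w2 _ /=.
  by rewrite /F /Phi/=; congr (1 + cos (_ + c))%:E; apply: eq_bigr => k _; rewrite tnth_mktuple.
have E0 : (\int[P1 \x P2]_w (1 + cos (\sum_k th k * expR (x (s k) w.1 - x (t k) w.1) *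
      (B (b k) w.2 - B (a k) w.2) + c))%:E = \int[P1 \x P2]_w F 0%R w)%E.
  apply: eq_integral => w _; congr (1 + cos (_ + c))%:E.
  by apply: eq_bigr => k _; rewrite !addr0.
apply: etrans (fub h) _; apply: etrans (esym (etrans E0 (fub 0))).
transitivity (\int[P1]_w fubini_F P2 (Phi 0%R) (D h w))%E.
  apply: eq_integral => w1 _; rewrite /fubini_F.
  pose l := [seq (th k * expR (tnth (D h w1) k), a k, b k) | k <- index_enum 'I_K].
  have El h' w2 : Phi h' (D h w1, w2) = (1 + cos (step_sum B (step_shift h' l) w2 + c))%:E.
    by rewrite /Phi /step_sum /step_shift -map_comp big_map.
  transitivity (\int[P2]_w2 (1 + cos (step_sum B (step_shift h l) w2 + c))%:E)%E.
    by apply: eq_integral => w2 _.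
  transitivity (\int[P2]_w2 (1 + cos (step_sum B (step_shift 0%R l) w2 + c))%:E)%E; last first.
    by apply: eq_integral => w2 _.
  apply: (@same_law_ge0_integral _ _ _ P2 _ R (step_sum B (step_shift h l))
    (step_sum B (step_shift 0 l)) (fun z : R => (1 + cos (z + c))%:E)) => //.
  - exact: (measurable_step_sum fB).
  - exact: (measurable_step_sum fB).
  - exact: mcos.
  - move=> A mA; rewrite (step_sum_shift_law fB)//.
    by rewrite (step_sum_shift_law fB 0).
apply: same_law_ge0_integral => //.
- have Phi0 p : (0 <= Phi 0%R p)%E by exact: cos1.
  exact: (@measurable_fun_fubini_tonelli_F _ _ _ _ _ P2 (Phi 0%R) (mPhi 0%R) Phi0).
- by move=> y; apply: integral_ge0 => w2 _; exact: cos1.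
- move=> A mA; rewrite /D path_difference_law//.
  by congr (P1 (_ @^-1` A)); apply/funext => w; apply: eq_mktuple => k; rewrite !addr0.
Qed.

End shift_invariance.

Section cosine_means.
Context d (T : measurableType d) (R : realType) (mu : {measure set T -> \bar R}).
Hypothesis mu1 : mu setT = 1%E.

Lemma measurable_cos_combination (m : nat) (th : 'I_m -> R) (Y : 'I_m -> T -> R) (b : R) :
  (forall i, measurable_fun setT (Y i)) ->
  measurable_fun setT (fun w => cos (\sum_i th i * Y i w + b)).
Proof.
move=> mY; apply: measurableT_comp; first exact: continuous_measurable_fun (@continuous_cos R).
by apply: measurable_funD => //; apply: measurable_sum => i; exact: measurable_funM.
Qed.

Lemma integrable_cos_combination (m : nat) (th : 'I_m -> R) (Y : 'I_m -> T -> R) (b : R) :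
  (forall i, measurable_fun setT (Y i)) ->
  mu.-integrable setT (EFin \o (fun w => cos (\sum_i th i * Y i w + b))).
Proof.
move=> mY; apply: (@bounded_integrable _ _ _ _ _ _ 1).
- by rewrite mu1 ltry.
- exact: measurable_cos_combination.
- by move=> w; exact: cos_max.
Qed.

(** Off the event that some X i n is at a distance larger than e' from Y i the
    cosines differ by at most C e', and on this event by at most 2. *)
Lemma cvg_mean_cos (m : nat) (th : 'I_m -> R) (X : 'I_m -> nat -> T -> R) (Y : 'I_m -> T -> R) (b : R) :
  (forall i n, measurable_fun setT (X i n)) -> (forall i, measurable_fun setT (Y i)) ->
  (forall i, cvg_in_probability mu \oo (X i) (Y i)) ->
  (\int[mu]_w cos (\sum_i th i * X i n w + b))%R @[n --> \oo] -->
  (\int[mu]_w cos (\sum_i th i * Y i w + b))%R.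
Proof.
move=> mX mY cX.
pose C := \sum_i `|th i|.
have C0 : 0 <= C by apply: sumr_ge0 => i _.
apply/cvgrPdist_le => e e0.
pose e' := e / (2 * (C + 1)).
have e'0 : 0 < e' by rewrite divr_gt0// mulr_gt0// ltr_wpDl.
pose E i n := [set w | e' < `|X i n w - Y i w|].
have mE i n : measurable (E i n) by exact: measurable_gap.
have cq : (\sum_(i < m) 2%:E * mu (E i n))%E @[n --> \oo] --> 0%E.
  elim: (index_enum _) => [|i r IH].
    by under eq_fun do rewrite big_nil; exact: cvg_cst.
  rewrite -[X in _ --> X](adde0 0%E); under eq_fun do rewrite big_cons.
  apply: cvgeD => //; rewrite -[X in _ --> X](mule0 2%:E).
  by apply: cvgeZl => //; exact: cX.
pose dist n w := `|cos (\sum_i th i * Y i w + b) - cos (\sum_i th i * X i n w + b)|.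
have dist2 n w : dist n w <= 2.
  rewrite /dist (le_trans (ler_normB _ _))//.
  have := cos_max (\sum_i th i * Y i w + b); have := cos_max (\sum_i th i * X i n w + b); lra.
have distE n w : ((dist n w)%:E <= (C * e')%:E + \sum_(i < m) 2%:E * (\1_(E i n) w)%:E)%E.
  under eq_bigr do rewrite -EFinM; rewrite sumEFin -EFinD lee_fin.
  have [[i Ei]|noE] := pselect (exists i, E i n w).
    apply: (@le_trans _ _ 2) (dist2 n w) _.
    rewrite (bigD1 i)//= indicE mem_set// mulr1.
    have := mulr_ge0 C0 (ltW e'0).
    have : 0 <= \sum_(j < m | j != i) 2 * \1_(E j n) w :> R by apply: sumr_ge0 => j _; rewrite mulr_ge0.
    lra.
  apply: (@le_trans _ _ (C * e')); last by rewrite lerDl sumr_ge0// => i _; rewrite mulr_ge0.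
  rewrite (le_trans (cos_lip _ _))// opprD addrACA subrr addr0 -sumrB mulr_suml.
  rewrite (le_trans (ler_norm_sum _ _ _))// ler_sum// => i _.
  rewrite -mulrBr normrM ler_wpM2l// distrC leNgt; apply/negP => lt_; apply: noE; by exists i.
have mdist n : measurable_fun setT (dist n).
  by apply: measurableT_comp => //; apply: measurable_funB; exact: measurable_cos_combination.
have int_dist n : (\int[mu]_w (dist n w)%:E <= (C * e')%:E + \sum_(i < m) 2%:E * mu (E i n))%E.
  have m1 i : measurable_fun setT (fun w => 2%:E * (\1_(E i n) w)%:E)%E.
    by apply: measurable_funeM; apply/measurable_EFinP; exact: measurable_indic.
  have p1 i w : (0 <= 2%:E * (\1_(E i n) w)%:E)%E by rewrite mule_ge0// lee_fin.
  apply: (@le_trans _ _ (\int[mu]_w ((C * e')%:E + \sum_(i < m) 2%:E * (\1_(E i n) w)%:E))%E).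
    apply: ge0_le_integral => //.
    - by move=> w _; rewrite lee_fin normr_ge0.
    - exact/measurable_EFinP.
    - by apply: emeasurable_funD => //; apply: emeasurable_sum.
  rewrite ge0_integralD//; last 3 first.
  - by move=> w _; rewrite lee_fin mulr_ge0// ltW.
  - by move=> w _; apply: sume_ge0 => i _; exact: p1.
  - exact: emeasurable_sum.
  rewrite integral_cst// mu1 mule1 leeD2l// ge0_integral_sum//.
  apply: lee_sum => i _; rewrite ge0_integralZl//; last first.
    by apply/measurable_EFinP; exact: measurable_indic.
  by rewrite integral_indic// setIT.
have /fine_cvgP[fq /cvgrPdist_lt/(_ (e / 2))] := cq; rewrite divr_gt0// => /(_ isT) hq.
near=> n.
have iY := @integrable_cos_combination m th Y b mY.
have iX := @integrable_cos_combination m th (fun i => X i n) b (fun i => mX i n).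
rewrite -RintegralB//; apply: le_trans (le_normr_Rintegral _ _) _ => //.
  exact: eq_integrable (integrableB measurableT iY iX).
have fin : (\sum_(i < m) 2%:E * mu (E i n))%E \is a fin_num by near: n.
have qlt : fine (\sum_(i < m) 2%:E * mu (E i n))%E < e / 2.
  apply: le_lt_trans (ler_norm _) _; rewrite -normrN -sub0r; near: n; exact: hq.
have := int_dist n; rewrite -[X in (_ + X)%E](fineK fin) -EFinD => hd.
have Ce : C * e' <= e / 2.
  rewrite /e' invfM mulrCA !mulrA ler_pdivrMr ?ltr_wpDl//; nra.
apply: (@le_trans _ _ (C * e' + fine (\sum_(i < m) 2%:E * mu (E i n))%E)); last lra.
rewrite -lee_fin; apply: le_trans hd.
rewrite fineK//; apply: integrable_fin_num => //.
apply: (@bounded_integrable _ _ _ _ _ _ 2).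
- by rewrite mu1 ltry.
- exact: mdist.
- by move=> w; rewrite normr_id; exact: dist2.
Unshelve. all: by end_near. Qed.

End cosine_means.

Section stationarity.
Context (d1 d2 : measure_display) (T1 : measurableType d1) (T2 : measurableType d2)
  (R : realType) (P1 : probability T1 R) (P2 : probability T2 R).
Variables (H : R) (B : R -> T2 -> R) (x : R -> T1 -> R).
Hypothesis fB : fractional_brownian_motion P2 H B.
Hypothesis px : drifting_path_process P1 x.
Local Notation PP := (complete_product_prob P1 P2).
Local Notation TT := (complete_product P1 P2).

Lemma complete_prod_prob_setT : PP setT = 1%E.
Proof.
rewrite (complete_prod_probE P1 P2 (@measurableT _ (T1 * T2)%type)).
exact: (@probability_setT _ _ _ (P1 \x P2)%E).
Qed.

Lemma complete_prod_ge0_integral (f : T1 * T2 -> \bar R) : measurable_fun setT f ->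
  (forall w, (0 <= f w)%E) -> (\int[PP]_w f w = \int[P1 \x P2]_w f w)%E.
Proof.
move=> mf f0.
have mid : measurable_fun setT (id : TT -> T1 * T2).
  by apply: complete_prod_measurable_fun.
transitivity (\int[image_measure PP mid]_w f w)%E.
  by rewrite (ge0_integral_pushforward mid).
by apply: eq_measure_integral => A mA _; exact: (complete_prod_probE P1 P2 mA).
Qed.

Let X n t := riemann_sum x B t n (uniform_partition t n).

Let mX n t : measurable_fun setT (X n t).
Proof. exact: (measurable_riemann_sum fB px). Qed.

Let mXc n t : measurable_fun setT (X n t : TT -> R).
Proof. exact: complete_prod_measurable_fun. Qed.

(** The partition for t + h is the translate by h of the partition for t, so that
    the shift of all the arguments t i amounts to a shift of all times. *)
Lemma riemann_sum_combination (m n : nat) (th t : 'I_m -> R) (h : R) w :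
  \sum_i th i * X n (t i + h) w =
  \sum_(k < #|{: 'I_m * 'I_n}|) let p := enum_val k in let u := uniform_partition (t p.1) n in
    th p.1 * expR (x (u p.2 + h) w.1 - x (t p.1 + h) w.1) *
    (B (u p.2.+1 + h) w.2 - B (u p.2 + h) w.2).
Proof.
pose F (p : 'I_m * 'I_n) := let u := uniform_partition (t p.1) n in
  th p.1 * expR (x (u p.2 + h) w.1 - x (t p.1 + h) w.1) *
    (B (u p.2.+1 + h) w.2 - B (u p.2 + h) w.2).
transitivity (\sum_p F p); last first.
  by rewrite (reindex _ (onW_bij _ (enum_val_bij _))).
rewrite -(pair_bigA _ (fun i j => F (i, j)))/=; apply: eq_bigr => i _.
rewrite /X /riemann_sum mulr_sumr; apply: eq_bigr => j _.
have uh k : uniform_partition (t i + h) n k = uniform_partition (t i) n k + h.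
  by rewrite /uniform_partition addrAC.
by rewrite /F /= !uh [- x _ _ + _]addrC mulrA.
Qed.

Let one_cos_integral (m : nat) (th t : 'I_m -> R) (b : R) n :
  (\int[PP]_w (1 + cos (\sum_i th i * X n (t i) w + b))%:E =
    (1 + \int[PP]_w cos (\sum_i th i * X n (t i) w + b))%R%:E)%E.
Proof.
have ic := integrable_cos_combination complete_prod_prob_setT th b (fun i => @mXc n (t i)).
have i1 : PP.-integrable setT (EFin \o (fun=> 1%R : R)).
  apply: (@bounded_integrable _ _ _ _ _ _ 1) => //.
  - by rewrite complete_prod_prob_setT ltry.
  - by move=> w; rewrite normr1.
have E : (\int[PP]_w (1 + cos (\sum_i th i * X n (t i) w + b)) =
    1 + \int[PP]_w cos (\sum_i th i * X n (t i) w + b))%R.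
  by rewrite (RintegralD measurableT i1 ic) Rintegral_cst// complete_prod_prob_setT mul1r.
rewrite -E fineK//; apply: integrable_fin_num => //.
exact: eq_integrable (integrableD measurableT i1 ic).
Qed.

Lemma mean_cos_shift (m : nat) (th t : 'I_m -> R) (b h : R) n :
  (\int[PP]_w cos (\sum_i th i * X n (t i + h) w + b) =
   \int[PP]_w cos (\sum_i th i * X n (t i) w + b))%R.
Proof.
suff : ((1 + \int[PP]_w cos (\sum_i th i * X n (t i + h) w + b))%R%:E =
   (1 + \int[PP]_w cos (\sum_i th i * X n (t i) w + b))%R%:E)%E.
  by move=> [] /addrI.
have mc (t' : 'I_m -> R) :
    measurable_fun setT (fun w => (1 + cos (\sum_i th i * X n (t' i) w + b))%:E).
  apply/measurable_EFinP; apply: measurable_funD => //.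
  by apply: measurable_cos_combination => i; exact: mX.
have c0 (z : R) : (0 <= (1 + cos z)%:E)%E.
  by rewrite lee_fin; have := cos_max z; rewrite ler_norml => /andP[? ?]; lra.
rewrite -(one_cos_integral th (fun i => t i + h)) -(one_cos_integral th t).
rewrite (complete_prod_ge0_integral (mc (fun i => t i + h)))//.
rewrite (complete_prod_ge0_integral (mc t))//.
pose S h' (w : T1 * T2) := \sum_(k < #|{: 'I_m * 'I_n}|)
  let p := enum_val k in let u := uniform_partition (t p.1) n in
  th p.1 * expR (x (u p.2 + h') w.1 - x (t p.1 + h') w.1) *
  (B (u p.2.+1 + h') w.2 - B (u p.2 + h') w.2).
have ES h' w : \sum_i th i * X n (t i + h') w = S h' w by exact: riemann_sum_combination.
transitivity (\int[P1 \x P2]_w (1 + cos (S h w + b))%:E)%E.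
  by apply: eq_integral => w _; rewrite ES.
transitivity (\int[P1 \x P2]_w (1 + cos (S 0%R w + b))%:E)%E; last first.
  by apply: eq_integral => w _; rewrite -ES; under eq_bigr do rewrite addr0.
pose p (k : 'I_#|{: 'I_m * 'I_n}|) : 'I_m * 'I_n := enum_val k.
pose u k := uniform_partition (t (p k).1) n.
have E := functional_shift fB px (fun k => th (p k).1) (fun k => u k (p k).2)
  (fun k => t (p k).1) (fun k => u k (p k).2) (fun k => u k (p k).2.+1) b h.
apply: etrans E _; apply: eq_integral => w _; congr (1 + cos (_ + b))%:E.
by apply: eq_bigr => k _ /=; rewrite !addr0.
Qed.

(** The means of the cosines of linear combinations converge along the Riemann
    sums, for which they are invariant; they determine the joint law. *)
Lemma Ybar_stationary (xi : R -> T1 -> R) (Y : R -> TT -> R) :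
  {ae P1, forall w, forall t, xi t w = x t w} ->
  (forall t : R, 0 <= t -> is_Ybar xi B t (Y t)) ->
  strictly_stationary PP Y.
Proof.
move=> xix hY m t h h0 t0 _ A mA.
have th0 i : 0 <= t i + h by rewrite addr_ge0// ltW.
have cX s : 0 <= s -> cvg_in_probability PP \oo (X ^~ s) (Y s).
  move=> s0; have [_ /(_ _ (uniform_partition_admissible s)) cY] := hY s s0.
  apply: cvg_in_probability_modif xix _ cY.
  by move=> n w /contrapT xw; apply: eq_bigr => i _; rewrite !xw.
have mY s : 0 <= s -> measurable_fun setT (Y s) by move=> /hY[].
have mtup (r : 'I_m -> R) : (forall i, 0 <= r i) ->
    measurable_fun setT (fun w => [tuple Y (r i) w | i < m]).
  move=> r0; apply/measurable_fun_tnthP => i; rewrite (_ : _ \o _ = Y (r i)); first exact: mY.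
  by apply/funext => w /=; rewrite tnth_mktuple.
have fin (r : 'I_m -> R) (r0 : forall i, 0 <= r i) :
    (image_measure PP (mtup r r0) setT < +oo)%E.
  by rewrite /image_measure/= /pushforward preimage_setT complete_prod_prob_setT ltry.
have wave_mean (r : 'I_m -> R) (r0 : forall i, 0 <= r i) th b :
    (\int[image_measure PP (mtup r r0)]_y wave th b y =
     \int[PP]_w cos (\sum_i th i * Y (r i) w + b))%R.
  have mw : measurable_fun setT (EFin \o wave th b).
    apply/measurable_EFinP; apply: measurable_cos_combination => i; exact: measurable_tnth.
  rewrite /Rintegral (integral_pushforward (mtup r r0))//; last first.
    rewrite preimage_setT; apply: (@bounded_integrable _ _ _ _ _ (fun w => wave th b [tuple Y (r i) w | i < m]) 1).
    - by rewrite complete_prod_prob_setT ltry.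
    - exact/measurable_EFinP/(measurableT_comp mw (mtup r r0)).
    - by move=> w; exact: cos_max.
  congr fine; apply: eq_integral => w _ /=; rewrite /wave; congr (cos (_ + b))%:E.
  by apply: eq_bigr => i _; rewrite tnth_mktuple.
apply: (cramer_wold (fin t t0) (fin (fun i => t i + h) th0)) => // th b.
rewrite !wave_mean.
have /= c1 := @cvg_mean_cos _ _ _ PP complete_prod_prob_setT m th (fun i n => X n (t i))
  (fun i => Y (t i)) b (fun i n => @mXc n (t i)) (fun i => mY _ (t0 i)) (fun i => cX _ (t0 i)).
have /= := @cvg_mean_cos _ _ _ PP complete_prod_prob_setT m th (fun i n => X n (t i + h))
  (fun i => Y (t i + h)) b (fun i n => @mXc n (t i + h)) (fun i => mY _ (th0 i)) (fun i => cX _ (th0 i)).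
under eq_fun do rewrite mean_cos_shift.
by move=> c2; exact: (cvg_unique _ c1 c2).
Qed.

End stationarity.

Theorem proposition4p1 (R : realType) (d1 d2 : measure_display)
    (T1 : measurableType d1) (T2 : measurableType d2)
    (P1 : probability T1 R) (P2 : probability T2 R)
    (H : R) (xi : R -> T1 -> R) (B : R -> T2 -> R) :
  2^-1 < H -> H < 1 ->
  fractional_brownian_motion P2 H B ->
  two_sided_levy_process P1 xi ->
  {ae P1, forall w, xi t w @[t --> +oo] --> +oo} ->
  (forall t : R, 0 <= t ->
     exists Yt : complete_product P1 P2 -> R, is_Ybar xi B t Yt) /\
  (forall Y : R -> complete_product P1 P2 -> R,
     (forall t : R, 0 <= t -> is_Ybar xi B t (Y t)) ->
     strictly_stationary (complete_product_prob P1 P2) Y).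
Proof.
move=> H2 H1 fB levy drift.
have [x [px xix]] := regular_modification levy drift.
split=> [t t0|Y hY]; first exact: (exists_Ybar H2 H1 fB px xix t0).
exact: (Ybar_stationary fB px xix hY).
Qed.
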